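(* Suppose that $q$ is even or $|n|_2\ne|q-1|_2$. Let $\nu=1^{n_1}2^{n_2}\cdots$ be a partition of $n$ and let $d=|\gcd(n_1,n_2,\dots)|_2$. Then the number of real conjugacy classes in $PSL_n(q)$ of type $\nu$ is equal to $h_\nu\, psl_\nu$, where $$psl_\nu=\begin{cases}\frac{1}{\gcd(2,q-1)}\prod_{n_i>0}n_{q,n_i}, & |n|_2<|q-1|_2\text{ or }q\text{ is even};\\ sl_\nu, & |n|_2>|q-1|_2,\ d>1\text{ and }q\text{ is odd};\\ \frac12 sl_\nu, & |n|_2>|q-1|_2,\ d=1\text{ and }q\text{ is odd}.\end{cases}$$ Moreover, all real classes in $PSL_n(q)$ are strongly real.
   Context: An element $g$ of a group $G$ is real if $hgh^{-1}=g^{-1}$ for some $h\in G$, and strongly real if $h$ can be chosen with $h^2=1$; a class is (strongly) real if its elements are. For a positive integer $k$, $|k|_2$ is the largest power of $2$ dividing $k$. Type: for $g\in GL_n(q)$, view $\mathbb{F}_q^n$ as an $\mathbb{F}_q[t]$-module with $t$ acting as $g$ and decompose it as $\bigoplus_j\mathbb{F}_q[t]/(f_j^{a_j})$ with $f_j$ monic irreducible. Let $n_i=\sum_{j:a_j=i}\deg f_j$; then $g$ is of type $\nu=1^{n_1}2^{n_2}\cdots$, the partition of $n$ with $n_i$ parts equal to $i$. The type is unchanged by multiplying $g$ by scalars. With $Z=Z(GL_n(q))$, $PSL_n(q)$ is viewed as the image of $SL_n(q)$ in $PGL_n(q)=GL_n(q)/Z$, and $gZ$ (and its class) has the type of $g$.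 For a partition with parts $\nu_1,\dots,\nu_r$, $h_\nu=\gcd(q-1,\nu_1,\dots,\nu_r)$. For $m\ge1$: $n_{q,m}=2q^{(m-1)/2}$ if $q$ odd, $m$ odd; $(q+1)q^{m/2-1}$ if $q$ odd, $m$ even; $q^{(m-1)/2}$ if $q$ even, $m$ odd; $q^{m/2}$ if $q$ even, $m$ even. For $q$ odd, $sl_\nu$ is defined by: - $sl_\nu=\prod_{n_i>0}n_{q,n_i}$ if $n_i=0$ for all odd $i$; - $sl_\nu=\frac12\prod_{n_i>0}n_{q,n_i}$ if there exists $i$ with $i n_i$ odd; - $sl_\nu=f_\nu(q)\prod_{i\text{ odd},\,n_i>0}q^{n_i/2-1}\prod_{i\text{ even},\,n_i>0}n_{q,n_i}$ otherwise, where $f_\nu(q)=\frac{(q+1)^r+(q-1)^r}{2}$ and $r$ here is the number of odd $i$ with $n_i>0$. *)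

(* Defs.v *)
From mathcomp Require Import all_boot all_order all_algebra.
From mathcomp Require Import all_fingroup all_solvable.
From mathcomp Require Import boolp.

Set Implicit Arguments.
Unset Strict Implicit.
Unset Printing Implicit Defensive.

Import GRing.Theory.

Local Open Scope ring_scope.

Section Reality.
Local Open Scope group_scope.
Variables (gT : finGroupType) (G : {set gT}).

Definition real_elt (g : gT) : bool :=
  [exists h in G, h * g * h^-1 == g^-1].

Definition strongly_real_elt (g : gT) : bool :=
  [exists h in G, (h * g * h^-1 == g^-1) && (h ^+ 2 == 1)].

Definition real_class (C : {set gT}) : bool := [forall g in C, real_elt g].

Definition strongly_real_class (C : {set gT}) : bool :=
  [forall g in C, strongly_real_elt g].

End Reality.

Section LinearGroups.
Local Open Scope group_scope.
Variables (n : nat) (F : finFieldType).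

Definition SL : {set {'GL_n[F]}} := [set g | \det (GLval g) == 1%R].

Fact SL_group_set : group_set SL.
Proof.
apply/group_setP; split=> [|g h]; first by rewrite inE GL_1E det1.
by rewrite !inE GL_MxE det_mulmx => /eqP-> /eqP->; rewrite mulr1.
Qed.
Canonical SL_group := Group SL_group_set.

(* The image of SL in GL / Z(GL), and not SL / Z(SL). *)
Definition PSL : {set coset_of 'Z('GL_n[F])} := SL / 'Z('GL_n[F]).
Canonical PSL_group := [group of PSL].

End LinearGroups.

(* Partitions are nonincreasing sequences of positive parts; the multiplicity
   n_i of the part i is [count_mem i nu]. *)
Definition is_partition (n : nat) (nu : seq nat) : bool :=
  [&& sorted geq nu, 0%N \notin nu & sumn nu == n].

Section MatrixType.
Variable F : finFieldType.

(* [g] makes F^m an F[t]-module isomorphic to the direct sum over j of the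
   F[t] / (f_j ^ a_j). The isomorphism is given by its restrictions [phi j] to
   the summands; linearity over F[t] is linearity over F together with
   compatibility with the action of t. As f_j ^ a_j is monic and nonconstant,
   [{poly %/ f j ^+ a j}] is the genuine quotient ring. *)
Definition primary_decomposition (m : nat) (g : 'M[F]_m)
    (k : nat) (f : 'I_k -> {poly F}) (a : 'I_k -> nat) : Prop :=
  (forall j, [/\ f j \is monic, irreducible_poly (f j) & (0 < a j)%N]) /\
  exists phi : forall j, {linear {poly %/ f j ^+ a j} -> 'cV[F]_m},
    (forall j x, phi j ('qX * x) = g *m phi j x) /\
    bijective (fun x : {dffun forall j, {poly %/ f j ^+ a j}} =>
                 \sum_j phi j (x j)).

Definition mx_has_type (m : nat) (g : 'M[F]_m) (nu : seq nat) : Prop :=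
  exists (k : nat) (f : 'I_k -> {poly F}) (a : 'I_k -> nat),
    primary_decomposition g f a /\
    forall i, count_mem i nu = (\sum_(j | a j == i) (size (f j)).-1)%N.

Definition PGL_has_type (n : nat) (x : coset_of 'Z('GL_n[F])) (nu : seq nat) :
    Prop :=
  exists2 g : {'GL_n[F]}, x = coset 'Z('GL_n[F]) g & mx_has_type (GLval g) nu.

Definition class_has_type (n : nat) (C : {set coset_of 'Z('GL_n[F])})
    (nu : seq nat) : Prop :=
  forall x, x \in C -> PGL_has_type x nu.

End MatrixType.

Definition hpart (q : nat) (nu : seq nat) : nat :=
  gcdn q.-1 (\big[gcdn/0%N]_(i <- nu) i).

(* For m > 0, all halvings below are exact. *)
Definition nq (q m : nat) : nat :=
  (if odd q then
     if odd m then 2 * q ^ (m.-1)./2 else q.+1 * q ^ (m./2).-1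
   else
     if odd m then q ^ (m.-1)./2 else q ^ m./2)%N.

(* The indices i with n_i > 0 are the elements of [undup nu]. *)
Definition fnu (q : nat) (nu : seq nat) : rat :=
  let r := count odd (undup nu) in
  ((q%:R + 1) ^+ r + (q%:R - 1) ^+ r) / 2%:R.

Definition sl (q : nat) (nu : seq nat) : rat :=
  if ~~ has odd nu then
    \prod_(i <- undup nu) (nq q (count_mem i nu))%:R
  else if has (fun i => odd (i * count_mem i nu)%N) nu then
    2%:R^-1 * \prod_(i <- undup nu) (nq q (count_mem i nu))%:R
  else
    (* here n_i is even for every odd i *)
    fnu q nu * \prod_(i <- undup nu | odd i)
                  (q ^ ((count_mem i nu)./2).-1)%N%:R
             * \prod_(i <- undup nu | ~~ odd i)
                  (nq q (count_mem i nu))%:R.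

Definition dpart (nu : seq nat) : nat :=
  ((\big[gcdn/0]_(i <- undup nu) count_mem i nu)`_2)%N.

(* Under the standing hypothesis "q even or |n|_2 <> |q - 1|_2", the last two
   cases are those with q odd and |n|_2 > |q - 1|_2. *)
Definition psl (q n : nat) (nu : seq nat) : rat :=
  if (n`_2 < (q.-1)`_2)%N || ~~ odd q then
    (gcdn 2 q.-1)%:R^-1 * \prod_(i <- undup nu) (nq q (count_mem i nu))%:R
  else if (1 < dpart nu)%N then sl q nu
  else 2%:R^-1 * sl q nu.

(* Main.v *)
(* Scalars aside, real classes of PSL_n(q) come from matrices g with
   M g M^-1 = z g^-1 for some M and some z <> 0, and with det g an n-th power.
   - Strong reality. M permutes the primary summands of g, and M can be replaced
     by an involution h that exchanges them in pairs, up to the substitution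
     t -> z / t. It remains to arrange that det h is an n-th power. This is
     automatic if -1 is one. Otherwise 4 divides n; if z is not a square, then
     (h g)^2 = z gives the determinant of h g; if z is a square, assume z = 1:
     either a summand of odd exponent for t - 1 or t + 1 allows a sign change, or
     s = g - g^-1, which anticommutes with h, forces the two eigenspaces of h to
     have the same dimension.
   - Counting. Let h_nu be as in the theorem, and let T be the group of the c that
     commute with g up to scalars. The determinants of the elements of T are the
     gcd(nu_j)-th powers: the centralizer provides these because norms are
     surjective, and the commutation up to scalars with g, hence commutation with
     g^e - 1 for a suitable e, excludes others. So SL contains h_nu / (q - 1) of T.
     Counting pairs then shows that the number of classes is h_nu / (q - 1) times
     the sum over z of the number of GL_n(q)-classes of the given type whose
     elements are conjugate to z g^-1. Those classes correspond to tuples of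
     monic polynomials u_i of degree n_i that are stable under
     f(t) -> t^(n_i) f(z / t) / f(0), subject to a condition on the determinant, a
     product of signs times powers of z; the signs are counted by the expansion
     of prod_i (A_i + B_i) + prod_i (A_i + (-1)^i B_i). *)

From HB Require Import structures.
Require Import Defs.
From mathcomp Require Import all_boot all_order all_algebra.
From mathcomp Require Import all_fingroup all_solvable all_field.
From mathcomp Require Import boolp zify ring.

Set Implicit Arguments.
Unset Strict Implicit.
Unset Printing Implicit Defensive.

Import GRing.Theory.

Local Open Scope ring_scope.

(** * Cyclic and primary decompositions *)

(** A class of PSL corresponds to several similarity classes of matrices, and a matrix may be
    similar to some of its own scalar multiples; listing classes by representatives would require
    this fusion. Counting pairs avoids it: the number of classes times the group order is the sum of
    the centralizer orders, which can be taken over matrices [g]. The elements inverting [g] modulo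
    scalars, if any, form a coset of the commutant of [g] up to scalars, hence are as numerous; they
    split according to the scalar [z], and each nonempty piece is a coset of the ordinary
    centralizer, which brings back similarity classes.

    This needs that being real in PSL is the same as being inverted by some element of PGL, so the
    involutions with controlled determinant serve the count as much as strong reality. For [q] odd
    the hypothesis acts through [n]-th powers: if |n|_2 < |q-1|_2, then -1 is one; if |n|_2 >
    |q-1|_2, then -1 is not one, but 4 divides n and every (n/2)-th power of a nonzero scalar is
    one. *)

Section PolyOfMatrix.
Variables (F : fieldType).

(** Given by coefficients so that dimension 0 is included, where the matrices form the zero ring; in
    positive dimension this is [horner_mx]. *)
Definition pmx n (g : 'M[F]_n) (p : {poly F}) : 'M[F]_n :=
  \sum_(i < size p) p`_i *: g ^+ i.

Lemma pmxE n (g : 'M[F]_n.+1) p : pmx g p = horner_mx g p.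
Proof.
rewrite -[in RHS](coefK p) poly_def rmorph_sum; apply: eq_bigr => i _ /=.
by rewrite linearZ rmorphXn /= horner_mx_X.
Qed.

Lemma pmx_is_linear n (g : 'M[F]_n) : linear (pmx g).
Proof.
move=> a p q; case: n g => [|n] g; first by rewrite !flatmx0.
by rewrite !pmxE linearP.
Qed.
HB.instance Definition _ n (g : 'M[F]_n) :=
  GRing.isLinear.Build F {poly F} 'M[F]_n *:%R (pmx g) (@pmx_is_linear n g).

Lemma pmxM n (g : 'M[F]_n) p q : pmx g (p * q) = pmx g p *m pmx g q.
Proof. by case: n g => [|n] g; rewrite ?flatmx0 // !pmxE rmorphM. Qed.

Lemma pmxC n (g : 'M[F]_n) c : pmx g c%:P = c%:M.
Proof. by case: n g => [|n] g; rewrite ?flatmx0 // pmxE horner_mx_C. Qed.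

Lemma pmx1 n (g : 'M[F]_n) : pmx g 1 = 1%:M. Proof. exact: pmxC. Qed.

Lemma pmxX n (g : 'M[F]_n) : pmx g 'X = g.
Proof. by case: n g => [|n] g; rewrite ?(flatmx0 g) ?flatmx0 // pmxE horner_mx_X. Qed.

Lemma pmxXn n (g : 'M[F]_n) k : pmx g 'X^k = g ^+ k.
Proof.
elim: k => [|k IHk]; first by rewrite !expr0 pmx1.
by rewrite exprS pmxM pmxX IHk exprS.
Qed.

Lemma pmx_exp n (g : 'M[F]_n) p k : pmx g (p ^+ k) = pmx g p ^+ k.
Proof.
elim: k => [|k IHk]; first by rewrite !expr0 pmx1.
by rewrite exprS pmxM IHk exprS.
Qed.

Lemma pmx_comm n (g : 'M[F]_n) p q : pmx g p *m pmx g q = pmx g q *m pmx g p.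
Proof. by rewrite -!pmxM mulrC. Qed.

Lemma pmx_intertwine m n (M : 'M[F]_(m, n)) g g' p :
  M *m g = g' *m M -> M *m pmx g p = pmx g' p *m M.
Proof.
move=> Mg; rewrite mulmx_sumr mulmx_suml; apply: eq_bigr => i _.
rewrite -scalemxAr -scalemxAl; congr (_ *: _).
elim: (i : nat) => [|k IHk]; first by rewrite !expr0 mulmx1 mul1mx.
by rewrite !exprSr [RHS]/= mulmxA IHk -!mulmxA Mg.
Qed.

Lemma pmx_block m n (A : 'M[F]_m) (B : 'M[F]_n) p :
  pmx (block_mx A 0 0 B) p = block_mx (pmx A p) 0 0 (pmx B p).
Proof.
have bX k : block_mx A 0 0 B ^+ k = block_mx (A ^+ k) 0 0 (B ^+ k).
  elim: k => [|k IHk]; first by rewrite !expr0 [LHS]scalar_mx_block.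
  by rewrite !exprS IHk [LHS]mulmx_block !mulmx0 !mul0mx !addr0 !add0r.
elim/poly_ind: p => [|p c IHp]; first by rewrite !linear0 /block_mx !row_mx0 col_mx0.
rewrite !linearD /= !pmxM !pmxX IHp !pmxC scalar_mx_block mulmx_block add_block_mx.
by rewrite !mulmx0 !mul0mx !addr0 !add0r.
Qed.

Lemma pmx_char n (g : 'M[F]_n) : pmx g (char_poly g) = 0.
Proof. by case: n g => [|n] g; rewrite ?flatmx0 // pmxE Cayley_Hamilton. Qed.

End PolyOfMatrix.

Section CyclicDecomposition.
Variables (F : fieldType).

Definition lincomb n (g : 'M[F]_n) (I : finType) (v : I -> 'cV[F]_n)
    (p : I -> {poly F}) : 'cV[F]_n := \sum_j pmx g (p j) *m v j.

(* [F^n], as an [F[t]]-module through [g], is the direct sum of the cyclic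
   submodules generated by the [v j], with annihilators [(h j)]. *)
Definition cyclic_dec n (g : 'M[F]_n) (I : finType) (v : I -> 'cV[F]_n)
    (h : I -> {poly F}) : Prop :=
  (forall p, lincomb g v p = 0 <-> forall j, h j %| p j) /\
  (forall x, exists p, x = lincomb g v p).

Lemma lincombB n (g : 'M[F]_n) (I : finType) (v : I -> 'cV[F]_n) p q :
  lincomb g v (fun j => p j - q j) = lincomb g v p - lincomb g v q.
Proof. by rewrite -sumrB; apply: eq_bigr => j _; rewrite linearB mulmxBl. Qed.

Lemma lincombM n (g : 'M[F]_n) (I : finType) (v : I -> 'cV[F]_n) q p :
  lincomb g v (fun j => q * p j) = pmx g q *m lincomb g v p.
Proof. by rewrite mulmx_sumr; apply: eq_bigr => j _; rewrite pmxM mulmxA. Qed.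

Lemma lincomb_delta n (g : 'M[F]_n) (I : finType) (v : I -> 'cV[F]_n) j p :
  lincomb g v (fun i => if i == j then p else 0) = pmx g p *m v j.
Proof.
rewrite /lincomb (bigD1 j) //= eqxx big1 ?addr0 // => i /negPf->.
by rewrite linear0 mul0mx.
Qed.

Lemma eq_lincomb n (g : 'M[F]_n) (I : finType) (v : I -> 'cV[F]_n) p q :
  p =1 q -> lincomb g v p = lincomb g v q.
Proof. by move=> epq; apply: eq_bigr => j _; rewrite epq. Qed.

Section Dec.
Variables (n : nat) (g : 'M[F]_n) (I : finType).
Variables (v : I -> 'cV[F]_n) (h : I -> {poly F}).
Hypothesis dec : cyclic_dec g v h.

Lemma dec_ann j : pmx g (h j) *m v j = 0.
Proof.
rewrite -lincomb_delta; apply/(proj1 dec) => i.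
by case: eqP => [->|]; rewrite ?dvdp0.
Qed.

(** Universal property of a direct sum of cyclic modules: generators may be sent to any vectors
    killed by the same annihilators. *)
Lemma dec_universal m (g' : 'M[F]_m) (w : I -> 'cV[F]_m) :
    (forall j, pmx g' (h j) *m w j = 0) ->
  exists M : 'M[F]_(m, n), forall p, M *m lincomb g v p = lincomb g' w p.
Proof.
move=> w_ann; have [lin0 gen] := dec.
have [P defP] := choice (fun k : 'I_n => gen (delta_mx k 0)).
(* Column [k] is the image of the [k]-th basis vector, expanded by a chosen [P k]. Another expansion
   differs by multiples of the [h j], which kill the [w j]. *)
exists (\matrix_(i, k) lincomb g' w (P k) i 0) => p.
set x := lincomb g v p.
have lin_sum m' (g1 : 'M[F]_m') (u : I -> 'cV[F]_m') :
    lincomb g1 u (fun j => \sum_k x k 0 *: P k j) = \sum_k x k 0 *: lincomb g1 u (P k).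
  under [RHS]eq_bigr do rewrite scaler_sumr.
  rewrite exchange_big; apply: eq_bigr => j _ /=.
  rewrite linear_sum mulmx_suml; apply: eq_bigr => k _.
  by rewrite linearZ scalemxAl.
have ->: (\matrix_(i, k) lincomb g' w (P k) i 0) *m x
    = \sum_k x k 0 *: lincomb g' w (P k).
  apply/colP => i; rewrite !mxE summxE; apply: eq_bigr => k _.
  by rewrite !mxE mulrC.
rewrite -lin_sum; apply/eqP; rewrite -subr_eq0 -lincombB; apply/eqP.
rewrite [LHS]big1 // => j _; have /dvdpP[q ->] : h j %| \sum_k x k 0 *: P k j - p j.
  move: j; apply/lin0; rewrite lincombB lin_sum; apply/eqP; rewrite subr_eq0; apply/eqP.
  rewrite -/x; transitivity (\sum_k x k 0 *: (delta_mx k 0 : 'cV[F]_n)).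
    by apply: eq_bigr => k _; rewrite -defP.
  by rewrite [RHS]matrix_sum_delta; apply: eq_bigr => k _; rewrite big_ord1.
by rewrite pmxM -mulmxA w_ann mulmx0.
Qed.

Lemma dec_eq m (M M' : 'M[F]_(m, n)) :
  (forall p, M *m lincomb g v p = M' *m lincomb g v p) -> M = M'.
Proof.
move=> eqM; apply/matrixP => i k; have [p pE] := proj2 dec (delta_mx k 0).
have /colP/(_ i) := eqM p; rewrite -pE !mxE (bigD1 k) //= mxE !eqxx mulr1.
rewrite [in RHS](bigD1 k) //= mxE !eqxx mulr1 !big1 ?addr0 // => l /negPf lk;
  by rewrite mxE lk mulr0.
Qed.

End Dec.

Lemma dec_isom n (g : 'M[F]_n) (I : finType) (v : I -> 'cV[F]_n) h
    m (g' : 'M[F]_m) (w : I -> 'cV[F]_m) :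
    cyclic_dec g v h -> cyclic_dec g' w h ->
  exists M : 'M[F]_(m, n), exists M' : 'M[F]_(n, m),
    [/\ M *m M' = 1%:M, M' *m M = 1%:M,
        forall p, M *m lincomb g v p = lincomb g' w p & M *m g = g' *m M].
Proof.
move=> dv dw; have [M MP] := dec_universal dv (dec_ann dw).
have [M' MP'] := dec_universal dw (dec_ann dv).
exists M, M'; split=> //.
- by apply: (dec_eq dw) => p; rewrite -mulmxA MP' MP mul1mx.
- by apply: (dec_eq dv) => p; rewrite -mulmxA MP MP' mul1mx.
apply: (dec_eq dv) => p; rewrite -!mulmxA MP -{1}(pmxX g) -lincombM MP.
by rewrite lincombM pmxX.
Qed.

Lemma dec_intertwine n (g : 'M[F]_n) (I : finType) (v : I -> 'cV[F]_n) h
    m (g' : 'M[F]_m) (M : 'M[F]_(m, n)) (M' : 'M[F]_(n, m)) :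
    M *m M' = 1%:M -> M' *m M = 1%:M -> M *m g = g' *m M -> cyclic_dec g v h ->
  cyclic_dec g' (fun j => M *m v j) h.
Proof.
move=> MM' M'M Mg [lin0 gen].
have linM p : lincomb g' (fun j => M *m v j) p = M *m lincomb g v p.
  rewrite mulmx_sumr; apply: eq_bigr => j _.
  by rewrite mulmxA -(pmx_intertwine _ Mg) mulmxA.
split=> [p|x].
  rewrite linM -lin0; split=> [|->]; last by rewrite mulmx0.
  by move/(congr1 (mulmx M')); rewrite mulmxA M'M mul1mx mulmx0.
by have [p pE] := gen (M' *m x); exists p; rewrite linM -pE mulmxA MM' mul1mx.
Qed.

Lemma dec_reindex n (g : 'M[F]_n) (I J : finType) (v : I -> 'cV[F]_n) h
    (s : J -> I) : bijective s ->
  cyclic_dec g v h -> cyclic_dec g (v \o s) (h \o s).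
Proof.
case=> t sK tK [lin0 gen].
have linE p : lincomb g (v \o s) p = lincomb g v (p \o t).
  rewrite /lincomb (reindex s) /=; last by exists t => i _.
  by apply: eq_bigr => j _; rewrite sK.
split=> [p|x].
  rewrite linE lin0; split=> hp j; last by have := hp (t j); rewrite /= tK.
  by have := hp (s j); rewrite /= sK.
have [p pE] := gen x; exists (p \o s); rewrite linE pE; apply: eq_lincomb => j /=.
by rewrite tK.
Qed.

End CyclicDecomposition.

(** * Unique factorization into monic irreducible polynomials *)

Section Factorization.
Variable F : fieldType.
Implicit Types p q f : {poly F}.

Definition monic_irred f := irreducible_poly f /\ f \is monic.

Lemma monic_irred_size f : monic_irred f -> (1 < size f)%N.
Proof. by case=> [[]]. Qed.

Lemma monic_irred_neq0 f : monic_irred f -> f != 0.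
Proof. by case=> _ /monic_neq0. Qed.

Lemma exp_monic_irred_neq0 f k : monic_irred f -> f ^+ k != 0.
Proof. by move=> fI; rewrite expf_neq0 // monic_irred_neq0. Qed.

Lemma monic_irred_coprime f p : monic_irred f -> coprimep f p = ~~ (f %| p).
Proof. by case=> fI _; apply: irreducible_poly_coprime. Qed.

Lemma monic_irred_dvd f f' : monic_irred f -> monic_irred f' -> (f %| f') = (f == f').
Proof.
move=> [[sf fI] fm] [[sf' fI'] fm']; apply/idP/eqP => [|->]; last exact: dvdpp.
have sf1 : size f != 1%N by rewrite neq_ltn sf orbT.
by move=> /(fI' _ sf1); rewrite eqp_monic // => /eqP.
Qed.

Lemma monic_irred_dvdM f p q : monic_irred f -> (f %| p * q) = (f %| p) || (f %| q).
Proof.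
move=> fI; have [fp|fp] /= := boolP (f %| p); first exact: dvdp_mulr.
by rewrite Gauss_dvdpr // monic_irred_coprime.
Qed.

Lemma monic_irred_dvdX f p k : monic_irred f -> f %| p ^+ k -> f %| p.
Proof.
move=> fI; elim: k => [|k IHk]; last first.
  by rewrite exprS monic_irred_dvdM // => /orP[].
rewrite expr0 dvdp1; have := monic_irred_size fI.
by case: eqP => // ->.
Qed.

Lemma monic_irred_prod f (s : seq {poly F}) :
    monic_irred f -> {in s, forall g, monic_irred g} ->
  (f %| \prod_(g <- s) g) = (f \in s).
Proof.
move=> fI; elim: s => [|g s IHs] sI.
  by rewrite big_nil dvdp1 in_nil; apply/negbTE; have := monic_irred_size fI; case: ltngtP.
rewrite big_cons monic_irred_dvdM // in_cons IHs; last first.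
  by move=> g' g's; apply: sI; rewrite in_cons g's orbT.
by rewrite monic_irred_dvd //; apply: sI; rewrite mem_head.
Qed.

Lemma monic_factor_exists p : (1 < size p)%N -> exists2 f, monic_irred f & f %| p.
Proof.
elim: {p}(size p).+1 {-2}p (ltnSn (size p)) => // k IHk p spk sp.
have p0 : p != 0 by rewrite -size_poly_gt0 ltnW.
have c0 : (lead_coef p)^-1 != 0 by rewrite invr_eq0 lead_coef_eq0.
have [pI|] := asboolP (irreducible_poly p).
  exists ((lead_coef p)^-1 *: p); last by rewrite dvdpZl.
  split; last by rewrite monicE lead_coefZ mulVf // lead_coef_eq0.
  split=> [|q sq]; first by rewrite size_scale.
  by rewrite dvdpZr // eqp_sym => /(pI.2 _ sq); rewrite (eqp_ltrans (eqp_scale _ c0)) eqp_sym.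
move=> /not_andP[//|/existsNP[q /not_implyP[sq /not_implyP[qp nqp]]]].
have q0 : q != 0 by apply: contraNneq p0 => q0; rewrite q0 dvd0p in qp.
have sqp : (size q < size p)%N.
  rewrite ltn_neqAle dvdp_leq // andbT; apply/negP => sqp; apply: nqp.
  by rewrite -dvdp_size_eqp.
have sq1 : (1 < size q)%N by rewrite ltn_neqAle eq_sym sq size_poly_gt0.
have [f fI fq] := IHk q (leq_trans sqp spk) sq1.
by exists f => //; apply: dvdp_trans qp.
Qed.

Lemma monic_factorization p : p \is monic ->
  exists2 s : seq {poly F}, {in s, forall f, monic_irred f} & p = \prod_(f <- s) f.
Proof.
elim: {p}(size p).+1 {-2}p (ltnSn (size p)) => // k IHk p spk pm.
have [sp1|sp1] := leqP (size p) 1.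
  exists [::]; rewrite // big_nil; have /monicP := pm.
  by rewrite [p]size1_polyC // lead_coefC => ->.
have [f fI /dvdpP[q pE]] := monic_factor_exists sp1.
have qm : q \is monic by rewrite -(monicMr q fI.2) -pE.
have sq : (size q < size p)%N.
  rewrite pE size_Mmonic ?monic_neq0 // ?fI.2 //.
  by have := monic_irred_size fI; case: (size f) => // -[|m] // _; rewrite !addnS /= ltnS leq_addr.
have [s sI qE] := IHk q (leq_trans sq spk) qm.
exists (f :: s); last by rewrite big_cons -qE mulrC.
by move=> g; rewrite in_cons => /orP[/eqP->|/sI].
Qed.

Lemma monic_factorization_uniq (s1 s2 : seq {poly F}) :
    {in s1, forall f, monic_irred f} -> {in s2, forall f, monic_irred f} ->
  \prod_(f <- s1) f = \prod_(f <- s2) f -> perm_eq s1 s2.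
Proof.
elim: s1 s2 => [|f s1 IHs] s2 s1I s2I.
  rewrite big_nil; case: s2 s2I => // g s2 s2I e1.
  have gI : monic_irred g by apply: s2I; rewrite mem_head.
  have := monic_irred_prod gI s2I; rewrite -e1 mem_head dvdp1.
  by have := monic_irred_size gI; case: eqP => // ->.
have fI : monic_irred f by apply: s1I; rewrite mem_head.
move=> e12; have fs2 : f \in s2.
  by rewrite -monic_irred_prod // -e12 big_cons dvdp_mulr.
suff s12 : perm_eq s1 (rem f s2).
  by rewrite perm_sym; apply: perm_trans (perm_to_rem fs2) _; rewrite perm_cons perm_sym.
apply: IHs.
- by move=> g gs; apply: s1I; rewrite in_cons gs orbT.
- by move=> g /mem_rem; apply: s2I.
by move: e12; rewrite (perm_big _ (perm_to_rem fs2)) !big_cons => /(mulfI (monic_irred_neq0 fI)).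
Qed.

(** This is the dimension of the kernel of [f ^+ i] on F[t]/(f'^a). For f' = f it is piecewise
    linear in [i] with its only bend at [a], so kernel sizes reveal exponents. *)
Lemma size_gcdp_primary f f' a i : monic_irred f -> monic_irred f' ->
  (size (gcdp (f' ^+ a) (f ^+ i))).-1 = ((f' == f) * ((size f).-1 * minn a i))%N.
Proof.
move=> fI fI'; case: eqP => [->|/eqP ff']; last first.
  apply/eqP; rewrite mul0n -(eqn_add2r 1) addn1 add0n prednK; last first.
    by rewrite size_poly_gt0 gcdp_eq0 !expf_eq0 !negb_and !monic_irred_neq0 // !orbT.
  rewrite -/(_ == _) -[_ == _]coprimep_def coprimep_expl // coprimep_expr //.
  by rewrite monic_irred_coprime // monic_irred_dvd.
rewrite mul1n -size_exp; congr (_.-1); have [ai|ia] := leqP a i.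
  by apply: eqp_size; rewrite dvdp_gcd_idl // dvdp_exp2l.
by apply: eqp_size; rewrite dvdp_gcd_idr // dvdp_exp2l // ltnW.
Qed.

End Factorization.

(** On F[t]/(h) the kernel of [p] consists of the multiples of h / gcd(h, p), so its dimension is
    the degree of the gcd. *)
Lemma dec_card_ker (F : finFieldType) n (g : 'M[F]_n) (I : finType)
    (v : I -> 'cV[F]_n) h p :
    (forall j, h j != 0) -> cyclic_dec g v h ->
  #|[set x : 'cV[F]_n | pmx g p *m x == 0]|
    = (#|F| ^ \sum_j (size (gcdp (h j) p)).-1)%N.
Proof.
move=> h0 [lin0 gen]; pose d j := gcdp (h j) p; pose e j := h j %/ d j.
have d0 j : d j != 0 by rewrite gcdp_eq0 negb_and h0.
have hE j : h j = e j * d j by rewrite divpK ?dvdp_gcdl.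
have e0 j : e j != 0 by apply: contraNneq (h0 j); rewrite hE => ->; rewrite mul0r.
have dvd_hp j q : (h j %| p * q) = (e j %| q).
  rewrite [h j]hE -[p in p * q](divpK (dvdp_gcdr (h j) p)) mulrAC dvdp_mul2r //.
  by rewrite Gauss_dvdpr // coprimep_div_gcd // h0.
(* An element of the kernel has exactly one expression with coefficients [e j * r j] where [r j] has
   smaller degree than [d j]. *)
pose T := {dffun forall j, {poly_((size (d j)).-1) F}}.
pose psi (r : T) := lincomb g v (fun j => e j * r j).
have psiI : injective psi.
  move=> r s /eqP; rewrite -subr_eq0 -lincombB => /eqP/lin0 rs.
  apply/ffunP => j; apply/val_inj/eqP; rewrite /= -subr_eq0; have := rs j.
  rewrite -mulrBr hE dvdp_mul2l //; apply: contraTT => rs0.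
  apply/negP => /(dvdp_leq rs0); apply/negP; rewrite -ltnNge.
  have sd : (0 < size (d j))%N by rewrite size_poly_gt0.
  apply: leq_ltn_trans (size_polyD _ _) _.
  have lt_d (q : {poly_((size (d j)).-1) F}) : (size q < size (d j))%N.
    by rewrite (leq_ltn_trans (size_npoly q)) // ltn_predL.
  by rewrite size_polyN gtn_max !lt_d.
have -> : [set x : 'cV[F]_n | pmx g p *m x == 0] = psi @: [set: T].
  apply/setP => x; rewrite inE; apply/eqP/imsetP => [px0|[r _ ->]]; last first.
    by rewrite -lincombM; apply/lin0 => j; rewrite dvd_hp dvdp_mulr.
  have [q xE] := gen x; move: px0; rewrite xE -lincombM => /lin0 eq_.
  have {}eq_ j : e j %| q j by rewrite -dvd_hp.
  exists [ffun j => @npolyp F _ ((q j %/ e j) %% d j)] => //.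
  apply/eqP; rewrite -subr_eq0 -lincombB; apply/eqP/lin0 => j.
  rewrite ffunE npolypK; last first.
    by rewrite -ltnS prednK ?size_poly_gt0 // ltn_modp.
  rewrite -{1}(divpK (eq_ j)) {1}(divp_eq (q j %/ e j) (d j)) mulrDl [_ %% _ * _]mulrC addrK.
  by rewrite -mulrA [d j * _]mulrC -hE dvdp_mull.
rewrite card_imset // cardsT card_dep_ffun foldrE big_map big_enum /=.
rewrite expn_sum; apply: eq_bigr => j _; exact: card_npoly.
Qed.

Lemma dec_dim (F : finFieldType) n (g : 'M[F]_n) (I : finType)
    (v : I -> 'cV[F]_n) h :
  (forall j, h j != 0) -> cyclic_dec g v h -> \sum_j (size (h j)).-1 = n.
Proof.
move=> h0 dv; apply/eqP; rewrite -(eqn_exp2l _ _ (finNzRing_gt1 F)).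
have := dec_card_ker 0 h0 dv; under eq_bigr do rewrite gcdp0.
move=> <-; rewrite -[n in X in _ == X]muln1 -card_mx; apply/eqP/eq_card => x.
by rewrite inE linear0 mul0mx eqxx.
Qed.

(** Each element goes to the one of the same rank in the enumeration of the opposite fiber. Ranks
    being preserved, this is an involution, and it is the identity on a fiber that is its own
    opposite. *)
Lemma fiber_involution (T : eqType) (I : finType) (k : I -> T) (star : T -> T) :
    (forall i, star (star (k i)) = k i) ->
    (forall i, #|[pred j | k j == star (k i)]| = #|[pred j | k j == k i]|) ->
  exists s : I -> I, [/\ involutive s, forall i, k (s i) = star (k i) &
    forall i, star (k i) = k i -> s i = i].
Proof.
move=> starK eq_card; pose fib x := enum [pred j | k j == x].
pose s i := nth i (fib (star (k i))) (index i (fib (k i))).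
have fib_i i : i \in fib (k i) by rewrite mem_enum inE.
have s_ok i : (index i (fib (k i)) < size (fib (star (k i))))%N.
  by rewrite -cardE eq_card cardE index_mem.
have ks i : k (s i) = star (k i).
  by have := mem_nth i (s_ok i); rewrite mem_enum inE => /eqP.
exists s; split=> // i; last by move=> ki; rewrite /s ki nth_index.
rewrite {1}/s ks starK (set_nth_default i) /s.
  by rewrite index_uniq ?s_ok ?enum_uniq // nth_index.
rewrite index_uniq ?s_ok ?enum_uniq //.
by rewrite index_mem.
Qed.

(** An instance of [fiber_involution] on the disjoint union, where [star] flips a flag that records
    the side. *)
Lemma fiber_bijection (T : eqType) (I J : finType) (k : I -> T) (l : J -> T) :
    (forall x, #|[pred i | k i == x]| = #|[pred j | l j == x]|) ->
  exists2 s : I -> J, bijective s & forall i, l (s i) = k i.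
Proof.
move=> eq_card.
pose kl (u : I + J) := match u with inl i => (k i, true) | inr j => (l j, false) end.
have card_kl x b : #|[pred u | kl u == (x, b)]|
    = if b then #|[pred i | k i == x]| else #|[pred j | l j == x]|.
  rewrite -!sum1_card big_sumType /=; case: b; last rewrite [X in (X + _)%N]big_pred0 ?add0n.
  - rewrite [X in (_ + X)%N]big_pred0 ?addn0; last by move=> i; rewrite inE /= xpair_eqE andbF.
    by apply: eq_bigl => i; rewrite !inE /= xpair_eqE andbT.
  - by apply: eq_bigl => i; rewrite !inE /= xpair_eqE andbT.
  - by move=> i; rewrite inE /= xpair_eqE andbF.
have [|u|s [sK ks _]] := @fiber_involution _ (I + J)%type kl (fun x => (x.1, ~~ x.2)).
- by case=> i.
- by case: (kl u) => x b /=; rewrite !card_kl eq_card; case: b.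
have s_l i : {j | s (inl i) = inr j}.
  by have := ks (inl i); case: (s (inl i)) => // j _; exists j.
have s_r j : {i | s (inr j) = inl i}.
  by have := ks (inr j); case: (s (inr j)) => // i _; exists i.
exists (fun i => sval (s_l i)) => [|i].
  exists (fun j => sval (s_r j)) => [i|j].
    by case: (s_l i) => j /= ij; case: (s_r j) => i' /=; rewrite -ij sK => -[].
  by case: (s_r j) => i /= ji; case: (s_l i) => j' /=; rewrite -ji sK => -[].
by case: (s_l i) => j /= ij; have := ks (inl i); rewrite ij => -[].
Qed.

(** * Existence of the primary decomposition *)

Section PrimaryDecomposition.
Variable F : fieldType.

Definition primary_dec n (g : 'M[F]_n) (I : finType) (v : I -> 'cV[F]_n)
    (f : I -> {poly F}) (a : I -> nat) : Prop :=
  (forall j, monic_irred (f j) /\ (0 < a j)%N) /\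
  cyclic_dec g v (fun j => f j ^+ a j).

Section Reduction.
Variables (n : nat) (g : 'M[F]_n) (I : finType) (f : I -> {poly F}).
Hypothesis fI : forall j, monic_irred (f j).

(* A relation in which some term is nonzero yields a nonzero relation that
   involves a single prime [f i]; dividing it by the least power of [f i] occurring
   in its coefficients gives an element that can replace one of the generators and
   has a smaller annihilator. *)
Lemma reduce_generators (v : I -> 'cV[F]_n) (a : I -> nat) :
    (forall j, pmx g (f j ^+ a j) *m v j = 0) ->
    (forall x, exists p, x = lincomb g v p) ->
    ~ (forall p, lincomb g v p = 0 -> forall j, f j ^+ a j %| p j) ->
  exists v' a', [/\ (forall j, pmx g (f j ^+ a' j) *m v' j = 0),
    (forall x, exists p, x = lincomb g v' p) & (\sum_j a' j < \sum_j a j)%N].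
Proof.
move=> ann gen /existsNP[p /not_implyP[p0 /existsNP[i0 /negP pi0]]].
pose f0 := f i0; have f0I := fI i0.
(* [u] kills the generators at the other primes and is invertible modulo powers of [f0], so
   multiplying by it isolates [f0] without losing the relation. *)
pose u := \prod_(j | f j != f0) f j ^+ a j.
have u_f0 : coprimep f0 u.
  rewrite /u; elim/big_rec: _ => [|j q jf0 IHq]; first exact: coprimep1.
  rewrite coprimepMr IHq andbT coprimep_expr // monic_irred_coprime //.
  by rewrite monic_irred_dvd // eq_sym.
pose r j := if (f j == f0) && ~~ (f j ^+ a j %| p j) then u * p j else 0.
have r0 : lincomb g v r = 0.
  rewrite -[RHS](mulmx0 _ (pmx g u)) -p0 -lincombM; apply: eq_bigr => j _.
  rewrite /r; case: ifP => // /negbT; rewrite negb_and negbK linear0 mul0mx => jP.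
  have /dvdpP[q ->] : f j ^+ a j %| u * p j; last by rewrite pmxM -mulmxA ann mulmx0.
  by case/orP: jP => [jf0|]; [rewrite /u (bigD1 j) //= -mulrA dvdp_mulr|exact: dvdp_mull].
have rP j : r j != 0 -> f j = f0 /\ ~~ (f0 ^+ a j %| r j).
  rewrite /r; case: ifP => [/andP[/eqP jf0 pj] _|]; last by rewrite eqxx.
  by split=> //; rewrite Gauss_dvdpr -?jf0 // coprimep_expl // jf0.
have exP : exists k, [exists j, ~~ (f0 ^+ k.+1 %| r j)].
  exists (a i0).-1; apply/existsP; exists i0; rewrite /r eqxx pi0 /=.
  have [a0|a0] := posnP (a i0); first by rewrite a0 dvd1p in pi0.
  by rewrite prednK // Gauss_dvdpr // coprimep_expl.
case: (ex_minnP exP) => b /existsP[j0 rj0] b_min.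
have b_dvd j : f0 ^+ b %| r j.
  case: b b_min {rj0} => [|b] b_min; first exact: dvd1p.
  by apply: contraT => nb; have := b_min b; rewrite ltnn => -> //; apply/existsP; exists j.
have [fj0 aj0] : f j0 = f0 /\ ~~ (f0 ^+ a j0 %| r j0).
  by apply: rP; apply: contraNneq rj0 => ->; rewrite dvdp0.
have b_lt : (b < a j0)%N.
  rewrite ltnNge; apply: contra aj0 => ab; apply: dvdp_trans (b_dvd j0).
  exact: dvdp_exp2l.
pose c j := r j %/ f0 ^+ b.
have rE j : r j = f0 ^+ b * c j by rewrite mulrC divpK.
have c_f0 : coprimep (f0 ^+ a j0) (c j0).
  rewrite coprimep_expl // monic_irred_coprime //; apply: contra rj0 => cf0.
  by rewrite rE exprSr dvdp_mul2l // exp_monic_irred_neq0.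
pose w := lincomb g v c.
have w_ann : pmx g (f0 ^+ b) *m w = 0.
  by rewrite -lincombM -r0; apply: eq_lincomb => j; rewrite rE.
have /Bezout_eq1_coprimepP[[s t] /= st] := c_f0.
(* Since [c j0] is invertible modulo [f0 ^+ a j0], the discarded generator is recovered from [w] and
   the remaining ones. *)
have v_j0 : v j0 = pmx g t *m (w - \sum_(j | j != j0) pmx g (c j) *m v j).
  rewrite /w /lincomb (bigD1 j0) //= addrK mulmxA -pmxM.
  rewrite -[LHS]mul1mx -(pmx1 g) -st linearD /= mulmxDl (pmxM _ s) -mulmxA -fj0 ann.
  by rewrite mulmx0 add0r.
exists (fun j => if j == j0 then w else v j), (fun j => if j == j0 then b else a j).
split.
- by move=> j; case: eqP => // ->; rewrite fj0.
- move=> x; have [q xE] := gen x.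
  exists (fun j => if j == j0 then q j0 * t else q j - q j0 * t * c j).
  rewrite xE /lincomb (bigD1 j0) //= [RHS](bigD1 j0) //= eqxx v_j0.
  rewrite mulmxA -pmxM mulmxBr -addrA; congr (_ + _).
  rewrite addrC mulmx_sumr -sumrB; apply: eq_bigr => j /negPf->.
  by rewrite mulmxA -pmxM -mulmxBl -linearB.
rewrite [X in (X < _)%N](bigD1 j0) // [X in (_ < X)%N](bigD1 j0) //= eqxx.
rewrite [X in (b + X < _)%N](eq_bigr a) ?ltn_add2r // => j /negPf-> //.
Qed.

Lemma independent_generators (v : I -> 'cV[F]_n) (a : I -> nat) :
    (forall j, pmx g (f j ^+ a j) *m v j = 0) ->
    (forall x, exists p, x = lincomb g v p) ->
  exists v' a', cyclic_dec g v' (fun j => f j ^+ a' j).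
Proof.
have [k] := ubnP (\sum_j a j); elim: k v a => // k IHk v a ak ann gen.
have [ind|nind] := pselect (forall p, lincomb g v p = 0 -> forall j, f j ^+ a j %| p j).
  exists v, a; split=> // p; split=> [|pa]; first exact: ind.
  by rewrite [LHS]big1 // => j _; have /dvdpP[q ->] := pa j; rewrite pmxM -mulmxA ann mulmx0.
have [v' [a' [ann' gen' lt_a]]] := reduce_generators ann gen nind.
by apply: (IHk v' a') => //; apply: leq_trans lt_a _; rewrite -ltnS.
Qed.
End Reduction.

(** Bezout splits [x] into a part killed by the full power of one prime factor of [h] and a part
    killed by the cofactor, to which the induction applies. *)
Lemma primary_span n (g : 'M[F]_n) (x : 'cV[F]_n) h : h \is monic -> pmx g h *m x = 0 ->
  exists (I : finType) (f : I -> {poly F}) (a : I -> nat) (v : I -> 'cV[F]_n),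
    [/\ forall j, monic_irred (f j), forall j, pmx g (f j ^+ a j) *m v j = 0 &
        x = \sum_j v j].
Proof.
have [k] := ubnP (size h); elim: k x h => // k IHk x h hk hm hx.
have [h1|h1] := leqP (size h) 1.
  have x0 : x = 0.
    move/monicP: hm hx; rewrite [h]size1_polyC // lead_coefC => ->.
    by rewrite pmxC mul1mx.
  by exists void, (fun=> 0), (fun=> 0%N), (fun=> 0); split=> [[]|[]|]; rewrite x0 big1 // => -[].
have [f fI fh] := monic_factor_exists h1.
have : exists k, ~~ (f ^+ k %| h).
  exists (size h); apply/negP => /(dvdp_leq (monic_neq0 hm)); apply/negP.
  rewrite -ltnNge -[X in (_ < X)%N]prednK ?size_poly_gt0 ?exp_monic_irred_neq0 //.
  by rewrite size_exp ltnS leq_pmull // -ltnS prednK ?monic_irred_size // ltnW ?monic_irred_size.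
case/ex_minnP => -[|a]; first by rewrite dvd1p.
move=> na amin; have /dvdpP[h' hE] : f ^+ a %| h.
  by apply: contraT => /amin; rewrite ltnn.
have a0 : (0 < a)%N by case: a na {hE amin} => //; rewrite expr1 fh.
have fh' : coprimep (f ^+ a) h'.
  rewrite coprimep_expl // monic_irred_coprime //; apply: contra na => fh'.
  by rewrite hE exprS dvdp_mul2r // exp_monic_irred_neq0.
have h'm : h' \is monic by rewrite -(monicMr h' (monic_exp a fI.2)) -hE.
have /Bezout_eq1_coprimepP[[s t] /= st] := fh'.
have xE : x = pmx g (s * f ^+ a) *m x + pmx g (t * h') *m x.
  by rewrite -mulmxDl -linearD /= st pmx1 mul1mx.
have [||I [f1 [a1 [v1 [f1I ann1 x1E]]]]] := IHk (pmx g (s * f ^+ a) *m x) h' _ h'm.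
- apply: leq_trans (_ : size h <= k)%N; last by rewrite -ltnS.
  rewrite hE size_Mmonic ?monic_exp ?fI.2 ?monic_neq0 //.
  rewrite -subn1 -addnBA ?size_poly_gt0 ?exp_monic_irred_neq0 //.
  rewrite subn1 size_exp -[X in (X < _)%N]addn0 ltn_add2l muln_gt0 a0 andbT.
  by rewrite -subn1 subn_gt0 monic_irred_size.
- by rewrite mulmxA -pmxM mulrCA -hE pmxM -mulmxA hx mulmx0.
exists (I + 'I_1)%type, (fun j => if j is inl i then f1 i else f),
  (fun j => if j is inl i then a1 i else a),
  (fun j => if j is inl i then v1 i else pmx g (t * h') *m x); split.
- by case.
- case=> [j|_]; first exact: ann1.
  by rewrite mulmxA -pmxM mulrCA [f ^+ a * h']mulrC -hE pmxM -mulmxA hx mulmx0.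
by rewrite big_sumType /= big_ord1 -x1E.
Qed.

Lemma dec_sub n (g : 'M[F]_n) (I : finType) (v : I -> 'cV[F]_n) h (P : pred I) :
    (forall j, ~~ P j -> h j = 1) -> cyclic_dec g v h ->
  cyclic_dec g (fun j : {j | P j} => v (val j)) (fun j => h (val j)).
Proof.
move=> h1 dv; have [lin0 gen] := dv.
pose ext (p : {j | P j} -> {poly F}) j := if insub j is Some i then p i else 0.
have extE p (i : {j | P j}) : ext p (val i) = p i by rewrite /ext valK.
have v0 j : ~~ P j -> v j = 0.
  by move=> /h1 hj; rewrite -[v j]mul1mx -(pmx1 g) -hj (dec_ann dv).
have linE p : lincomb g v p = lincomb g (fun j : {j | P j} => v (val j)) (p \o val).
  rewrite [LHS](bigID P) /= [X in _ + X]big1 ?addr0; last first.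
    by move=> j /v0->; rewrite mulmx0.
  by rewrite (big_sub P).
have linE' p : lincomb g (fun j : {j | P j} => v (val j)) p = lincomb g v (ext p).
  by rewrite linE; apply: eq_lincomb => i; rewrite /= extE.
split=> [p|x]; last by have [p ->] := gen x; exists (p \o val); rewrite linE.
rewrite linE' lin0; split=> hp j; first by rewrite -extE.
rewrite /ext; case: insubP => [i _ <-|/h1->]; [exact: hp|exact: dvd1p].
Qed.

(** By Cayley-Hamilton every basis vector is a sum of vectors killed by prime powers. Together these
    generate, and they are then made independent. *)
Theorem primary_dec_exists n (g : 'M[F]_n) :
  exists (I : finType) v f a, @primary_dec n g I v f a.
Proof.
have [I IP] := choice (fun i : 'I_n => primary_span (char_poly_monic g)
  (etrans (congr1 (mulmx^~ (delta_mx i 0 : 'cV_n)) (pmx_char g)) (mul0mx _ _))).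
pose f i := sval (cid (IP i)); pose a i := sval (cid (svalP (cid (IP i)))).
pose v i := sval (cid (svalP (cid (svalP (cid (IP i)))))).
have Iv i : [/\ forall j, monic_irred (f i j),
    forall j, pmx g (f i j ^+ a i j) *m v i j = 0 & delta_mx i 0 = \sum_j v i j].
  exact: svalP (cid (svalP (cid (svalP (cid (IP i)))))).
pose J : finType := {i : 'I_n & I i}; pose fJ (j : J) := f (tag j) (tagged j).
pose aJ (j : J) := a (tag j) (tagged j); pose vJ (j : J) := v (tag j) (tagged j).
have fI j : monic_irred (fJ j) by have [fI _ _] := Iv (tag j); apply: fI.
have annJ j : pmx g (fJ j ^+ aJ j) *m vJ j = 0 by have [_ ann _] := Iv (tag j); apply: ann.
have genJ x : exists p, x = lincomb g vJ p.
  exists (fun j : J => (x (tag j) 0)%:P).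
  rewrite [LHS]matrix_sum_delta (eq_bigr (fun i => x i 0 *: \sum_j v i j)); last first.
    by move=> i _; rewrite big_ord1; have [_ _ <-] := Iv i.
  under eq_bigr do rewrite scaler_sumr.
  rewrite sig_big_dep; apply: eq_bigr => j _ /=.
  by rewrite pmxC mul_scalar_mx.
have [w [b dw]] := independent_generators fI annJ genJ.
pose P j := (0 < b j)%N.
exists {j | P j}, (fun j => w (val j)), (fun j => fJ (val j)), (fun j => b (val j)).
split=> [j|]; first by split; [exact: fI|exact: (valP j)].
by apply: (@dec_sub _ _ _ w (fun j => fJ j ^+ b j) P) => // j; rewrite -eqn0Ngt => /eqP->.
Qed.

End PrimaryDecomposition.

(** * Reciprocal polynomials *)

Section Reciprocal.
Variable F : fieldType.
Implicit Types (p q h : {poly F}) (z : F).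

(* [recip N z p] is [t ^ N p (z / t)] when [N] is at least the degree of [p]. *)
Definition recip N z p := \poly_(k < N.+1) (p`_(N - k) * z ^+ (N - k)).

(** For [p] monic with nonzero constant term: the monic polynomial with roots z / r, where r runs
    over the roots of [p]. It plays for z g^-1 the role of [p] for [g]. *)
Definition star z p := (p`_0)^-1 *: recip (size p).-1 z p.

Lemma recip_is_linear N z : linear (recip N z).
Proof.
move=> c p q; apply/polyP => k; rewrite coefD coefZ !coef_poly.
by case: ifP => _; rewrite ?mulr0 ?addr0 // coefD coefZ mulrDl mulrA.
Qed.
HB.instance Definition _ N z :=
  GRing.isLinear.Build F {poly F} {poly F} *:%R (recip N z) (@recip_is_linear N z).

Lemma recipXn N z k : (k <= N)%N -> recip N z 'X^k = z ^+ k *: 'X^(N - k).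
Proof.
move=> kN; apply/polyP => i; rewrite coef_poly coefZ !coefXn ltnS.
case: leqP => iN.
  have -> : (N - i == k)%N = (i == N - k)%N by lia.
  by case: eqP => [->|]; rewrite ?mul0r ?mulr0 // mul1r mulr1 subKn.
by have -> : (i == N - k)%N = false; [lia|rewrite mulr0].
Qed.

Lemma recipZXn N z c k : (k <= N)%N -> recip N z (c *: 'X^k) = (c * z ^+ k) *: 'X^(N - k).
Proof. by move=> kN; rewrite linearZ /= recipXn // scalerA. Qed.

Lemma size_recip N z p : (size (recip N z p) <= N.+1)%N.
Proof. exact: size_poly. Qed.

Lemma poly_sum_widen p N : (size p <= N.+1)%N -> p = \sum_(i < N.+1) p`_i *: 'X^i.
Proof.
move=> pN; rewrite -poly_def; apply/polyP => k; rewrite coef_poly.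
by case: ltnP => // Nk; rewrite nth_default // (leq_trans pN).
Qed.

Lemma recipM N M z p q : (size p <= N.+1)%N -> (size q <= M.+1)%N ->
  recip (N + M) z (p * q) = recip N z p * recip M z q.
Proof.
move=> pN qM; rewrite (poly_sum_widen pN) (poly_sum_widen qM).
rewrite mulr_suml !linear_sum /= mulr_suml; apply: eq_bigr => i _.
rewrite mulr_sumr linear_sum /= mulr_sumr; apply: eq_bigr => j _.
have [iN jM] : (i <= N)%N /\ (j <= M)%N by split; rewrite -ltnS.
have mulZ c d k l : (c *: 'X^k) * (d *: 'X^l) = (c * d) *: 'X^(k + l) :> {poly F}.
  by rewrite -scalerAl -scalerAr scalerA exprD.
rewrite mulZ !recipZXn ?leq_add // mulZ; congr (_ *: 'X^_).
  by rewrite exprD mulrACA.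
lia.
Qed.

Lemma recipK N z p : (size p <= N.+1)%N -> recip N z (recip N z p) = z ^+ N *: p.
Proof.
move=> pN; rewrite {1}(poly_sum_widen pN) [in RHS](poly_sum_widen pN).
rewrite !linear_sum; apply: eq_bigr => i _ /=.
have iN : (i <= N)%N by rewrite -ltnS.
rewrite !recipZXn ?leq_subr // subKn // scalerA.
by rewrite -mulrA -exprD subnKC // mulrC.
Qed.

Lemma recip_eq0 N z p : z != 0 -> (size p <= N.+1)%N -> (recip N z p == 0) = (p == 0).
Proof.
move=> z0 pN; apply/eqP/eqP => [r0|->]; last by rewrite linear0.
have := recipK z pN; rewrite r0 linear0 => /esym/eqP.
by rewrite scaler_eq0 expf_eq0 (negPf z0) andbF => /eqP.
Qed.

Section Twist.
Variable z : F.
Hypothesis z0 : z != 0.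

Lemma size_recip_eq p : p`_0 != 0 -> size (recip (size p).-1 z p) = size p.
Proof.
move=> p0; have sp : (0 < size p)%N by rewrite size_poly_gt0; apply: contraNneq p0 => ->; rewrite coef0.
by rewrite size_poly_eq prednK // subnn expr0 mulr1.
Qed.

Lemma size_star p : p`_0 != 0 -> size (star z p) = size p.
Proof. by move=> p0; rewrite size_scale ?invr_eq0 // size_recip_eq. Qed.

Lemma coef0_gt0 p : p`_0 != 0 -> (0 < size p)%N.
Proof. by move=> p0; rewrite size_poly_gt0; apply: contraNneq p0 => ->; rewrite coef0. Qed.

Lemma lead_coef_recip p : p`_0 != 0 -> lead_coef (recip (size p).-1 z p) = p`_0.
Proof.
by move=> p0; rewrite lead_coefE size_recip_eq // coef_poly leqnn subnn mulr1.
Qed.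

Lemma star_monic p : p`_0 != 0 -> star z p \is monic.
Proof. by move=> p0; rewrite monicE lead_coefZ lead_coef_recip // mulVf. Qed.

Lemma coef0_star p : (star z p)`_0 = (p`_0)^-1 * (lead_coef p * z ^+ (size p).-1).
Proof. by rewrite coefZ coef_poly /= subn0. Qed.

Lemma coef0_star_neq0 p : p`_0 != 0 -> (star z p)`_0 != 0.
Proof.
move=> p0; rewrite coef0_star !mulf_neq0 ?invr_eq0 ?expf_neq0 //.
by rewrite lead_coef_eq0 -size_poly_gt0 coef0_gt0.
Qed.

Lemma starK p : p \is monic -> p`_0 != 0 -> star z (star z p) = p.
Proof.
move=> /monicP pm p0; rewrite {1}/star coef0_star pm mul1r size_star // linearZ /=.
rewrite recipK ?prednK ?coef0_gt0 // !scalerA -mulrA mulVf ?scale1r //.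
by rewrite mulf_neq0 ?invr_eq0 ?expf_neq0.
Qed.

Lemma starM p q : p`_0 != 0 -> q`_0 != 0 -> star z (p * q) = star z p * star z q.
Proof.
move=> p0 q0; have [sp sq] := (coef0_gt0 p0, coef0_gt0 q0).
rewrite /star -scalerAl -scalerAr scalerA coef0M invfM; congr (_ *: _).
rewrite -recipM ?prednK // size_mul -?size_poly_gt0 //; congr recip.
by move: (size p) (size q) sp sq => m k; lia.
Qed.

Lemma star1 : star z 1 = 1.
Proof.
rewrite /star size_poly1 coefC eqxx invr1 scale1r.
by have := @recipXn 0 z 0 isT; rewrite !expr0 scale1r.
Qed.

Lemma coef0X_neq0 p k : p`_0 != 0 -> (p ^+ k)`_0 != 0.
Proof. by move=> p0; rewrite -!horner_coef0 horner_exp expf_neq0 // horner_coef0. Qed.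

Lemma starX p k : p`_0 != 0 -> star z (p ^+ k) = star z p ^+ k.
Proof.
move=> p0; elim: k => [|k IHk]; first by rewrite !expr0 star1.
by rewrite !exprS starM ?IHk ?coef0X_neq0.
Qed.

Lemma coef0_prod_neq0 (I : Type) (s : seq I) (P : pred I) (f : I -> {poly F}) :
  (forall i, P i -> (f i)`_0 != 0) -> (\prod_(i <- s | P i) f i)`_0 != 0.
Proof.
move=> f0; elim/big_rec: _ => [|i p Pi p0]; first by rewrite coefC oner_eq0.
by rewrite coef0M mulf_neq0 // f0.
Qed.

Lemma star_prod (I : Type) (s : seq I) (P : pred I) (f : I -> {poly F}) :
    (forall i, P i -> (f i)`_0 != 0) ->
  star z (\prod_(i <- s | P i) f i) = \prod_(i <- s | P i) star z (f i).
Proof.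
move=> f0; elim: s => [|i s IHs]; first by rewrite !big_nil star1.
rewrite !big_cons; case: ifP => // Pi.
by rewrite starM ?f0 ?IHs // coef0_prod_neq0.
Qed.

(** Reciprocation respects products and is an involution up to nonzero scalars, so both directions
    follow from the single implication [aux]. *)
Lemma dvd_recip N h p : h`_0 != 0 -> (size p <= N.+1)%N ->
  (h %| recip N z p) = (star z h %| p).
Proof.
move=> h0 pN; have sh := coef0_gt0 h0.
have [->|p0] := eqVneq p 0; first by rewrite linear0 !dvdp0.
have aux h1 h2 q : h1`_0 != 0 -> q != 0 -> (size q <= N.+1)%N ->
    (recip (size h1).-1 z h1) %= h2 -> h1 %| q -> h2 %| recip N z q.
  move=> h10 q0 qN eh /dvdpP[c qE]; have sh1 := coef0_gt0 h10.
  have c0 : c != 0 by apply: contraNneq q0; rewrite qE => ->; rewrite mul0r.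
  have sc : (0 < size c)%N by rewrite size_poly_gt0.
  have : (size q = size c + (size h1).-1)%N.
    by rewrite qE size_mul // -?size_poly_gt0 // -[size h1]prednK // addnS.
  move=> sq; rewrite qE -(eqp_dvdl _ eh).
  have -> : N = ((N - (size h1).-1) + (size h1).-1)%N by lia.
  by rewrite recipM ?dvdp_mull // ?prednK //; lia.
apply/idP/idP => [hp|].
  have := @aux h (star z h) (recip N z p) h0; rewrite recip_eq0 // p0 size_recip.
  rewrite recipK // dvdpZr ?expf_neq0 //; apply=> //.
  by rewrite /star eqp_sym eqp_scale ?invr_eq0.
apply: aux => //; first exact: coef0_star_neq0.
rewrite size_star // /star linearZ /= recipK ?prednK // scalerA.
rewrite eqp_scale // mulf_neq0 ?invr_eq0 ?expf_neq0 //.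
Qed.

Lemma star_irred f : monic_irred f -> f`_0 != 0 -> monic_irred (star z f).
Proof.
move=> [[sf fI] fm] f0; split; last exact: star_monic.
split=> [|q sq qf]; first by rewrite size_star.
have q0 : q`_0 != 0.
  have /dvdpP[c e] := qf; apply: contraNneq (coef0_star_neq0 f0).
  by rewrite e coef0M => ->; rewrite mulr0.
have : star z q %| f.
  have /dvdpP[c e] := qf; have c0 : c`_0 != 0.
    by apply: contraNneq (coef0_star_neq0 f0); rewrite e coef0M => ->; rewrite mul0r.
  by rewrite -[f]starK // e starM // dvdp_mulIr.
move=> qf'; have := fI (star z q); rewrite size_star // => /(_ sq qf')/eqp_size.
by rewrite size_star // => sqf; rewrite -dvdp_size_eqp // size_star // sqf.
Qed.

End Twist.
End Reciprocal.

(** The matrices [g] and g' = z g^-1 have the same cyclic subspaces, so the same generators serve.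
    Multiplication by [g ^+ N] turns a polynomial in [g'] of degree at most [N] into its [recip] in
    [g], which translates the relations. *)
Lemma recip_dec (F : fieldType) n (g g' : 'M[F]_n) z (I : finType)
    (v : I -> 'cV[F]_n) (h : I -> {poly F}) :
    z != 0 -> g *m g' = z%:M -> (forall j, (h j)`_0 != 0) ->
  cyclic_dec g v h -> cyclic_dec g' v (fun j => star z (h j)).
Proof.
move=> z0 gg' h0 [lin0 gen].
have g'g : g' *m g = z%:M.
  have : g *m (z^-1 *: g') = 1%:M by rewrite -scalemxAr gg' scale_scalar_mx mulVf.
  by move/mulmx1C; rewrite -scalemxAl => /(congr1 ( *:%R z)); rewrite scalerA mulfV // scale1r => ->; rewrite scalemx1.
have recip_mx (k k' : 'M[F]_n) N (p : {poly F}) : k *m k' = z%:M -> (size p <= N.+1)%N ->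
    k ^+ N *m pmx k' p = pmx k (recip N z p).
  move=> kk' pN; rewrite (poly_sum_widen pN) [pmx k' _]linear_sum [recip N z _]linear_sum.
  rewrite [pmx k _]linear_sum [LHS]mulmx_sumr.
  apply: eq_bigr => i _; rewrite !linearZ /=; congr (_ *: _).
  have iN : (i <= N)%N by rewrite -ltnS.
  rewrite recipXn // linearZ /= !pmxXn -{1}(subnK iN) exprD -[LHS]mulmxA.
  rewrite -mul_mx_scalar; congr (_ *m _).
  elim: (i : nat) => [|m IHm]; first by rewrite !expr0 mulmx1.
  rewrite exprSr exprS [LHS]mulmxA -[X in X *m _]mulmxA kk'.
  by rewrite mul_mx_scalar -scalemxAl IHm scale_scalar_mx -exprS.
have lincomb_recip (k k' : 'M[F]_n) N (p : I -> {poly F}) : k *m k' = z%:M -> (forall j, size (p j) <= N.+1)%N ->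
    k ^+ N *m lincomb k' v p = lincomb k v (fun j => recip N z (p j)).
  move=> kk' pN; rewrite mulmx_sumr; apply: eq_bigr => j _.
  by rewrite mulmxA (recip_mx _ k').
have expK N : g' ^+ N *m g ^+ N = (z ^+ N)%:M.
  elim: N => [|N IHN]; first by rewrite !expr0 mulmx1.
  rewrite exprSr exprS [LHS]mulmxA -[X in X *m _]mulmxA g'g.
  by rewrite mul_mx_scalar -scalemxAl IHN scale_scalar_mx -exprS.
have bound (p : I -> {poly F}) : exists N, forall j, (size (p j) <= N.+1)%N.
  by exists (\max_j size (p j)) => j; rewrite leqW // leq_bigmax.
split=> [p|x].
  have [N pN] := bound p.
  have -> : (lincomb g' v p = 0) <-> (lincomb g v (fun j => recip N z (p j)) = 0).
    rewrite -(lincomb_recip _ _ _ _ gg' pN); split=> [->|/(congr1 (mulmx (g' ^+ N)))].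
      by rewrite mulmx0.
    rewrite mulmxA expK mulmx0 mul_scalar_mx => /eqP.
    by rewrite scaler_eq0 expf_eq0 (negPf z0) andbF => /eqP.
  by rewrite lin0; split=> hp j; have := hp j; rewrite dvd_recip.
(* The vector to expand depends on [N], so [N] is fixed before the coefficients [p] are known;
   reducing them modulo the [h j] then brings their degrees below it. *)
have [N hN] := bound h; have [p pE] := gen (z ^- N *: (g ^+ N *m x)).
exists (fun j => recip N z (p j %% h j)).
have modN j : (size (p j %% h j)%R <= N.+1)%N.
  apply: leq_trans (hN j); rewrite ltnW // ltn_modp.
  by apply: contraNneq (h0 j) => ->; rewrite coef0.
rewrite -(lincomb_recip _ _ _ _ g'g modN).
have <- : lincomb g v p = lincomb g v (fun j => p j %% h j).
  apply/eqP; rewrite -subr_eq0 -lincombB; apply/eqP/lin0 => j.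
  by rewrite {1}(divp_eq (p j) (h j)) addrK dvdp_mull.
by rewrite -pE -scalemxAr mulmxA expK mul_scalar_mx scalerA mulVf ?scale1r ?expf_neq0.
Qed.

(** * Determinants and the invariants of similarity *)

(** The two sizes are equal only propositionally, as happens with ranks and with sizes of block
    matrices. *)
Lemma det_conj (R : comPzRingType) m k (A : 'M[R]_m) (M : 'M_(m, k)) M' :
  m = k -> M *m M' = 1%:M -> \det (M' *m A *m M) = \det A.
Proof.
move=> mk; case: k / mk M M' => M M' MM'.
by rewrite !det_mulmx mulrAC [\det M' * _]mulrC -det_mulmx MM' det1 mul1r.
Qed.

Section Companion.
Variable F : fieldType.

(** The transposed companion matrix acts on columns as multiplication by t on F[t]/(h) in the basis
    of powers of t; the generator is the class of 1. *)
Lemma companion_dec (h : {poly F}) : h \is monic -> (1 < size h)%N ->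
  exists v, cyclic_dec (companionmx h)^T (fun _ : 'I_1 => v) (fun=> h).
Proof.
move=> hm hs; set C := companionmx h; set d := (size h).-1 in C *.
have d0 : (0 < d)%N by rewrite -ltnS prednK // ltnW.
pose i0 := Ordinal d0; pose v : 'cV[F]_d := delta_mx i0 0.
have Cv (i : 'I_d) : C^T ^+ i *m v = delta_mx i 0.
  case: i => i /= i_d; elim: i i_d => [|i IHi] i_d.
    by rewrite expr0 mul1mx; congr delta_mx; apply: val_inj.
  rewrite exprS -[LHS]mulmxA (IHi (ltnW i_d)) -[LHS]trmxK trmx_mul !trmxK trmx_delta.
  by rewrite mulmx_delta_companion trmx_delta; congr delta_mx; apply: val_inj.
have pv (p : {poly F}) : (size p <= d)%N -> pmx C^T p *m v = (poly_rV p)^T.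
  move=> sp; have -> : p = \sum_(i < d) p`_i *: 'X^i.
    by rewrite -poly_def; apply/polyP => k; rewrite coef_poly; case: ltnP => // dk; rewrite nth_default // (leq_trans sp).
  rewrite linear_sum mulmx_suml; apply/colP => k; rewrite summxE !mxE.
  rewrite coef_sum; apply: eq_bigr => i _.
  by rewrite linearZ /= pmxXn -scalemxAl Cv !mxE coefZ coefXn eqxx andbT.
have Ch : pmx C^T h = 0.
  have : pmx C h = 0 by rewrite -[X in pmx _ X](companionmxK hm) pmx_char.
  move/(congr1 trmx); rewrite trmx0 => <-; rewrite /pmx linear_sum.
  apply: eq_bigr => i _; rewrite linearZ /=; congr (_ *: _).
  elim: (i : nat) => [|k IHk]; first by rewrite !expr0 trmx1.
  by rewrite exprS exprSr IHk [RHS]trmx_mul.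
have modh (p : {poly F}) : pmx C^T p *m v = (poly_rV (p %% h))^T.
  rewrite -pv; last by rewrite -ltnS prednK ?(ltnW hs) // ltn_modp monic_neq0.
  by rewrite {1}(divp_eq p h) linearD /= mulmxDl pmxM Ch mulmx0 mul0mx add0r.
exists v; split=> [p|x].
  rewrite /lincomb big_ord1 modh; split=> [p0 j|hp].
    move/(congr1 trmx): p0; rewrite trmxK trmx0 => /(congr1 (@rVpoly _ _)).
    rewrite linear0 poly_rV_K ?ord1 => [/eqP //|].
    by rewrite -ltnS prednK ?(ltnW hs) // ltn_modp monic_neq0.
  by have /eqP-> := hp 0; rewrite linear0 trmx0.
exists (fun=> rVpoly x^T); rewrite /lincomb big_ord1 pv ?size_poly //.
by rewrite rVpolyK trmxK.
Qed.

Lemma char_companion_tr (h : {poly F}) : h \is monic -> char_poly (companionmx h)^T = h.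
Proof.
move=> hm; rewrite -[RHS]companionmxK // /char_poly -det_tr; congr (\det _).
by rewrite /char_poly_mx raddfB /= tr_scalar_mx map_trmx trmxK.
Qed.

Lemma dec_block m n (A : 'M[F]_m) (B : 'M[F]_n) (I J : finType) v w h k :
    cyclic_dec A v h -> cyclic_dec B w k ->
  cyclic_dec (block_mx A 0 0 B)
    (fun u : I + J => match u with inl i => col_mx (v i) 0 | inr j => col_mx 0 (w j) end)
    (fun u => match u with inl i => h i | inr j => k j end).
Proof.
move=> [lv gv] [lw gw].
have linE p : lincomb (block_mx A 0 0 B)
    (fun u : I + J => match u with inl i => col_mx (v i) 0 | inr j => col_mx 0 (w j) end) p
    = col_mx (lincomb A v (p \o inl)) (lincomb B w (p \o inr)).
  rewrite /lincomb big_sumType /= -[in RHS](addr0 (\sum_j pmx A _ *m _)).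
  rewrite -[in RHS](add0r (\sum_j pmx B _ *m _)) -add_col_mx; congr (_ + _).
    have colE x : col_mx x 0 = col_mx 1%:M 0 *m x :> 'cV[F]_(m + n).
      by rewrite mul_col_mx mul1mx mul0mx.
    rewrite colE mulmx_sumr; apply: eq_bigr => i _.
    by rewrite -colE pmx_block mul_block_col !mul0mx mulmx0 !addr0.
  have colE x : col_mx 0 x = col_mx 0 1%:M *m x :> 'cV[F]_(m + n).
    by rewrite mul_col_mx mul1mx mul0mx.
  rewrite colE mulmx_sumr; apply: eq_bigr => j _.
  by rewrite -colE pmx_block mul_block_col !mul0mx mulmx0 !add0r.
split=> [p|x].
  rewrite linE -(col_mx0 _ m n 1); split=> [/eq_col_mx[/lv pv /lw pw] [i|j]|hp].
  - exact: pv.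
  - exact: pw.
  by congr col_mx; [apply/lv => i|apply/lw => j]; apply: hp.
have [p pE] := gv (usubmx x); have [q qE] := gw (dsubmx x).
exists (fun u => match u with inl i => p i | inr j => q j end).
by rewrite linE -[LHS]vsubmxK pE qE.
Qed.

Lemma dec_block_D1 m n (A : 'M[F]_m) (B : 'M[F]_n) (I : finType) (h : I -> {poly F}) j0 x w :
    cyclic_dec A (fun _ : 'I_1 => x) (fun=> h j0) ->
    cyclic_dec B w (fun u : {j | j != j0} => h (val u)) ->
  exists v, [/\ cyclic_dec (block_mx A 0 0 B) v h, v j0 = col_mx x 0 &
    forall u, v (val u) = col_mx 0 (w u)].
Proof.
move=> dA dB.
pose s j : 'I_1 + {j | j != j0} := if insub j is Some u then inr u else inl ord0.
pose t (u : 'I_1 + {j | j != j0}) := match u with inl _ => j0 | inr u => val u end.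
have s0 : s j0 = inl ord0 by rewrite /s insubF ?eqxx.
have sval u : s (val u) = inr u by rewrite /s valK.
have sB : bijective s.
  exists t => [j|[i|u]]; [|by rewrite /= s0 [i]ord1|by rewrite /= sval].
  by rewrite /s; case: insubP => [u _ //|]; rewrite negbK => /eqP.
have := dec_reindex sB (dec_block dA dB); set v := (X in cyclic_dec _ X _).
set k := (X in cyclic_dec _ _ X) => dv; have kE : k = h.
  apply/funext => j; rewrite /k /=; have [->|jj0] := eqVneq j j0; first by rewrite s0.
  by rewrite -[j](SubK {j | j != j0} jj0) sval.
by exists v; rewrite -kE /v /= s0; split=> // u; rewrite sval.
Qed.

(** A block diagonal model on which the characteristic polynomial is visible; isomorphism carries it
    to every decomposition with the same annihilators. *)
Lemma dec_model (I : finType) (h : I -> {poly F}) :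
    (forall j, h j \is monic /\ (1 < size (h j))%N) ->
  exists n (g : 'M[F]_n) v, cyclic_dec g v h /\ char_poly g = \prod_j h j.
Proof.
have [k] := ubnP #|I|; elim: k I h => // k IHk I h; rewrite ltnS => cI hP.
have [I0|/card_gt0P[j0 _]] := posnP #|I|.
  exists 0%N, 0, (fun=> 0); split; last first.
    rewrite big_pred0; first exact: det_mx00.
    by move=> j; have := fintype0 j; rewrite I0.
  have noI : I -> False by move=> j; have := fintype0 j; rewrite I0.
  by split=> [p|x]; [split=> _; [move=> j; case: (noI j)|rewrite flatmx0]|exists (fun=> 0); rewrite !flatmx0].
have [|j|n [B [w [dB cB]]]] := IHk {j | j != j0} (fun u => h (val u)).
- rewrite card_sig; apply: leq_trans cI; rewrite [X in (_ < X)%N](cardD1 j0) ltnS.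
  by apply: subset_leq_card; apply/subsetP => j; rewrite !inE andbT.
- exact: hP.
have [hm hs] := hP j0; have [v dA] := companion_dec hm hs.
have [x' [dx _ _]] := dec_block_D1 dA dB.
exists _, (block_mx (companionmx (h j0))^T 0 0 B), x'; split=> //.
rewrite /char_poly char_block_diag_mx det_ublock -![\det _]/(char_poly _).
rewrite char_companion_tr // cB (bigD1 j0) //=; congr (_ * _).
by rewrite [RHS](big_sub (fun j => j != j0)).
Qed.

End Companion.

Section DecInvariants.
Variable F : finFieldType.
Variables (n : nat) (g : 'M[F]_n) (I : finType) (v : I -> 'cV[F]_n) (h : I -> {poly F}).
Hypothesis dec : cyclic_dec g v h.
Hypothesis hP : forall j, h j \is monic /\ (1 < size (h j))%N.

Let h0 j : h j != 0. Proof. by rewrite monic_neq0 // (proj1 (hP j)). Qed.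

Lemma char_poly_similar m k (A : 'M[F]_m) (B : 'M[F]_k) (M : 'M_(m, k)) M' :
    m = k -> M *m M' = 1%:M -> M' *m M = 1%:M -> M *m B = A *m M ->
  char_poly A = char_poly B.
Proof.
move=> mk; case: k / mk M M' B => M M' B MM' M'M MB.
have -> : A = M *m B *m M' by rewrite MB -mulmxA MM' mulmx1.
have MM'P : map_mx polyC M *m map_mx polyC M' = 1%:M.
  by rewrite -map_mxM MM' map_scalar_mx.
have -> : char_poly (M *m B *m M')
    = \det (map_mx polyC M *m char_poly_mx B *m map_mx polyC M').
  rewrite /char_poly /char_poly_mx !map_mxM mulmxBr mulmxBl scalar_mxC.
  by rewrite -[_%:M *m _ *m _]mulmxA MM'P mulmx1.
by rewrite !det_mulmx mulrAC -det_mulmx MM'P det1 mul1r.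
Qed.

Lemma dec_char_poly : char_poly g = \prod_j h j.
Proof.
have [m [g' [w [dg' <-]]]] := dec_model hP.
have mn : n = m by rewrite -(dec_dim h0 dec) (dec_dim h0 dg').
have [M [M' [MM' M'M _ Mg]]] := dec_isom dg' dec.
exact: char_poly_similar mn MM' M'M Mg.
Qed.

Lemma dec_det : \det g = \prod_j ((-1) ^+ (size (h j)).-1 * (h j)`_0).
Proof.
have := char_poly_det g; rewrite dec_char_poly -horner_coef0 horner_prod.
move/(congr1 ( *%R ((-1) ^+ n))); rewrite mulrA -exprD addnn -mul2n exprM sqrrN !expr1n mul1r.
move=> <-; rewrite big_split -[in LHS](dec_dim h0 dec) -prodrXr; congr (_ * _).
by apply: eq_bigr => j _; rewrite horner_coef0.
Qed.

(** Multiplication by [p] on one summand and the identity on the others: the source of commuting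
    matrices with prescribed determinant. It is written on a block model and transported by [M]. *)
Lemma dec_mult j0 p : exists c, [/\ c *m g = g *m c, c *m v j0 = pmx g p *m v j0,
    forall j, j != j0 -> c *m v j = v j &
    exists d (A : 'M[F]_d), char_poly A = h j0 /\ \det c = \det (pmx A p)].
Proof.
have hP' (u : {j | j != j0}) : h (val u) \is monic /\ (1 < size (h (val u)))%N by [].
have [m [B [w [dB _]]]] := dec_model hP'.
have [hm hs] := hP j0; have [x dA] := companion_dec hm hs.
set A := _^T in dA; pose g' := block_mx A 0 0 B; set d := (size (h j0)).-1 in A dA g' *.
have [v' [dg' v'0 v'E]] := dec_block_D1 dA dB.
have nE : n = (d + m)%N by rewrite -(dec_dim h0 dec) (dec_dim h0 dg').
have [M [M' [MM' M'M Mv Mg]]] := dec_isom dec dg'.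
have {}Mv j : M *m v j = v' j.
  by have := Mv (fun i => if i == j then 1 else 0); rewrite !lincomb_delta !pmx1 !mul1mx.
have M'v j : M' *m v' j = v j by rewrite -Mv mulmxA M'M mul1mx.
have M'g : M' *m g' = g *m M'.
  by rewrite -[RHS]mul1mx -M'M -!mulmxA [M *m _]mulmxA Mg -mulmxA MM' mulmx1.
pose c' := block_mx (pmx A p) 0 0 (1%:M : 'M[F]_m).
exists (M' *m c' *m M); split.
- rewrite -!mulmxA Mg [g *m _]mulmxA -M'g -!mulmxA; congr (_ *m _); rewrite !mulmxA.
  congr (_ *m _); rewrite /c' /g' !mulmx_block !mulmx0 !mul0mx !addr0 !add0r mul1mx mulmx1.
  by have := pmx_comm A p 'X; rewrite pmxX => ->.
- rewrite -!mulmxA Mv -(M'v j0) [RHS]mulmxA -(pmx_intertwine _ M'g) -mulmxA; congr (_ *m _).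
  by rewrite v'0 /c' pmx_block !mul_block_col !mulmx0 !mul0mx !addr0.
- move=> j jj0; rewrite -!mulmxA Mv -[RHS]M'v; congr (_ *m _).
  by rewrite -[j](SubK {j | j != j0} jj0) v'E mul_block_col !mulmx0 !mul0mx mul1mx addr0 add0r.
exists d, A; split; first exact: char_companion_tr.
by rewrite (det_conj _ (esym nE) MM') det_ublock det1 mulr1.
Qed.

End DecInvariants.

(** * Uniqueness of the primary decomposition and similarity *)

Section Invariants.
Variable F : finFieldType.

Lemma primary_dec_neq0 n (g : 'M[F]_n) (I : finType) v f a :
  @primary_dec _ n g I v f a -> forall j, f j ^+ a j \is monic /\ (1 < size (f j ^+ a j))%N.
Proof.
case=> fI _ j; have [fj aj] := fI j; split; first by rewrite monic_exp // (proj2 fj).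
by rewrite -subn_gt0 subn1 size_exp muln_gt0 aj andbT -subn1 subn_gt0 monic_irred_size.
Qed.

(** The kernel of [p ^+ k] has dimension [S k] times the degree of [p], so [S] depends on [g] alone.
    The number of summands F[t]/(p^i) is 2 S(i) - S(i-1) - S(i+1). *)
Lemma primary_dec_fibers n (g : 'M[F]_n) (I J : finType) v f a w f' a' :
    @primary_dec _ n g I v f a -> @primary_dec _ n g J w f' a' ->
  forall x, #|[pred j | (f j, a j) == x]| = #|[pred j | (f' j, a' j) == x]|.
Proof.
move=> pv pw [p i].
pose S (K : finType) (b : K -> {poly F}) (c : K -> nat) k := (\sum_j (b j == p) * minn (c j) k)%N.
have [pI|pNI] := pselect (monic_irred p /\ (0 < i)%N); last first.
  rewrite !eq_card0 // => j; apply/negbTE/eqP => -[fj aj]; apply: pNI; rewrite -fj -aj;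
  by [apply: (proj1 pv)|apply: (proj1 pw)].
have eqS k : S I f a k = S J f' a' k.
  have aux (K : finType) x b c : @primary_dec _ n g K x b c ->
      #|[set x : 'cV[F]_n | pmx g (p ^+ k) *m x == 0]| = (#|F| ^ (S K b c k * (size p).-1))%N.
    move=> dx; have dxP := primary_dec_neq0 dx; case: dx => bI dx.
    rewrite (dec_card_ker _ _ dx) => [|j]; last by rewrite monic_neq0 ?(proj1 (dxP j)).
    congr (_ ^ _)%N; rewrite big_distrl; apply: eq_bigr => j _ /=.
    by rewrite (size_gcdp_primary _ _ (proj1 pI) (proj1 (bI j))) -mulnA [(minn _ _ * _)%N]mulnC.
  have := aux _ _ _ _ pv; rewrite (aux _ _ _ _ pw) => /eqP.
  rewrite eqn_exp2l ?finNzRing_gt1 // eqn_pmul2r => [/eqP //|].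
  by rewrite -subn1 subn_gt0; apply: monic_irred_size (proj1 pI).
have countS (K : finType) b c : (#|[pred j : K | (b j, c j) == (p, i)]| + (S K b c i.-1 + S K b c i.+1)
    = 2 * S K b c i)%N.
  rewrite /S -sum1_card big_mkcond -!big_split big_distrr; apply: eq_bigr => j _ /=.
  rewrite inE xpair_eqE; case: eqP => _; rewrite /= ?mul0n ?muln0 // !mul1n.
  by case: eqP (proj2 pI) => [->|]; lia.
have := countS I f a; rewrite !eqS -(countS J f' a') => /eqP.
by rewrite eqn_add2r => /eqP.
Qed.

Lemma same_fibers_similar n (g g' : 'M[F]_n) (I J : finType) v f a w f' a' :
    @primary_dec _ n g I v f a -> @primary_dec _ n g' J w f' a' ->
    (forall x, #|[pred j | (f j, a j) == x]| = #|[pred j | (f' j, a' j) == x]|) ->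
  exists M M' : 'M_n, [/\ M *m M' = 1%:M, M' *m M = 1%:M & M *m g = g' *m M].
Proof.
move=> [_ dv] [_ dw] /fiber_bijection[s sB sE].
have ds := dec_reindex sB dw.
have kE : (fun j => f' j ^+ a' j) \o s = (fun j => f j ^+ a j).
  by apply/funext => j /=; have [-> ->] := sE j.
rewrite kE in ds; have [M [M' [MM' M'M _ Mg]]] := dec_isom dv ds.
by exists M, M'.
Qed.

(* A complete invariant of similarity: the type of [g] has [(size (u i)).-1] parts
   equal to [i]. *)
Definition has_data n (g : 'M[F]_n) (u : nat -> {poly F}) : Prop :=
  exists (I : finType) v f a, @primary_dec _ n g I v f a /\
    forall i, u i = \prod_(j | a j == i) f j.

(** By unique factorization, the product over each exponent determines the multiset of its
    primes. *)
Lemma eq_fibers_data (I J : finType) (f : I -> {poly F}) a (f' : J -> {poly F}) a' :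
    (forall j, monic_irred (f j)) -> (forall j, monic_irred (f' j)) ->
  (forall x, #|[pred j | (f j, a j) == x]| = #|[pred j | (f' j, a' j) == x]|)
    <-> (forall i : nat, \prod_(j | a j == i) f j = \prod_(j | a' j == i) f' j).
Proof.
move=> fI fI'; split=> [/fiber_bijection[s sB sE] i|eq_prod [p i]].
  rewrite [RHS](reindex s) /=; last exact: onW_bij.
  by apply: eq_big => [j|j _]; have [e1 e2] := sE j; rewrite ?e1 ?e2.
pose sq (K : finType) b (c : K -> nat) := [seq b j | j <- enum [pred j | c j == i]] : seq {poly F}.
have countE (K : finType) b (c : K -> nat) :
    #|[pred j | (b j, c j) == (p, i)]| = count_mem p (sq K b c).
  rewrite count_map -size_filter cardE /enum_mem -filter_predI; congr size.
rewrite !countE; suff /seq.permP-> : perm_eq (sq I f a) (sq J f' a') by [].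
apply: monic_factorization_uniq.
- by move=> _ /mapP[j _ ->]; apply: fI.
- by move=> _ /mapP[j _ ->]; apply: fI'.
by rewrite !big_map !big_enum /= eq_prod.
Qed.

Lemma data_uniq n (g : 'M[F]_n) u u' : has_data g u -> has_data g u' -> u = u'.
Proof.
move=> [I [v [f [a [dv uE]]]]] [J [w [f' [a' [dw uE']]]]]; apply/funext => i.
rewrite uE uE'; move: i; apply/eq_fibers_data => [j|j|]; [exact: (proj1 (proj1 dv j))|exact: (proj1 (proj1 dw j))|].
exact: primary_dec_fibers dv dw.
Qed.

Lemma data_conj n (g g' M M' : 'M[F]_n) u :
  M *m M' = 1%:M -> M *m g = g' *m M -> has_data g u -> has_data g' u.
Proof.
move=> MM' Mg [I [v [f [a [[fI dv] uE]]]]].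
exists I, (fun j => M *m v j), f, a; split=> //; split=> //.
exact: dec_intertwine MM' (mulmx1C MM') Mg dv.
Qed.

Lemma data_similar n (g g' : 'M[F]_n) u : has_data g u -> has_data g' u ->
  exists M M' : 'M_n, [/\ M *m M' = 1%:M, M' *m M = 1%:M & M *m g = g' *m M].
Proof.
move=> [I [v [f [a [dv uE]]]]] [J [w [f' [a' [dw uE']]]]].
apply: (same_fibers_similar dv dw); apply/eq_fibers_data => [j|j|i].
- exact: (proj1 (proj1 dv j)).
- exact: (proj1 (proj1 dw j)).
by rewrite -uE -uE'.
Qed.

Lemma data_exists n (g : 'M[F]_n) : exists u, has_data g u.
Proof.
have [I [v [f [a d]]]] := primary_dec_exists g.
by exists (fun i => \prod_(j | a j == i) f j), I, v, f, a.
Qed.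

Lemma primary_dec_coef0 n (g g' : 'M[F]_n) z (I : finType) v f a : z != 0 -> g *m g' = z%:M ->
  @primary_dec _ n g I v f a -> forall j, (f j)`_0 != 0.
Proof.
move=> z0 gg' dv j; have dP := primary_dec_neq0 dv; have [fI d] := dv.
have : \det g != 0.
  apply/negP => /eqP g0; have := congr1 determinant gg'; rewrite det_mulmx g0 mul0r.
  by rewrite det_scalar => /esym/eqP; rewrite expf_eq0 (negPf z0) andbF.
rewrite (dec_det d dP) (bigD1 j) //= !mulf_eq0 !negb_or -!andbA => /and3P[_ + _].
by apply: contra => /eqP f0; rewrite -horner_coef0 horner_exp horner_coef0 f0 expr0n gtn_eqF // (proj2 (fI j)).
Qed.

Lemma data_recip n (g g' : 'M[F]_n) z u : z != 0 -> g *m g' = z%:M -> has_data g u ->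
  has_data g' (fun i => star z (u i)).
Proof.
move=> z0 gg' [I [v [f [a [dv uE]]]]]; have f0 := primary_dec_coef0 z0 gg' dv.
have [fI d] := dv; exists I, v, (fun j => star z (f j)), a; split; last first.
  by move=> i; rewrite uE star_prod.
split=> [j|]; first by split; [apply: star_irred (proj1 (fI j)) _|apply: (proj2 (fI j))].
have h0 j : (f j ^+ a j)`_0 != 0 by apply: coef0X_neq0.
have := recip_dec z0 gg' h0 d; congr (cyclic_dec _ _ _); apply/funext => j.
by rewrite starX.
Qed.

End Invariants.

Section Data.
Variable F : finFieldType.

Lemma size_prod_monic (I : finType) (P : pred I) (f : I -> {poly F}) :
    (forall j, P j -> f j != 0) ->
  (size (\prod_(j | P j) f j)).-1 = (\sum_(j | P j) (size (f j)).-1)%N.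
Proof.
move=> f0; suff : \prod_(j | P j) f j != 0 /\ (size (\prod_(j | P j) f j)).-1 = (\sum_(j | P j) (size (f j)).-1)%N by case.
elim/big_rec2: _ => [|j m p Pj [p0 IH]]; first by rewrite oner_eq0 size_poly1.
rewrite mulf_neq0 ?f0 // size_mul ?f0 // -IH; split=> //.
have : (0 < size (f j))%N by rewrite size_poly_gt0 f0.
have : (0 < size p)%N by rewrite size_poly_gt0.
by move: (size p) (size (f j)) => a b; lia.
Qed.

Section PrimaryDec.
Variables (n : nat) (g : 'M[F]_n) (I : finType) (v : I -> 'cV[F]_n).
Variables (f : I -> {poly F}) (a : I -> nat).
Hypothesis d : primary_dec g v f a.

Lemma primary_dec_dim : (\sum_j a j * (size (f j)).-1 = n)%N.
Proof.
have dP := primary_dec_neq0 d; rewrite -[RHS](dec_dim _ (proj2 d)) => [|j].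
  by apply: eq_bigr => j _; rewrite size_exp mulnC.
by rewrite monic_neq0 // (proj1 (dP j)).
Qed.

Lemma primary_dec_le j : (a j <= n)%N.
Proof.
rewrite -primary_dec_dim (bigD1 j) //= (leq_trans _ (leq_addr _ _)) // leq_pmulr //.
by rewrite -subn1 subn_gt0; apply: monic_irred_size (proj1 (proj1 d j)).
Qed.

Lemma sum_by_exponent (G : I -> nat) :
  (\sum_j G j = \sum_(i < n.+1) \sum_(j | a j == i) G j)%N.
Proof.
rewrite (partition_big (fun j => inord (a j) : 'I_n.+1) xpredT) //=.
apply: eq_bigr => i _; apply: eq_bigl => j.
by rewrite -val_eqE /= inordK // ltnS primary_dec_le.
Qed.

Lemma prod_by_exponent (G : I -> F) :
  \prod_j G j = \prod_(i < n.+1) \prod_(j | a j == i) G j.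
Proof.
rewrite (partition_big (fun j => inord (a j) : 'I_n.+1) xpredT) //=.
apply: eq_bigr => i _; apply: eq_bigl => j.
by rewrite -val_eqE /= inordK // ltnS primary_dec_le.
Qed.

End PrimaryDec.

Lemma data_monic n (g : 'M[F]_n) u i : has_data g u -> u i \is monic.
Proof.
move=> [I [v [f [a [[fI _] ->]]]]]; apply: monic_prod => j _.
exact: (proj2 (proj1 (fI j))).
Qed.

Lemma data_out n (g : 'M[F]_n) u i : has_data g u -> ~~ (0 < i <= n)%N -> u i = 1.
Proof.
move=> [I [v [f [a [d ->]]]]] ni; rewrite big_pred0 // => j.
by apply: contraNF ni => /eqP <-; rewrite (proj2 (proj1 d j)) (primary_dec_le d).
Qed.

Lemma data_dim n (g : 'M[F]_n) u : has_data g u ->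
  (\sum_(i < n.+1) i * (size (u i)).-1 = n)%N.
Proof.
move=> [I [v [f [a [d uE]]]]]; rewrite -[RHS](primary_dec_dim d) (sum_by_exponent d).
apply: eq_bigr => i _; rewrite uE size_prod_monic => [|j _]; last exact: monic_irred_neq0 (proj1 (proj1 d j)).
by rewrite big_distrr; apply: eq_bigr => j /eqP->.
Qed.

Lemma data_det n (g : 'M[F]_n) u : has_data g u ->
  \det g = \prod_(i < n.+1) ((-1) ^+ (size (u i)).-1 * (u i)`_0) ^+ i.
Proof.
move=> [I [v [f [a [d uE]]]]]; rewrite (dec_det (proj2 d) (primary_dec_neq0 d)).
rewrite (prod_by_exponent d); apply: eq_bigr => i _.
rewrite uE -horner_coef0 horner_prod size_prod_monic => [|j _]; last exact: monic_irred_neq0 (proj1 (proj1 d j)).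
rewrite -prodrXr -big_split -prodrXl; apply: eq_bigr => j /eqP <- /=.
by rewrite size_exp exprM -horner_coef0 horner_exp exprMn.
Qed.

(** The summands are indexed by an exponent [i] and a position in the factorization of [u i]. *)
Lemma data_model n (u : nat -> {poly F}) :
    (forall i, u i \is monic) -> (forall i, ~~ (0 < i <= n)%N -> u i = 1) ->
    (\sum_(i < n.+1) i * (size (u i)).-1 = n)%N ->
  exists g : 'M[F]_n, has_data g u.
Proof.
move=> um u1 u_dim.
pose s i := s2val (cid2 (monic_factorization (um i))).
have sI i : {in s i, forall f, monic_irred f} := s2valP (cid2 (monic_factorization (um i))).
have us i : u i = \prod_(f <- s i) f := s2valP' (cid2 (monic_factorization (um i))).
have s0 i : u i = 1 -> s i = [::].
  move=> ui1; have := us i; rewrite ui1; case E: (s i) => [//|f t] e.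
  have fI : monic_irred f by apply: (sI i); rewrite E mem_head.
  have : f %| 1 by rewrite e big_cons dvdp_mulr.
  by rewrite dvdp1 gtn_eqF // monic_irred_size.
pose I : finType := {i : 'I_n.+1 & 'I_(size (s i))}.
pose f (j : I) : {poly F} := (s (tag j))`_(tagged j); pose a (j : I) : nat := tag j.
have fI j : monic_irred (f j) by apply: (sI (tag j)); rewrite mem_nth.
have a0 j : (0 < a j)%N.
  case: j => i k; rewrite /a /= lt0n; apply/negP => /eqP i0.
  by case: k => k /=; rewrite s0 // i0 u1.
have [|m [g [v [dg _]]]] := @dec_model F I (fun j => f j ^+ a j).
  move=> j; split; first by rewrite monic_exp // (proj2 (fI j)).
  by rewrite -subn_gt0 subn1 size_exp muln_gt0 a0 andbT -subn1 subn_gt0 monic_irred_size.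
have dP : primary_dec g v f a by split.
have prodE i : \prod_(j | a j == i) f j = u i.
  have [i_n|n_i] := ltnP i n.+1; last first.
    rewrite u1 ?big_pred0 // => [j|]; last by rewrite (leqNgt i) n_i andbF.
    by apply: contraTF n_i => /eqP <-; rewrite -ltnNge /a ltn_ord.
  rewrite us (big_nth 0) big_mkord.
  transitivity (\prod_(i' < n.+1 | i' == Ordinal i_n) \prod_(k < size (s i')) (s i')`_k).
    by rewrite sig_big_dep; apply: eq_bigl => j; rewrite /= andbT -val_eqE.
  by rewrite big_pred1_eq.
have mn : m = n.
  rewrite -(primary_dec_dim dP) -[RHS]u_dim.
  transitivity (\sum_(i < n.+1) \sum_(k < size (s i)) i * (size (nth 0%R (s i) k)).-1)%N.
    by rewrite sig_big_dep.
  apply: eq_bigr => i _; rewrite -big_distrr us (big_nth 0) big_mkord /= size_prod_monic //.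
  by move=> k _; apply: monic_irred_neq0; apply: (sI i); rewrite mem_nth.
have : exists g' : 'M[F]_m, has_data g' u.
  by exists g, I, v, f, a; split=> // i; rewrite prodE.
by rewrite mn.
Qed.

End Data.

(** * Types in terms of the similarity invariant *)

Section Type_.
Variable F : finFieldType.

Lemma monic_irred_mk_monic (h : {poly F}) : h \is monic -> (1 < size h)%N -> mk_monic h = h.
Proof. by move=> hm hs; rewrite /mk_monic hm hs. Qed.

Lemma qpoly_linearE n (g : 'M[F]_n) (h : {poly F})
    (phi : {linear {poly %/ h} -> 'cV[F]_n}) p :
    (forall x, phi ('qX * x) = g *m phi x) ->
  phi (in_qpoly h p) = pmx g p *m phi 1.
Proof.
move=> phiX; elim/poly_ind: p => [|p c IHp].
  by rewrite !linear0 mul0mx.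
have phiD x y : phi (x + y) = phi x + phi y by exact: linearD.
have phiZ b x : phi (b *: x) = b *: phi x by exact: linearZ.
rewrite mulrC -alg_polyC in_qpolyD phiD in_qpolyM phiX IHp in_qpolyZ phiZ in_qpoly1.
rewrite [pmx g (_ + _)]linearD /= mulmxDl pmxM pmxX -mulmxA; congr (_ + _).
by rewrite [pmx g _]linearZ /= pmx1 -scalemxAl mul1mx.
Qed.

(** The image of 1 generates a summand; conversely a generator [v] defines the map that sends the
    class of [p] to p(g) v. *)
Lemma mx_has_typeP n (g : 'M[F]_n) nu :
  mx_has_type g nu <-> exists2 u, has_data g u & forall i, count_mem i nu = (size (u i)).-1.
Proof.
split.
  move=> [k [f [a [[fI [phi [phiX phiB]]] nuE]]]].
  exists (fun i => \prod_(j | a j == i) f j); last first.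
    move=> i; rewrite nuE size_prod_monic // => j _.
    by have [fm _ _] := fI j; apply: monic_neq0.
  exists 'I_k, (fun j => phi j 1), f, a; split=> //.
  have hP j : f j ^+ a j \is monic /\ (1 < size (f j ^+ a j))%N.
    have [fm [fs _] aj] := fI j; split; first exact: monic_exp.
    by rewrite -subn_gt0 subn1 size_exp muln_gt0 aj andbT -subn1 subn_gt0.
  have hE j : mk_monic (f j ^+ a j) = f j ^+ a j by apply: monic_irred_mk_monic; apply hP.
  have linE p : lincomb g (fun j => phi j 1) p = \sum_j phi j (in_qpoly _ (p j)).
    by apply: eq_bigr => j _; rewrite (qpoly_linearE _ (phiX j)).
  pose Phi (x : {dffun forall j, {poly %/ f j ^+ a j}}) := \sum_j phi j (x j).
  split=> [j|]; first by have [fm fi aj] := fI j.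
  split=> [p|x].
    have -> : lincomb g (fun j => phi j 1) p = Phi [ffun j => in_qpoly _ (p j)].
      by rewrite linE; apply: eq_bigr => j _; rewrite ffunE.
    have Phi0 : Phi [ffun=> 0] = 0 by rewrite /Phi big1 // => j _; rewrite ffunE linear0.
    split=> [p0 j|hp].
      have /ffunP/(_ j) : [ffun j => in_qpoly (f j ^+ a j) (p j)] = [ffun=> 0] :> {dffun forall j, {poly %/ f j ^+ a j}}.
        by apply: (bij_inj phiB); rewrite -/(Phi _) -[RHS]/(Phi _) p0 Phi0.
      rewrite !ffunE => /(congr1 val) /=; rewrite hE -Pdiv.IdomainMonic.modpE ?(proj1 (hP j)) //.
      by move/eqP.
    rewrite -Phi0; congr Phi; apply/ffunP => j; rewrite !ffunE; apply: val_inj => /=.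
    rewrite hE -Pdiv.IdomainMonic.modpE ?(proj1 (hP j)) //.
    exact/eqP/hp.
  have [y <-] : exists y, Phi y = x by case: phiB => Psi _ K; exists (Psi x); apply: K.
  exists (fun j => val (y j)); rewrite linE; apply: eq_bigr => j _; congr (phi j _).
  by apply: val_inj; apply/esym/in_qpoly_small/size_mk_monic.
move=> [u [I [v [f [a [d uE]]]]] nuE]; have hP := primary_dec_neq0 d.
have hE j : mk_monic (f j ^+ a j) = f j ^+ a j by apply: monic_irred_mk_monic; apply hP.
pose r (j : 'I_#|I|) := enum_val j; have rB : bijective r by apply: enum_val_bij.
exists #|I|, (f \o r), (a \o r); split; last first.
  move=> i; rewrite nuE uE size_prod_monic => [|j _]; last first.
    exact: monic_irred_neq0 (proj1 (proj1 d j)).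
  by rewrite (reindex r) //=; apply: onW_bij.
split=> [j|]; first by have [[fi fm] aj] := proj1 d (r j).
(* The map uses reduced representatives. Its compatibility with t requires that reduction modulo the
   annihilator not change the value, which is [mod_ann]. *)
pose phi j : {linear {poly %/ f (r j) ^+ a (r j)} -> 'cV[F]_n} :=
  (mulmxr (v (r j)) \o pmx g \o @polyn F _)%FUN.
have phiE j (x : {poly %/ f (r j) ^+ a (r j)}) : phi j x = pmx g x *m v (r j) by [].
have mod_ann j p : pmx g (in_qpoly (f (r j) ^+ a (r j)) p) *m v (r j) = pmx g p *m v (r j).
  rewrite /= hE -Pdiv.IdomainMonic.modpE ?(proj1 (hP _)) //.
  rewrite [in RHS](divp_eq p (f (r j) ^+ a (r j))) [in RHS]linearD /= mulmxDl pmxM.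
  by rewrite -[X in X + _]mulmxA (dec_ann (proj2 d)) mulmx0 add0r.
exists phi; split=> [j x|].
  rewrite !phiE; apply: etrans (mod_ann j (polyn 'qX * polyn x)) _.
  rewrite mulrC pmxM -[LHS]mulmxA mod_ann pmxX mulmxA.
  by have := pmx_comm g x 'X; rewrite pmxX => ->; rewrite mulmxA.
have [lin0 gen] := dec_reindex rB (proj2 d).
pose Phi (x : {dffun forall j, {poly %/ f (r j) ^+ a (r j)}}) := \sum_j phi j (x j).
have PhiE x : Phi x = lincomb g (v \o r) (fun j => val (x j)) by [].
have PhiI : injective Phi.
  move=> x y /eqP; rewrite !PhiE -subr_eq0 -lincombB => /eqP/lin0 xy.
  apply/ffunP => j; apply: val_inj; apply/eqP; rewrite -subr_eq0; have := xy j.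
  apply: contraTT => xy0; apply/negP => /(dvdp_leq xy0); apply/negP; rewrite -ltnNge.
  by rewrite /= -[X in (_ < size (polyseq X))%N]hE; apply: (size_mk_monic (x j - y j)).
pose Psi x := [ffun j => in_qpoly (f (r j) ^+ a (r j)) (sval (cid (gen x)) j)] : {dffun forall j, {poly %/ f (r j) ^+ a (r j)}}.
have PsiK x : Phi (Psi x) = x.
  rewrite [RHS](svalP (cid (gen x))); apply: eq_bigr => j _; rewrite ffunE phiE /=.
  exact: mod_ann.
exists Psi => // x; apply: PhiI; exact: PsiK.
Qed.

End Type_.

(** * Determinants of the commutants up to scalars *)

Section DetPolyOfMatrix.

Lemma map_pmx (F L : fieldType) (iota : {rmorphism F -> L}) n (A : 'M[F]_n) p :
  map_mx iota (pmx A p) = pmx (map_mx iota A) (map_poly iota p).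
Proof.
case: n A => [|n] A; first by apply/matrixP => -[].
by rewrite !pmxE map_horner_mx.
Qed.

Lemma char_poly_horner (R : comNzRingType) n (A : 'M[R]_n) x :
  (char_poly A).[x] = \det (x%:M - A).
Proof.
rewrite -horner_evalE -det_map_mx; congr (\det _); apply/matrixP => i j.
by rewrite !mxE /= horner_evalE !hornerE; case: (i == j); rewrite ?mulr1n ?mulr0n !hornerE.
Qed.

Lemma det_pmx_split (L : fieldType) n (A : 'M[L]_n) c (s : seq L) :
  \det (pmx A (c *: \prod_(b <- s) ('X - b%:P)))
    = c ^+ n * \prod_(b <- s) ((-1) ^+ n * (char_poly A).[b]).
Proof.
rewrite linearZ detZ; congr (_ * _); elim: s => [|b s IHs].
  by rewrite !big_nil /= pmx1 det1.
rewrite !big_cons /= pmxM det_mulmx IHs; congr (_ * _).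
rewrite linearB /= pmxX pmxC char_poly_horner -detZ scaleN1r opprB //.
Qed.

Lemma det_expmx (R : comPzRingType) n (A : 'M[R]_n) k : \det (A ^+ k) = \det A ^+ k.
Proof. by elim: k => [|k IHk]; rewrite ?expr0 ?det1 // !exprS det_mulmx IHk. Qed.

(* Over a splitting field of [p], the determinant of [p(A)] is a product of values
   of the characteristic polynomial of [A]. *)
Lemma det_pmx_exp (F : finFieldType) m d a (A : 'M[F]_m) (B : 'M[F]_d) p :
  char_poly A = char_poly B ^+ a -> \det (pmx A p) = \det (pmx B p) ^+ a.
Proof.
move=> AB; have mda : m = (d * a)%N.
  by have := congr1 (fun q : {poly F} => (size q).-1) AB; rewrite size_exp !size_char_poly.
have [L [iota _]] := countable_algebraic_closure F.
apply: (fmorph_inj iota); rewrite rmorphXn /= -!det_map_mx !map_pmx.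
have [s ->] := closed_field_poly_normal (map_poly iota p).
rewrite !det_pmx_split -!map_char_poly AB mda exprMn -exprM; congr (_ * _).
rewrite -prodrXl; apply: eq_bigr => b _.
by rewrite rmorphXn horner_exp exprMn -exprM.
Qed.

End DetPolyOfMatrix.

(** * Norms from F[t]/f to F *)

Section Norm.
Variable F : finFieldType.
Local Notation q := #|F|.

Lemma pchar_nat_card : [pchar F].-nat q.
Proof.
have [p pr_p pF] := finPcharP F.
rewrite (eq_pnat _ (pcharf_eq pF)) (@card_pprimeChar p F pF) pnatX.
by rewrite pnat_id.
Qed.

(** The [q]-th power map is additive and fixes [F], so it sends roots of a polynomial over [F] to
    roots. *)
Lemma frobenius_horner (K : finFieldType) (iota : {rmorphism F -> K}) p x :
  (map_poly iota p).[x ^+ q] = (map_poly iota p).[x] ^+ q.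
Proof.
have qK : [pchar K].-nat q by rewrite (eq_pnat _ (fmorph_pchar iota)) pchar_nat_card.
elim/poly_ind: p => [|p c IHp].
  by rewrite rmorph0 !horner0 expr0n; case: eqP (finNzRing_gt1 F) => // ->.
rewrite rmorphD rmorphM /= map_polyX map_polyC !hornerE /= IHp.
by rewrite exprDn_pchar // exprMn -rmorphXn expf_card.
Qed.

Section Irreducible.
Variable f : {poly F}.
Hypothesis fI : monic_irred f.
Let K : finFieldType := {poly %/ f with fI}.
Let iota : {rmorphism F -> K} := qpolyC f.
Local Notation d := (size f).-1.

Let cardK : #|K| = (q ^ d)%N. Proof. exact: card_qfpoly. Qed.

Let fE : mk_monic f = f. Proof. exact: mk_monicE fI. Qed.

Lemma in_qpoly_eq0 p : (in_qpoly f p == 0) = (f %| p).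
Proof.
rewrite -val_eqE /= fE -Pdiv.IdomainMonic.modpE ?(proj2 fI) //.
Qed.

(** The class of t is a nonzero element of the field F[t]/f with q^d elements, so q^d - 1 serves;
    this number is -1 in [F], hence invertible there. *)
Lemma irred_dvd_Xn_sub1 : f`_0 != 0 ->
  exists2 e, f %| 'X^e - 1 & (e%:R != 0 :> F) && (0 < e)%N.
Proof.
move=> f0; have d0 : (0 < d)%N by rewrite -subn1 subn_gt0 monic_irred_size.
have q1 : (1 < q ^ d)%N by rewrite -(expn0 q) ltn_exp2l // finNzRing_gt1.
exists (q ^ d).-1; last first.
  rewrite -subn1 subn_gt0 q1 andbT natrB ?(ltnW q1) // natrX.
  have -> : q%:R = 0 :> F.
    have [p pr_p pF] := finPcharP F; apply/eqP; rewrite -(dvdn_pcharf pF).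
    have := pchar_nat_card; rewrite (eq_pnat _ (pcharf_eq pF)) => /p_natP[[|k] qE].
      by have := finNzRing_gt1 F; rewrite qE.
    by rewrite qE expnS dvdn_mulr.
  by rewrite expr0n gtn_eqF // sub0r oppr_eq0 oner_eq0.
have : f %| 'X * ('X^((q ^ d).-1)%N - 1).
  rewrite mulrBr mulr1 -exprS prednK ?(ltnW q1) // -in_qpoly_eq0 linearB /= subr_eq0.
  by rewrite rmorphXn -cardK; apply/eqP/(@expf_card K).
rewrite monic_irred_dvdM // => /orP[|//] fX.
have [fI1 fm] := fI; have XI : monic_irred ('X : {poly F}).
  by split; [rewrite -[X in irreducible_poly X]subr0; apply: irredp_XsubC|exact: monicX].
by move: fX f0; rewrite monic_irred_dvd // => /eqP ->; rewrite coefX eqxx.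
Qed.

(* A generator [w] of the multiplicative group of [K = F[t] / f] has the [d]
   distinct conjugates [w ^ q ^ k], so its norm is [w ^ (1 + q + ... + q ^ (d - 1))];
   this generates the multiplicative group of [F]. *)
Lemma norm_generator : exists p : {poly F}, forall m (A : 'M[F]_m) x,
  char_poly A = f -> x != 0 -> exists k, x = \det (pmx A (p ^+ k)).
Proof.
have d0 : (0 < d)%N by rewrite -subn1 subn_gt0 monic_irred_size.
have q1 := finNzRing_gt1 F; have q0 := ltnW q1.
have [w genw] := cyclicP (field_unit_group_cyclic [set: {unit K}]).
have ow : #[w]%g = (q ^ d).-1 by rewrite orderE -genw -cardK -card_finField_unit.
pose p : {poly F} := polyn (val w); pose N := (\sum_(k < d) q ^ k)%N.
have NqE : (q ^ d).-1 = (q.-1 * N)%N by rewrite predn_exp.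
have wX k : val (w ^+ k)%g = val w ^+ k by rewrite FinRing.val_unitX.
have det_pE m (A : 'M[F]_m) : char_poly A = f -> iota (\det (pmx A p)) = val w ^+ N.
  move=> fA; pose chi := char_poly (companionmx f)^T.
  have <- : \det (pmx (companionmx f)^T p) = \det (pmx A p).
    by rewrite (@det_pmx_exp F _ _ 1 _ A) ?expr1 // fA char_companion_tr // (proj2 fI).
  pose B := pmx (companionmx f)^T p.
  (* Cayley-Hamilton for B = p(C) says that [f] divides [char_poly B \Po p], that is, that the class
     of [p] is a root of [char_poly B]. *)
  have root_w : (map_poly iota (char_poly B)).[val w] = 0.
    have -> : val w = in_qpoly f p by apply/val_inj/esym/in_qpoly_small/size_mk_monic.
    rewrite -in_qpoly_comp_horner; apply/eqP; rewrite in_qpoly_eq0.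
    have [v [lin0 _]] := companion_dec (proj2 fI) (monic_irred_size fI).
    have := lin0 (fun=> char_poly B \Po p); rewrite /lincomb big_ord1.
    have -> : pmx (companionmx f)^T (char_poly B \Po p) = pmx B (char_poly B).
      rewrite comp_polyE [LHS]linear_sum; apply: eq_bigr => i _.
      by rewrite linearZ /= pmx_exp.
    by rewrite pmx_char mul0mx => -[/(_ erefl)/(_ ord0)].
  pose rs := [seq val w ^+ (q ^ k)%N | k <- index_iota 0 d].
  have rs_root : all (root (map_poly iota (char_poly B))) rs.
    apply/allP => _ /mapP[k _ ->]; rewrite /root; apply/eqP.
    elim: k => [|k IHk]; first by rewrite expn0 expr1.
    by rewrite expnSr exprM frobenius_horner IHk expr0n gtn_eqF.
  have rs_uniq : uniq rs.
    rewrite map_inj_in_uniq ?iota_uniq // => i j; rewrite !mem_index_iota /= => id_ jd.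
    have aux k l : (k <= l < d)%N -> (q ^ k == q ^ l %[mod #[w]%g])%N -> k = l.
      move=> /andP[kl ld]; rewrite eq_sym eqn_mod_dvd ?leq_pexp2l // => kl_dvd.
      have lt1 : (q ^ l < q ^ l.+1)%N by rewrite ltn_exp2l.
      have le2 : (q ^ l.+1 <= q ^ d)%N by rewrite leq_pexp2l.
      have kl0 : (q ^ l - q ^ k = 0)%N.
        apply/eqP; apply: contraLR kl_dvd; rewrite -lt0n => kl0; rewrite gtnNdvd //.
        have : (0 < q ^ k)%N by rewrite expn_gt0 q0.
        by rewrite ow; move: (q ^ l)%N (q ^ k)%N (q ^ d)%N (q ^ l.+1)%N lt1 le2 kl0 => *; lia.
      apply/eqP; rewrite -(eqn_exp2l _ _ q1) eqn_leq leq_pexp2l //=.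
      by rewrite -subn_eq0 kl0.
    rewrite -!wX => /val_inj/eqP; rewrite eq_expg_mod_order => ij.
    by have [le_ij|/ltnW le_ij] := leqP i j; [|apply/esym]; apply: aux; rewrite ?le_ij // eq_sym.
  have szB : size (map_poly iota (char_poly B)) = (size rs).+1.
    by rewrite size_map_poly size_char_poly size_map size_iota subn0.
  have := all_roots_prod_XsubC szB rs_root; rewrite uniq_rootsE => /(_ rs_uniq).
  rewrite lead_coef_map (monicP (char_poly_monic B)) rmorph1 scale1r.
  move/(congr1 (fun P : {poly K} => P.[0])); rewrite horner_coef0 coef_map char_poly_det.
  rewrite horner_prod big_map big_mkord /= rmorphM rmorphXn rmorphN1.
  under eq_bigr do rewrite hornerXsubC sub0r.
  rewrite prodrN card_ord => /(mulfI _) ->; last by rewrite expf_neq0 // oppr_eq0 oner_eq0.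
  by rewrite prodrXr.
exists p => m A x fA x0.
have iotax0 : iota x != 0 by rewrite fmorph_eq0.
have [k wk] : exists k, iota x = val w ^+ k.
  have : finField_unit iotax0 \in [set: {unit K}] by rewrite inE.
  rewrite genw => /cycleP[k /(congr1 val)]; rewrite wX /= => e; exists k.
  exact: e.
(* As [w ^+ k] comes from [F], its power of exponent q - 1 is 1, so the order (q - 1) N of [w]
   divides k (q - 1). *)
have : (N %| k)%N.
  have q10 : (0 < q.-1)%N by rewrite -subn1 subn_gt0.
  rewrite -(@dvdn_pmul2l q.-1) // -NqE -ow order_dvdn -val_eqE wX /= mulnC exprM -wk.
  rewrite -rmorphXn -(rmorph1 iota); apply/eqP; congr (iota _).
  by apply: (mulIf x0); rewrite mul1r -exprSr prednK // expf_card.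
case/dvdnP => l kE; exists l; apply: (fmorph_inj iota).
by rewrite wk kE mulnC exprM -(det_pE _ _ fA) -rmorphXn /= pmx_exp det_expmx.
Qed.

End Irreducible.
End Norm.

(** * Determinants on invariant subspaces *)

Section StableDet.
Variable F : fieldType.

(* Row spaces and maps acting on the right. *)
Definition stable_det m n (W : 'M[F]_(m, n)) (c : 'M[F]_n) : F := \det (restrictmx W c).

Lemma stable_detE m n (W : 'M[F]_(m, n)) c r (B : 'M[F]_(r, n)) (C : 'M[F]_r) :
  row_free B -> (B :=: W)%MS -> B *m c = C *m B -> stable_det W c = \det C.
Proof.
move=> Bf BW Bc; pose B0 := row_base W; pose C0 := restrictmx W c.
have B0f : row_free B0 by apply: row_base_free.
have B0W : (B0 :=: W)%MS by apply: eq_row_base.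
have B0c : B0 *m c = C0 *m B0.
  rewrite /C0 /conjmx mulmxKpV // (eqmxMr c B0W) B0W -BW.
  by rewrite -(eqmxMr c BW) Bc submxMl.
have [P PE] : exists P, B = P *m B0 by apply/submxP; rewrite BW B0W.
have [Q QE] : exists Q, B0 = Q *m B by apply/submxP; rewrite BW B0W.
have PQ : P *m Q = 1%:M.
  by apply: (row_free_inj Bf); rewrite mul1mx -mulmxA -QE -PE.
have CP : C *m P = P *m C0.
  by apply: (row_free_inj B0f); rewrite -[LHS]mulmxA -PE -Bc -[RHS]mulmxA -B0c [RHS]mulmxA -PE.
have rW : r = \rank W by rewrite -BW; apply/esym/eqP.
have CE : C = P *m C0 *m Q by rewrite -CP -mulmxA PQ mulmx1.
have QP : Q *m P = 1%:M.
  by apply: (row_free_inj B0f); rewrite mul1mx -mulmxA -PE -QE.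
by rewrite CE -[P *m C0]/(P *m C0) (det_conj C0 (esym rW) QP).
Qed.

Lemma eq_stable_det m1 m2 n (W1 : 'M[F]_(m1, n)) (W2 : 'M[F]_(m2, n)) c :
  (W1 :=: W2)%MS -> (W1 *m c <= W1)%MS -> stable_det W1 c = stable_det W2 c.
Proof.
move=> W12 W1c; apply/esym/(@stable_detE _ _ _ _ _ (row_base W1)).
- exact: row_base_free.
- exact: (eqmx_trans (eq_row_base W1) W12).
by rewrite /conjmx mulmxKpV // (eqmxMr c (eq_row_base W1)) eq_row_base.
Qed.

Lemma stable_det1 n (c : 'M[F]_n) : stable_det 1%:M c = \det c.
Proof. by apply: (@stable_detE _ _ _ _ _ 1%:M); rewrite ?mul1mx ?mulmx1 // /row_free mxrank1. Qed.

Lemma stable_det0 m n (c : 'M[F]_n) : stable_det (0 : 'M_(m, n)) c = 1.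
Proof.
rewrite (@stable_detE _ _ _ c 0 0 1%:M) ?det1 ?mulmx1 ?mul0mx ?mulmx0 //.
  by rewrite /row_free mxrank0.
by apply/eqmxP; rewrite !sub0mx.
Qed.

Lemma stable_det_scalar m n (W : 'M[F]_(m, n)) c a :
  (W *m c = a *: W) -> stable_det W c = a ^+ \rank W.
Proof.
move=> Wc; rewrite (@stable_detE _ _ W c _ (row_base W) a%:M) ?det_scalar ?row_base_free //.
  exact: eq_row_base.
have [P PE] : exists P, row_base W = P *m W by apply/submxP; rewrite eq_row_base.
by rewrite PE -mulmxA Wc -scalemxAr mul_scalar_mx.
Qed.

(** Multiplicativity of the determinant of [c] along the exact sequence of [W] under [N], with
    kernel [W :&: kermx N] and image [W *m N]. *)
Lemma stable_det_ker m n (W : 'M[F]_(m, n)) (c N : 'M[F]_n) :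
    (W *m c <= W)%MS -> c *m N = N *m c ->
  stable_det W c = stable_det (W :&: kermx N)%MS c * stable_det (W *m N) c.
Proof.
move=> Wc cN; set K := (W :&: kermx N)%MS; set D := (W :\: kermx N)%MS.
have KN : K *m N = 0 by apply/sub_kermxP; apply: capmxSr.
have DW : (D <= W)%MS by apply: diffmxSl.
pose B1 := row_base K; pose B2 := row_base D.
have [B1K B2D] : (B1 :=: K)%MS /\ (B2 :=: D)%MS by split; apply: eq_row_base.
have KDW : (K + D :=: W)%MS.
  by rewrite addsmxC; apply: addsmx_diff_cap_eq.
have KD0 : (D :&: kermx N = 0)%MS by apply: capmx_diff.
have Kc : (K *m c <= K)%MS.
  rewrite sub_capmx (submx_trans (submxMr c (capmxSl _ _)) Wc) /=.
  by apply/sub_kermxP; rewrite -mulmxA cN mulmxA KN mul0mx.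
have B1c : (B1 *m c <= B1)%MS by rewrite B1K (submx_trans (submxMr c _) Kc) // B1K.
have /submxP[C1 C1E] := B1c.
have : (B2 *m c <= col_mx B1 B2)%MS.
  rewrite -addsmxE (adds_eqmx B1K B2D) KDW (submx_trans _ Wc) // submxMr //.
  by rewrite B2D.
case/submxP => X XE; rewrite -[X]hsubmxK mul_row_col in XE.
have rB12 : row_free (col_mx B1 B2).
  rewrite /row_free -addsmxE mxrank_disjoint_sum ?(eqnP (row_base_free _)) //.
  apply/eqP; rewrite -submx0 -KD0 sub_capmx.
  rewrite (submx_trans (capmxSr _ _)) ?B2D //= (submx_trans (capmxSl _ _)) // B1K.
  exact: capmxSr.
rewrite (@stable_detE _ _ W c _ (col_mx B1 B2) (block_mx C1 0 (lsubmx X) (rsubmx X))) //.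
- rewrite det_lblock; congr (_ * _).
    by apply/esym/(@stable_detE _ _ _ _ _ B1) => //; apply: row_base_free.
  apply/esym/(@stable_detE _ _ _ _ _ (B2 *m N)).
  - rewrite /row_free; have := mxrank_mul_ker B2 N.
    have -> : (B2 :&: kermx N = 0)%MS.
      by apply/eqP; rewrite -submx0 -KD0 capmxS // B2D.
    by rewrite mxrank0 addn0 => ->; apply: row_base_free.
  - apply: eqmx_trans (eqmxMr N B2D) _; apply/eqmxP; rewrite submxMr //=.
    by rewrite -(eqmxMr N KDW) addsmxMr KN adds0mx.
  have B1N : B1 *m N = 0 by apply/sub_kermxP; rewrite B1K capmxSr.
  by rewrite -mulmxA -cN mulmxA XE mulmxDl -mulmxA B1N mulmx0 add0r mulmxA.
- exact: eqmx_trans (eqmx_sym (addsmxE _ _)) (eqmx_trans (adds_eqmx B1K B2D) KDW).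
by rewrite mul_col_mx mul_block_col mul0mx addr0 C1E XE.
Qed.

End StableDet.

Section KernelImage.
Variables (F : fieldType) (n : nat) (g : 'M[F]_n) (I : finType).
Variables (v : I -> 'cV[F]_n) (f : I -> {poly F}) (a : I -> nat) (p : {poly F}).
Hypothesis d : primary_dec g v f a.
Hypothesis p_sqf : forall j, ~~ (f j ^+ 2 %| p).

Lemma primary_ker_im i (x : 'cV[F]_n) : (forall j, f j %| p -> a j <> i.+1) ->
    pmx g p *m x = 0 -> (exists y : 'cV[F]_n, x = pmx g (p ^+ i) *m y) ->
  exists y : 'cV[F]_n, x = pmx g (p ^+ i.+1) *m y.
Proof.
move=> ai px0 [y xE]; have [fI dv] := d; have [lin0 gen] := dv.
have [r yE] := gen y.
have hr j : f j ^+ a j %| p ^+ i.+1 * r j.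
  by move: j; apply/lin0; rewrite lincombM -yE exprS pmxM -mulmxA -xE.
have s_ex j : exists s, f j ^+ a j %| p ^+ i.+1 * s - p ^+ i * r j.
  have [fj aj] := fI j; have [fp|nfp] := boolP (f j %| p); last first.
    exists 0; rewrite mulr0 sub0r dvdpNr dvdp_mull //; have := hr j.
    by rewrite Gauss_dvdpr // coprimep_expl // coprimep_expr // monic_irred_coprime.
  have [ai1|ia] := ltnP (a j) i.+1.
    exists 0; rewrite mulr0 sub0r dvdpNr dvdp_mulr //.
    by apply: dvdp_trans (dvdp_exp2r i fp); apply: dvdp_exp2l.
  have {}ia : (i.+1 < a j)%N by rewrite ltn_neqAle ia andbT eq_sym; apply/eqP/ai.
  have /dvdpP[p' pE] := fp.
  have fp' : coprimep (f j ^+ a j) p'.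
    rewrite coprimep_expl // monic_irred_coprime //; apply: contra (p_sqf j) => fp'.
    by rewrite pE expr2 dvdp_mul.
  have /dvdpP[r' rE] : f j %| r j.
    have := hr j; rewrite pE exprMn -mulrA Gauss_dvdpr ?coprimep_expr //.
    rewrite -{1}(subnKC ia) addSn -addnS exprD dvdp_mul2l ?exp_monic_irred_neq0 //.
    by rewrite exprS => /(dvdp_trans (dvdp_mulr _ (dvdpp _))).
  have /Bezout_eq1_coprimepP[[s t] /= st] := fp'.
  exists (t * r'); rewrite rE.
  have -> : p ^+ i.+1 * (t * r') - p ^+ i * (r' * f j) = - (p ^+ i * r' * f j * s) * f j ^+ a j.
    have -> : p ^+ i * (r' * f j) = p ^+ i * (r' * f j) * (s * f j ^+ a j + t * p') by rewrite st mulr1.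
    by rewrite exprSr {2}pE; ring.
  exact: dvdp_mulIr.
have [s sE] := choice s_ex.
exists (lincomb g v s); apply/esym/eqP; rewrite xE yE -!lincombM -subr_eq0 -lincombB.
by apply/eqP/lin0.
Qed.

Lemma primary_ker_im_mx i : (forall j, f j %| p -> a j <> i.+1) ->
  (((pmx g p)^T ^+ i :&: kermx (pmx g p)^T) <= (pmx g p)^T ^+ i.+1)%MS.
Proof.
move=> ai; have trX k : (pmx g p)^T ^+ k = (pmx g (p ^+ k))^T.
  rewrite pmx_exp; elim: k => [|k IHk]; first by rewrite !expr0 trmx1.
  by rewrite exprS exprSr IHk [RHS]trmx_mul.
rewrite !trX; apply/rV_subP => u; rewrite sub_capmx => /andP[/submxP[w wE] /sub_kermxP up].
have [||y yE] := @primary_ker_im i u^T ai.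
- by rewrite -[pmx g p]trmxK -trmx_mul up trmx0.
- by exists w^T; rewrite wE trmx_mul trmxK.
by apply/submxP; exists y^T; rewrite -trmx_mul -yE trmxK.
Qed.

End KernelImage.

Section NilpotentCommutant.
Variables (F : fieldType) (n : nat) (c N : 'M[F]_n).
Hypotheses (c_unit : c \in unitmx) (cN : c *m N = N *m c).

(** The quotient of [E k] by [E k.+1] has one dimension for each Jordan block of [N] of size [k.+1]
    and eigenvalue 0. *)
Let E k := (N ^+ k :&: kermx N)%MS.

Lemma comm_expmx k : c *m N ^+ k = N ^+ k *m c.
Proof.
elim: k => [|k IHk]; first by rewrite !expr0 mulmx1 mul1mx.
by rewrite exprS mulmxA cN -mulmxA IHk mulmxA.
Qed.

Lemma stable_exp k : (N ^+ k *m c <= N ^+ k)%MS.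
Proof. by rewrite -comm_expmx submxMl. Qed.

Lemma det_comm_exp k : \det c = (\prod_(i < k) stable_det (E i) c) * stable_det (N ^+ k) c.
Proof.
elim: k => [|k ->]; first by rewrite big_ord0 mul1r expr0 stable_det1.
by rewrite big_ord_recr /= -mulrA (stable_det_ker (stable_exp k) cN) -[N ^+ k *m N]/(N ^+ k * N) -exprSr.
Qed.

Lemma stable_det_cap_neq0 k : stable_det (E k) c != 0.
Proof.
have := det_comm_exp k.+1; rewrite big_ord_recr /= => detE.
by move: c_unit; rewrite unitmxE unitfE detE !mulf_eq0 !negb_or -andbA => /and3P[].
Qed.

(* On [E i], the factors with [j >= i] of the product of [det_comm_exp] telescope. *)
Lemma det_comm_nilpotent M (P : pred nat) : N ^+ M = 0 ->
    (forall i, ~~ P i.+1 -> (E i <= N ^+ i.+1)%MS) ->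
  exists2 x : nat -> F, forall i, x i != 0 /\ (~~ P i -> x i = 1) &
    \det c = \prod_(i < M) x i.+1 ^+ i.+1.
Proof.
move=> NM EP; pose e k := stable_det (E k) c.
have e0 k : e k != 0 by apply: stable_det_cap_neq0.
have EM : e M = 1.
  rewrite /e -(@eq_stable_det _ _ _ _ (0 : 'M_n)) ?stable_det0 ?mul0mx //.
  by apply/eqmxP; rewrite sub0mx /= (submx_trans (capmxSl _ _)) // NM.
have NS i : (N ^+ i.+1 <= N ^+ i)%MS by rewrite exprS submxMl.
have Ee i : ~~ P i.+1 -> e i = e i.+1.
  move=> Pi; apply: eq_stable_det.
    apply/eqmxP; rewrite !sub_capmx !capmxSr EP //= (submx_trans (capmxSl _ _)) //= .
  rewrite sub_capmx (submx_trans (submxMr c (capmxSl _ _)) (stable_exp i)) /=.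
  apply/sub_kermxP; rewrite -mulmxA cN mulmxA.
  have /sub_kermxP-> : (E i <= kermx N)%MS by apply: capmxSr.
  exact: mul0mx.
(* The value at [j.+1] is the determinant of [c] on the quotient of [E j] by [E j.+1]; it occurs in
   the determinant of [c] once for each of the [j.+1] levels of the blocks of that size. *)
exists (fun i => if i is j.+1 then e j / e j.+1 else 1).
  case=> [|i]; first by rewrite oner_eq0.
  split; first by rewrite mulf_neq0 ?invr_eq0.
  by move=> /Ee->; rewrite divff.
have := det_comm_exp M; rewrite NM stable_det0 mulr1 => ->.
suff : forall k, \prod_(i < k) e i = (\prod_(i < k) (e i / e i.+1) ^+ i.+1) * e k ^+ k.
  by move/(_ M); rewrite EM expr1n mulr1.
elim=> [|k IHk]; first by rewrite !big_ord0 expr0 mulr1.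
rewrite !big_ord_recr /= IHk -!mulrA; congr (_ * _).
by rewrite -exprMn divfK // exprSr.
Qed.

End NilpotentCommutant.

Section Squarefree.
Variable F : fieldType.

Lemma monic_irred_ndvdX p : monic_irred p -> p`_0 != 0 -> ~~ (p %| ('X : {poly F})).
Proof.
move=> pI; apply: contra => pX.
have XI : monic_irred ('X : {poly F}).
  by split; [rewrite -[X in irreducible_poly X]subr0; apply: irredp_XsubC|exact: monicX].
by move: pX; rewrite monic_irred_dvd // => /eqP ->; rewrite coefX eqxx.
Qed.

(** Separability: a double factor would divide the derivative e X^(e-1), hence X. *)
Lemma square_ndvd_Xn_sub1 (p : {poly F}) e : e%:R != 0 :> F -> monic_irred p -> p`_0 != 0 ->
  ~~ (p ^+ 2 %| 'X^e - 1).
Proof.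
move=> eF pI p0; apply/negP => /dvdpP[c cE].
have : p %| ('X^e - 1)^`().
  rewrite cE derivM expr2 derivM; apply/dvdpP.
  by exists (c^`() * p + c * (p^`() + p^`())); ring.
rewrite derivB derivC subr0 derivXn -scaler_nat dvdpZr //.
by move/(monic_irred_dvdX pI); apply/negP/monic_irred_ndvdX.
Qed.

End Squarefree.

Section CentralizerDet.
Variables (F : finFieldType) (n : nat) (g : 'M[F]_n) (I : finType).
Variables (v : I -> 'cV[F]_n) (f : I -> {poly F}) (a : I -> nat).
Hypothesis d : primary_dec g v f a.
Hypothesis f0 : forall j, (f j)`_0 != 0.

(** The factor q - 1 of [e] makes scalars disappear from g^e, the factors [e0 j] make g^e - 1
    nilpotent, and invertibility of [e] in [F] excludes double factors, so that the exponents [a j]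
    survive as Jordan block sizes. *)
Lemma common_exponent : exists e : nat, [/\ forall z : F, z != 0 -> z ^+ e = 1,
  forall j, f j %| 'X^e - 1 & forall j, ~~ (f j ^+ 2 %| 'X^e - 1)].
Proof.
have [fI _] := d.
have e_ex j := irred_dvd_Xn_sub1 (proj1 (fI j)) (f0 j).
pose e0 j := s2val (cid2 (e_ex j)).
have fe0 j : f j %| 'X^(e0 j) - 1 := s2valP (cid2 (e_ex j)).
have e0P j : (e0 j)%:R != 0 :> F by case/andP: (s2valP' (cid2 (e_ex j))).
have e0_gt j : (0 < e0 j)%N by case/andP: (s2valP' (cid2 (e_ex j))).
have q1 := finNzRing_gt1 F; have q10 : (0 < #|F|.-1)%N by rewrite -subn1 subn_gt0.
pose e := (#|F|.-1 * \prod_j e0 j)%N.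
have eF : e%:R != 0 :> F.
  rewrite natrM mulf_neq0 //; last first.
    by rewrite natr_prod; apply/prodf_neq0 => j _.
  have : #|F|.-1%:R + 1 = 0 :> F.
    rewrite natr1 prednK ?(ltnW q1) //.
    have [p pr_p pF] := finPcharP F; apply/eqP; rewrite -(dvdn_pcharf pF).
    have := pchar_nat_card F; rewrite (eq_pnat _ (pcharf_eq pF)) => /p_natP[[|k] qE].
      by move: q1; rewrite qE.
    by rewrite qE expnS dvdn_mulr.
  by move/eqP; apply: contraTneq => ->; rewrite add0r oner_eq0.
exists e; split=> [z z0|j|j].
- rewrite exprM; have -> : z ^+ #|F|.-1 = 1; last by rewrite expr1n.
  by apply: (mulIf z0); rewrite mul1r -exprSr prednK ?(ltnW q1) // expf_card.
- have [k eE] : exists k, e = (e0 j * k)%N.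
    by exists (#|F|.-1 * \prod_(i | i != j) e0 i)%N; rewrite /e (bigD1 j) //= mulnCA.
  by rewrite eE exprM subrX1 dvdp_mulr.
by apply: square_ndvd_Xn_sub1 => //; apply: (proj1 (fI j)).
Qed.

(** All Jordan blocks of the nilpotent matrix g^e - 1 have size some [a j]. The determinant of a
    matrix commuting with it is a product of powers whose exponents are such sizes, all divisible by
    [D]. *)
Lemma det_scaled_commutant (c : 'M[F]_n) mu D : c \in unitmx -> mu != 0 ->
    c *m g = (mu *: g) *m c -> (forall j, D %| a j)%N ->
  exists y, \det c = y ^+ D.
Proof.
move=> cU mu0 cg Da; have [e [muE fe nfe]] := common_exponent.
pose P : {poly F} := 'X^e - 1; pose N := (pmx g P)^T.
have cX k : c *m g ^+ k = (mu ^+ k *: g ^+ k) *m c.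
  elim: k => [|k IHk]; first by rewrite !expr0 scale1r mulmx1 mul1mx.
  rewrite exprS mulmxA cg -mulmxA IHk mulmxA exprS; congr (_ *m _).
  by rewrite -scalemxAl -scalemxAr scalerA.
have cN : c^T *m N = N *m c^T.
  rewrite /N -!trmx_mul; congr _^T; rewrite linearB /= pmx1 pmxXn mulmxBr mulmxBl.
  by rewrite cX muE // scale1r mulmx1 mul1mx.
have [fI [lin0 gen]] := d.
have NM : N ^+ n = 0.
  have trX k : N ^+ k = (pmx g (P ^+ k))^T.
    rewrite pmx_exp; elim: k => [|k IHk]; first by rewrite !expr0 trmx1.
    by rewrite exprS exprSr IHk [RHS]trmx_mul.
  rewrite trX -[RHS]trmx0; congr _^T; apply: (dec_eq (proj2 d)) => p.
  rewrite mul0mx -lincombM; apply/lin0 => j; rewrite dvdp_mulr //.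
  by apply: dvdp_trans (dvdp_exp2r n (fe j)); apply: dvdp_exp2l; apply: primary_dec_le d j.
have cTU : c^T \in unitmx by rewrite unitmx_tr.
have [|x xP] := det_comm_nilpotent cTU cN (P := fun i => [exists j, a j == i]) NM.
  move=> i /existsPn ai; apply: (primary_ker_im_mx d nfe) => j _.
  exact/eqP/ai.
rewrite det_tr => ->; exists (\prod_(i < n) x i.+1 ^+ (i.+1 %/ D)).
rewrite -prodrXl; apply: eq_bigr => i _; rewrite -exprM.
have [Di|nDi] := boolP (D %| i.+1)%N; first by rewrite divnK.
have [_ ->] := xP i.+1; first by rewrite !expr1n.
by apply: contra nDi => /existsP[j /eqP <-].
Qed.

(** The exponents [k] for which every [k]-th power is attained are closed under gcd by Bezout; each
    [a j] is one, by surjectivity of the norm on summand [j]. *)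
Lemma det_centralizer x : x != 0 -> exists c : 'M[F]_n,
  [/\ c \in unitmx, c *m g = g *m c & \det c = x ^+ (\big[gcdn/0]_j a j)].
Proof.
pose S k := forall x : F, x != 0 -> exists c : 'M[F]_n,
  [/\ c \in unitmx, c *m g = g *m c & \det c = x ^+ k].
suff : S (\big[gcdn/0]_j a j)%N by apply.
have S0 : S 0%N by move=> y y0; exists 1%:M; rewrite unitmx1 mul1mx mulmx1 det1.
have SM k l (u : F) w : u != 0 -> w != 0 -> S k -> S l ->  exists c : 'M[F]_n,
    [/\ c \in unitmx, c *m g = g *m c & \det c = u ^+ k * w ^+ l].
  move=> u0 w0 /(_ u u0)[c [cU cg cd]] /(_ w w0)[c' [cU' cg' cd']].
  exists (c *m c'); rewrite unitmx_mul cU cU' det_mulmx cd cd'; split=> //.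
  by rewrite -mulmxA cg' mulmxA cg mulmxA.
apply: (big_ind S) => // [k l Sk Sl y y0|j _ y y0].
  have [k0|k0] := posnP k; first by rewrite k0 gcd0n; apply: Sl.
  case: (egcdnP l k0) => km kn kE _.
  have [||c [cU cg cd]] := SM k l (y ^+ km) (y ^- kn) _ _ Sk Sl.
  - by rewrite expf_neq0.
  - by rewrite invr_eq0 expf_neq0.
  exists c; split=> //; rewrite cd exprVn -!exprM kE exprD mulrAC divff ?mul1r //.
  by rewrite expf_neq0.
have [fI dv] := d; have [p pP] := norm_generator (proj1 (fI j)).
have fj : char_poly (companionmx (f j))^T = f j by rewrite char_companion_tr // (proj2 (proj1 (fI j))).
have [k yE] := pP _ _ _ fj y0.
have [c [cg _ _ [m [A [Ah cd]]]]] := dec_mult dv (primary_dec_neq0 d) j (p ^+ k).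
have cdE : \det c = y ^+ a j by rewrite cd yE; apply: det_pmx_exp; rewrite Ah fj.
by exists c; rewrite unitmxE unitfE cdE expf_neq0.
Qed.

End CentralizerDet.

(** * Inverting involutions *)

Section Anticommutation.
Variables (F : fieldType) (n : nat) (h s : 'M[F]_n).
Hypotheses (F2 : 2%:R != 0 :> F) (hh : h *m h = 1%:M) (hs : h *m s = - (s *m h)).

Let eig (b : bool) : 'M[F]_n := kermx (h - ((-1) ^+ b)%:M).
Let edim m (W : 'M[F]_(m, n)) b := \rank (W :&: eig b)%MS.

Let eigP m (x : 'M[F]_(m, n)) b : (x <= eig b)%MS = (x *m h == (-1) ^+ b *: x).
Proof. by rewrite sub_kermx mulmxBr mul_mx_scalar subr_eq0. Qed.

(* [s] maps each eigenspace of [h] onto the part of the image in the other one. *)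
Let edim_image m (W : 'M[F]_(m, n)) b : (W *m h <= W)%MS ->
  edim W b = (edim (W :&: kermx s)%MS b + edim (W *m s) (~~ b))%N.
Proof.
move=> Wh; rewrite /edim -(mxrank_mul_ker (W :&: eig b)%MS s) addnC; congr (_ + _)%N.
  by congr (\rank _); rewrite -!capmxA [(kermx s :&: _)%MS]capmxC.
apply: eqmx_rank; apply/andP; split.
  rewrite sub_capmx submxMr ?capmxSl // eigP -mulmxA.
  have /eqP e : ((W :&: eig b)%MS *m h == (-1) ^+ b *: (W :&: eig b)%MS) by rewrite -eigP capmxSr.
  have -> : s *m h = - (h *m s) by rewrite hs opprK.
  by rewrite mulmxN mulmxA e -scalemxAl signrN scaleNr eqxx.
apply/rV_subP => y; rewrite sub_capmx eigP => /andP[/submxP[w wE] /eqP yh].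
pose x := w *m W; have xW : (x <= W)%MS by apply: submxMl.
have xhW : (x *m h <= W)%MS by rewrite (submx_trans _ Wh) // submxMr.
pose x' := 2%:R^-1 *: (x + (-1) ^+ b *: (x *m h)).
have x'W : (x' <= W :&: eig b)%MS.
  rewrite sub_capmx scalemx_sub ?addmx_sub ?scalemx_sub //= eigP; apply/eqP.
  rewrite mulmxDl -scalemxAl -mulmxA hh mulmx1 scalerDr scalerA.
  by rewrite -signr_addb addbb scale1r addrC.
suff -> : y = x' *m s by apply: submxMr.
rewrite /x' -scalemxAl mulmxDl -scalemxAl -(mulmxA x) hs mulmxN mulmxA -[x *m s]mulmxA -wE yh.
rewrite signrN scaleNr opprK scalerA -signr_addb addbb scale1r.
by rewrite -mulr2n -scaler_nat scalerA mulVf // scale1r.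
Qed.

Let stable_sX k : (s ^+ k *m h <= s ^+ k)%MS.
Proof.
suff [b ->] : exists b, s ^+ k *m h = (-1) ^+ b *: (h *m s ^+ k).
  by rewrite scalemx_sub // submxMl.
elim: k => [|k [b IHk]]; first by exists 0%N; rewrite !expr0 mulmx1 mul1mx scale1r.
exists b.+1; rewrite exprSr -mulmxA.
have -> : s *m h = - (h *m s) by rewrite hs opprK.
by rewrite mulmxN mulmxA IHk -scalemxAl -mulmxA exprS mulN1r scaleNr.
Qed.

(** Equivalently, [s] has no Jordan block of odd size for the eigenvalue 0. *)
Hypothesis even_blocks : forall k, (s ^+ k.*2 :&: kermx s <= s ^+ k.*2.+1)%MS.

Let cap_eq k : (s ^+ k.*2 :&: kermx s :=: s ^+ k.*2.+1 :&: kermx s)%MS.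
Proof.
apply/eqmxP; rewrite !sub_capmx !capmxSr even_blocks /= andbT.
by rewrite (submx_trans (capmxSl _ _)) // exprS submxMl.
Qed.

(** Two applications of [s] bring each eigenspace of [h] back to itself and remove a kernel part
    once with each sign, these parts being equal by [cap_eq]. The difference of the two dimensions
    is therefore constant. *)
Let edim_even k : (edim (s ^+ k.*2) false + edim (s ^+ 0) true
  = edim (s ^+ k.*2) true + edim (s ^+ 0) false)%N.
Proof.
elim: k => [|k IHk]; first by rewrite addnC.
have e1 b := edim_image b (stable_sX k.*2).
have e2 b := edim_image b (stable_sX k.*2.+1).
have eE b : edim (s ^+ k.*2 :&: kermx s)%MS b = edim (s ^+ k.*2.+1 :&: kermx s)%MS b.
  by rewrite /edim (cap_eqmx (cap_eq k) (eqmx_refl (eig b))).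
move: IHk; rewrite !e1 -![s ^+ k.*2 *m s]exprSr !e2 !eE /=.
rewrite -![s ^+ k.*2.+1 *m s]exprSr -doubleS; lia.
Qed.

(** Once the images of the powers of [s] are stationary, [s] is injective there and exchanges the
    two eigenspaces, so the constant difference is 0. *)
Let edim_eq : edim (s ^+ 0) false = edim (s ^+ 0) true.
Proof.
have [k rk] : exists k, \rank (s ^+ k.*2.+1) = \rank (s ^+ k.*2).
  apply: contrapT => /forallNP nk.
  have rS i : (\rank (s ^+ i.+1) <= \rank (s ^+ i))%N by rewrite mxrankS // exprS submxMl.
  have bound k : (\rank (s ^+ k.*2) + k <= n)%N.
    elim: k => [|k IHk]; first by rewrite addn0 rank_leq_row.
    rewrite doubleS; have := rS k.*2.+1; have := rS k.*2; have /eqP := nk k; lia.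
  by have := bound n.+1; lia.
have sE : (s ^+ k.*2.+1 :=: s ^+ k.*2)%MS.
  by apply/eqmxP; rewrite -mxrank_leqif_eq ?rk // exprS submxMl.
have cap0 : (s ^+ k.*2 :&: kermx s)%MS = 0.
  apply/eqP; rewrite -mxrank_eq0 -(eqn_add2l (\rank (s ^+ k.*2 *m s))) mxrank_mul_ker addn0.
  by rewrite -[s ^+ k.*2 *m s]exprSr rk.
have e_sw b : edim (s ^+ k.*2) b = edim (s ^+ k.*2) (~~ b).
  rewrite (edim_image b (stable_sX _)) cap0 /edim cap0mx mxrank0 add0n.
  by rewrite -[s ^+ k.*2 *m s]exprSr (cap_eqmx sE (eqmx_refl _)).
by have := edim_even k; rewrite (e_sw false) => /addnI ->.
Qed.

Lemma anticommuting_det : n = (\rank (h - 1%:M)).*2 /\ \det h = (-1) ^+ \rank (h - 1%:M).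
Proof.
have h1E : (h - 1%:M) *m h = (-1) *: (h - 1%:M).
  by rewrite mulmxBl hh mul1mx scaleN1r opprB.
have eig1 : (h - 1%:M :=: eig true)%MS.
  apply/eqmxP; rewrite eigP h1E eqxx /=; apply/rV_subP => x; rewrite eigP expr1 => /eqP xh.
  apply/submxP; exists (- 2%:R^-1 *: x); rewrite -scalemxAl mulmxBr mulmx1 xh scaleN1r.
  by rewrite -opprD -mulr2n scalerN scaleNr opprK -scaler_nat scalerA mulVf // scale1r.
have eig0 : eig false = kermx (h - 1%:M) by rewrite /eig expr0.
split.
  have := mxrank_mul_ker 1%:M (h - 1%:M); rewrite mul1mx mxrank1 -eig0.
  have := edim_eq; rewrite /edim expr0 => ->.
  by rewrite (cap1mx (eig true)) -eig1 addnn.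
have c1 : (1%:M *m h <= (1%:M : 'M[F]_n))%MS by apply: submx1.
have hc : h *m (h - 1%:M) = (h - 1%:M) *m h by rewrite mulmxBr mulmxBl mulmx1 mul1mx.
rewrite -stable_det1 (stable_det_ker c1 hc) mul1mx (@stable_det_scalar _ _ _ (h - 1%:M) h (-1) h1E).
rewrite (@stable_det_scalar _ _ _ _ h 1) ?expr1n ?mul1r // scale1r.
have : (1%:M :&: kermx (h - 1%:M) <= eig false)%MS by rewrite eig0 capmxSr.
by rewrite eigP expr0 scale1r => /eqP.
Qed.

End Anticommutation.

Section RootOfScalar.
Variables (F : finFieldType) (n : nat) (k : 'M[F]_n) (e : F).
Hypotheses (e_nsq : forall x, x ^+ 2 != e) (kk : k *m k = e%:M).

Lemma irred_X2_sub : monic_irred ('X^2 - e%:P).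
Proof.
split; last exact: monicXnsubC.
apply: cubic_irreducible; first by rewrite size_XnsubC.
by move=> x; rewrite rootE !hornerE subr_eq0.
Qed.

(** As X^2 - e is irreducible and kills [k], it is the annihilator of every summand, each of which
    contributes a factor -e. *)
Lemma det_root_scalar : exists m, n = m.*2 /\ \det k = (- e) ^+ m.
Proof.
have [I [v [f [a d]]]] := primary_dec_exists k; have [fI [lin0 gen]] := d.
have hE j : f j ^+ a j = 'X^2 - e%:P.
  have kP : pmx k ('X^2 - e%:P) = 0.
    by rewrite linearB /= pmxXn pmxC expr2 -kk subrr.
  have dvd : f j ^+ a j %| 'X^2 - e%:P.
    have := proj1 (lin0 (fun i => if i == j then 'X^2 - e%:P else 0)).
    rewrite lincomb_delta kP mul0mx => /(_ erefl j); by rewrite eqxx.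
  have [hm hs] := primary_dec_neq0 d j.
  apply/eqP; rewrite -eqp_monic ?(proj2 irred_X2_sub) //.
  by apply: ((proj1 irred_X2_sub).2 _ _ dvd); rewrite neq_ltn hs orbT.
exists #|I|; split.
  rewrite -(dec_dim _ (proj2 d)) => [|j]; last by rewrite monic_neq0 // (proj1 (primary_dec_neq0 d j)).
  under eq_bigr do rewrite hE size_XnsubC //.
  by rewrite sum_nat_const muln2.
rewrite (dec_det (proj2 d) (primary_dec_neq0 d)).
under eq_bigr do rewrite hE size_XnsubC //= sqrrN expr1n mul1r coefB coefXn coefC sub0r.
by rewrite prodr_const.
Qed.

End RootOfScalar.

Section Involution.
Variables (F : finFieldType) (n : nat) (g g' : 'M[F]_n) (z : F).
Hypotheses (z0 : z != 0) (gg' : g *m g' = z%:M).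
Variables (I : finType) (v : I -> 'cV[F]_n) (f : I -> {poly F}) (a : I -> nat).
Hypothesis d : primary_dec g v f a.

Let f0 := primary_dec_coef0 z0 gg' d.

Lemma scalar_inverse_comm : g' *m g = z%:M.
Proof.
have : g *m (z^-1 *: g') = 1%:M by rewrite -scalemxAr gg' scale_scalar_mx mulVf.
move/mulmx1C; rewrite -scalemxAl => /(congr1 ( *:%R z)).
by rewrite scalerA mulfV // scale1r => ->; rewrite scalemx1.
Qed.
Local Notation g'g := scalar_inverse_comm.

Lemma recip_primary_dec : primary_dec g' v (fun j => star z (f j)) a.
Proof.
have [fI dv] := d; split=> [j|].
  by split; [apply: star_irred (proj1 (fI j)) (f0 j)|apply: (proj2 (fI j))].
have h0 j : (f j ^+ a j)`_0 != 0 by apply: coef0X_neq0.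
have := recip_dec z0 gg' h0 dv; congr (cyclic_dec _ _ _); apply/funext => j.
by rewrite starX.
Qed.

(* [h] exchanges each generator with one whose annihilator is the reciprocal. *)
Lemma inverting_involution (M M' : 'M[F]_n) : M *m M' = 1%:M -> M *m g = g' *m M ->
  exists s h, [/\ involutive s /\ (forall j, star z (f j) = f j -> s j = j), h *m h = 1%:M,
    h *m g = g' *m h & forall j, h *m v j = v (s j)].
Proof.
move=> MM' Mg; have [fI dv] := d; have starK j := starK z0 (proj2 (proj1 (fI j))) (f0 j).
have d' : primary_dec g' (fun j => M *m v j) f a.
  by split=> //; apply: dec_intertwine MM' (mulmx1C MM') Mg dv.
(* The similarity [M] enters through multiplicities: a prime and its reciprocal occur equally often
   with each exponent. *)
have fib := primary_dec_fibers d' recip_primary_dec.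
have [||s [sK sE s_id]] := @fiber_involution _ I (fun j => (f j, a j)) (fun x => (star z x.1, x.2)).
- by move=> j; rewrite /= starK.
- move=> i; rewrite fib; apply: eq_card => j; rewrite !inE !xpair_eqE.
  congr (_ && _); apply/eqP/eqP => [e|-> //]; by rewrite -(starK j) e starK.
have {}sE j : f (s j) = star z (f j) /\ a (s j) = a j by have := sE j => -[].
have w_ann j : pmx g' (f j ^+ a j) *m v (s j) = 0.
  have [_ /dec_ann/(_ (s j))] := recip_primary_dec.
  by have [-> ->] := sE j; rewrite starK.
have [h hP] := dec_universal dv w_ann.
have hv j : h *m v j = v (s j).
  by have := hP (fun i => if i == j then 1 else 0); rewrite !lincomb_delta !pmx1 !mul1mx.
have hg : h *m g = g' *m h.
  apply: (dec_eq dv) => p; rewrite -!mulmxA hP -{1}(pmxX g) -lincombM hP.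
  by rewrite lincombM pmxX.
have hg' : h *m g' = g *m h.
  have : z *: (h *m g') = z *: (g *m h).
    by rewrite -!mul_scalar_mx -{1}gg' -!mulmxA [g' *m (h *m _)]mulmxA -hg -!mulmxA gg' mul_mx_scalar mul_scalar_mx scalemxAr.
  by move/(scalerI z0).
exists s, h; split=> //; first by split=> // j sj; apply: s_id; rewrite sj.
apply: (dec_eq dv) => p; rewrite -mulmxA hP mul1mx mulmx_sumr; apply: eq_bigr => j _.
by rewrite mulmxA (pmx_intertwine _ hg') -mulmxA hv sK.
Qed.

End Involution.

Section DetOne.
Variables (F : finFieldType) (n : nat) (g g' M M' : 'M[F]_n).
Hypotheses (F2 : 2%:R != 0 :> F) (gg' : g *m g' = 1%:M).
Hypotheses (MM' : M *m M' = 1%:M) (Mg : M *m g = g' *m M).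

Lemma star_X2_sub1 (p : {poly F}) :
  monic_irred p -> p %| 'X^2 - 1 -> star 1 p = p /\ (size p).-1 = 1%N.
Proof.
have aux c : c ^+ 2 = 1 -> p = 'X - c%:P -> star 1 p = p /\ (size p).-1 = 1%N.
  move=> c2 ->; rewrite size_XsubC; split=> //; have c0 : c != 0.
    by apply: contra_eq_neq c2 => ->; rewrite expr0n eq_sym oner_eq0.
  rewrite /star size_XsubC; apply/polyP => i; rewrite coefZ coef_poly !coefB !coefX !coefC.
  case: i => [|[|i]] /=; rewrite ?expr1n ?mulr1 ?subr0 ?sub0r //.
  - by rewrite invrN mulr1; apply: (mulIf c0); rewrite mulNr mulVf // mulNr -expr2 c2.
  - by rewrite mulVf // oppr_eq0.
  by rewrite mulr0.
move=> pI; have -> : 'X^2 - 1 = ('X - 1%:P) * ('X - (-1)%:P) :> {poly F}.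
  by rewrite polyCN opprK -subr_sqr expr1n.
have XI (c : F) : monic_irred ('X - c%:P) by split; [exact: irredp_XsubC|exact: monicXsubC].
rewrite monic_irred_dvdM // !monic_irred_dvd // => /orP[] /eqP e.
  by apply: (aux 1); rewrite ?expr1n.
by apply: (aux (-1)); rewrite ?sqrrN ?expr1n.
Qed.

Lemma det1_inverting_involution : (4 %| n)%N ->
  exists h : 'M[F]_n, [/\ h *m h = 1%:M, h *m g = g' *m h & \det h = 1].
Proof.
move=> n4; have [I [v [f [a d]]]] := primary_dec_exists g.
have f0 := primary_dec_coef0 (oner_neq0 F) gg' d; have [fI dv] := d.
have [s [h [[sK s_id] hh hg hv]]] := inverting_involution (oner_neq0 F) gg' d MM' Mg.
have g'g : g' *m g = 1%:M by apply: mulmx1C.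
have hg' : h *m g' = g *m h.
  by rewrite -[LHS]mul1mx -gg' -!mulmxA [g' *m (h *m _)]mulmxA -hg -!mulmxA gg' mulmx1.
have [/existsP[j0 /andP[/eqP sj0 odd_j0]]|/existsPn no_odd] :=
  boolP [exists j, (star 1 (f j) == f j) && odd (a j * (size (f j)).-1)].
  (* [c] is -1 on a summand of odd dimension fixed by [s] and 1 elsewhere; it commutes with [h], so
     [h *m c] is again an inverting involution, of opposite determinant. *)
  have [c [cg cv0 cv [m [A [Ah cd]]]]] := dec_mult dv (primary_dec_neq0 d) j0 (-1).
  have {}cv0 : c *m v j0 = - v j0 by rewrite cv0 linearN /= pmx1 mulNmx mul1mx.
  have {}cd : \det c = -1.
    rewrite cd linearN /= pmx1 -scaleN1r detZ det1 mulr1.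
    have : m = (a j0 * (size (f j0)).-1)%N.
      by have := size_char_poly A; rewrite Ah => /(congr1 predn); rewrite size_exp mulnC => ->.
    by move=> ->; rewrite -signr_odd odd_j0 expr1.
  have cg' : c *m g' = g' *m c.
    by rewrite -[LHS]mul1mx -g'g -!mulmxA [g *m (c *m _)]mulmxA -cg -!mulmxA gg' mulmx1.
  have gen_eq (x y : 'M[F]_n) : x *m g = g *m x -> y *m g = g *m y ->
      (forall j, x *m v j = y *m v j) -> x = y.
    move=> xg yg xy; apply: (dec_eq dv) => p; rewrite !mulmx_sumr; apply: eq_bigr => j _.
    by rewrite !mulmxA (pmx_intertwine _ xg) (pmx_intertwine _ yg) -!mulmxA xy.
  have hch : h *m c *m h = c.
    apply: gen_eq => //.
      by rewrite -!mulmxA hg [c *m _]mulmxA cg' -!mulmxA [h *m (g' *m _)]mulmxA hg' -!mulmxA.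
    move=> j; rewrite -!mulmxA hv; have [->|jj0] := eqVneq j j0.
      by rewrite s_id // cv0 mulmxN hv s_id.
    have sjj0 : s j != j0.
      by apply: contra jj0 => /eqP sj; rewrite -(sK j) sj s_id.
    by rewrite !cv // hv sK.
  have cc : c *m c = 1%:M.
    apply: gen_eq; [by rewrite -mulmxA cg mulmxA cg mulmxA|by rewrite mul1mx mulmx1|].
    move=> j; rewrite -mulmxA mul1mx; have [->|jj0] := eqVneq j j0.
      by rewrite cv0 mulmxN cv0 opprK.
    by rewrite !cv.
  have dh2 : \det h ^+ 2 = 1 by rewrite expr2 -det_mulmx hh det1.
  have /orP[/eqP dh|/eqP dh] : (\det h == 1) || (\det h == -1) by rewrite -sqrf_eq1 dh2.
    by exists h.
  exists (h *m c); rewrite det_mulmx dh cd mulrNN mulr1; split=> //.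
    by rewrite mulmxA hch cc.
  by rewrite -mulmxA cg mulmxA hg -mulmxA.
exists h; split=> //; pose P : {poly F} := 'X^2 - 1; pose N := (pmx g P)^T.
have nfP j : ~~ (f j ^+ 2 %| P) by apply: square_ndvd_Xn_sub1 => //; apply: (proj1 (fI j)).
have PE : pmx g P = g *m g - 1%:M.
  by rewrite /P [LHS]linearB /= pmxXn pmx1 expr2.
(* [t] and [N] differ by an invertible factor commuting with both, so their powers have the same
   images, and the block sizes of [t] are the exponents of the primes dividing t^2 - 1. *)
pose t := (g - g')^T.
have tN : t = g'^T *m N.
  by rewrite /t /N -trmx_mul PE mulmxBl -mulmxA gg' mulmx1 mul1mx.
have Nt : N = g^T *m t.
  by rewrite /t /N -trmx_mul PE mulmxBl g'g.
have gN : g^T *m N = N *m g^T.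
  by rewrite /N -!trmx_mul PE mulmxBl mulmxBr mulmxA mul1mx mulmx1.
have g'N : g'^T *m N = N *m g'^T.
  rewrite /N -!trmx_mul PE mulmxBl mulmxBr -mulmxA gg' mulmxA g'g.
  by rewrite !mulmx1 !mul1mx.
have tX k : t ^+ k = g'^T ^+ k *m N ^+ k by rewrite tN; apply: (exprMn_comm k g'N).
have gt : g^T *m t = t *m g^T.
  by rewrite /t -!trmx_mul mulmxBl mulmxBr gg' g'g.
have NX k : N ^+ k = g^T ^+ k *m t ^+ k by rewrite Nt; apply: (exprMn_comm k gt).
have t_even k : (t ^+ k.*2 :&: kermx t <= t ^+ k.*2.+1)%MS.
  have kerN : (kermx t <= kermx N)%MS.
    by apply/sub_kermxP; rewrite Nt gt mulmxA mulmx_ker mul0mx.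
  apply: submx_trans (_ : N ^+ k.*2.+1 <= _)%MS; last by rewrite NX submxMl.
  have tN2 : (t ^+ k.*2 <= N ^+ k.*2)%MS by rewrite tX submxMl.
  apply: submx_trans (capmxS tN2 kerN) _.
  apply: (primary_ker_im_mx d nfP) => j fP aj; have := no_odd j.
  have [-> ->] := star_X2_sub1 (proj1 (fI j)) fP.
  by rewrite eqxx muln1 aj /= odd_double.
have ht : h^T *m t = - (t *m h^T).
  by rewrite /t -!trmx_mul -linearN /= mulmxBl mulmxBr hg hg' opprB.
have hhT : h^T *m h^T = 1%:M by rewrite -trmx_mul hh trmx1.
have [nE] := anticommuting_det F2 hhT ht t_even.
rewrite det_tr => ->; have : ~~ odd (\rank (h^T - 1%:M)).
  by move: n4; rewrite {1}nE -muln2 (@dvdn_pmul2r 2 2) // dvdn2.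
by move/negPf; rewrite -signr_odd => ->.
Qed.

End DetOne.

Lemma two_part n : (0 < n)%N -> exists r b, [/\ n = (2 ^ r * b)%N, odd b & (n`_2 = 2 ^ r)%N].
Proof.
move=> n0; exists (logn 2 n), (n`_2^')%N; rewrite -p_part partnC //; split=> //.
by rewrite odd_2'nat part_pnat.
Qed.

(** * Squares and [n]-th powers in a finite field *)

Section Powers.
Variable F : finFieldType.
Local Notation q := #|F|.

Definition is_pow n (x : F) : bool := [exists y, x == y ^+ n].

Lemma is_powP n x : reflect (exists y, x = y ^+ n) (is_pow n x).
Proof. by apply: (iffP existsP) => -[y /eqP]; exists y => //; apply/eqP. Qed.

Lemma is_powM n x y : is_pow n x -> is_pow n y -> is_pow n (x * y).
Proof. by move=> /is_powP[u ->] /is_powP[w ->]; apply/is_powP; exists (u * w); rewrite exprMn. Qed.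

Lemma is_powV n x : is_pow n x -> is_pow n x^-1.
Proof. by move=> /is_powP[u ->]; apply/is_powP; exists u^-1; rewrite exprVn. Qed.

Lemma is_powX n x : is_pow n (x ^+ n).
Proof. by apply/is_powP; exists x. Qed.

Lemma is_powMl n x y : x != 0 -> is_pow n x -> is_pow n (x * y) = is_pow n y.
Proof.
move=> x0 px; apply/idP/idP; last exact: is_powM.
by move/(is_powM (is_powV px)); rewrite mulrA mulVf ?mul1r.
Qed.

Lemma card_pred_gt0 : (0 < q.-1)%N.
Proof. by rewrite -subn1 subn_gt0 finNzRing_gt1. Qed.

Lemma expf_card_pred x : x != 0 -> x ^+ q.-1 = 1 :> F.
Proof.
move=> x0; apply: (mulIf x0).
by rewrite mul1r -exprSr prednK ?expf_card // ltnW ?finNzRing_gt1.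
Qed.

Lemma finField_generator : exists w : F, [/\ w != 0, forall x, x != 0 -> exists k, x = w ^+ k &
  forall k, w ^+ k = 1 -> (q.-1 %| k)%N].
Proof.
have [w genw] := cyclicP (field_unit_group_cyclic [set: {unit F}]).
have ow : #[w]%g = q.-1 by rewrite orderE -genw card_finField_unit.
exists (val w); split=> [|x x0|k wk].
- by rewrite -unitfE (valP w).
- have : finField_unit x0 \in [set: {unit F}] by rewrite inE.
  rewrite genw => /cycleP[k /(congr1 val)]; rewrite FinRing.val_unitX /= => e.
  by exists k.
by rewrite -ow order_dvdn -val_eqE FinRing.val_unitX wk.
Qed.

Lemma even_card_opp1 : ~~ odd q -> -1 = 1 :> F.
Proof.
move=> q2; have [p pr_p pF] := finPcharP F.
have := pchar_nat_card F; rewrite (eq_pnat _ (pcharf_eq pF)) => /p_natP[k qE].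
have p2 : p = 2%N.
  apply/eqP; move: q2; rewrite qE oddX negb_or => /andP[_ podd].
  by case: (even_prime pr_p) => [->//|]; rewrite (negPf podd).
by apply/eqP; rewrite eq_sym -subr_eq0 opprK; apply/eqP; have := pcharf0 pF; rewrite p2.
Qed.

Section OddCard.
Hypothesis q_odd : odd q.

Lemma two_neq0 : 2%:R != 0 :> F.
Proof.
have [p pr_p pF] := finPcharP F; apply: contraTneq q_odd => F2.
have p2 : p = 2%N.
  apply/eqP; rewrite -(dvdn_prime2 pr_p) //; by rewrite (dvdn_pcharf pF) F2.
have := pchar_nat_card F; rewrite (eq_pnat _ (pcharf_eq pF)) p2 => /p_natP[[|k] qE].
  by have := finNzRing_gt1 F; rewrite qE.
by rewrite qE oddX.
Qed.

Lemma opp1_neq1 : -1 != 1 :> F.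
Proof. by rewrite eq_sym -subr_eq0 opprK; apply: two_neq0. Qed.

Lemma half_card : (q.-1 = (q.-1)./2.*2)%N.
Proof. by rewrite -[LHS]odd_double_half; have := q_odd; case: q => //= m /negPf->. Qed.

Lemma half_card_gt0 : (0 < (q.-1)./2)%N.
Proof. by have := card_pred_gt0; rewrite {1}half_card double_gt0. Qed.

Lemma euler_criterion (z : F) : z != 0 -> (forall x, x ^+ 2 != z) -> z ^+ (q.-1)./2 = -1.
Proof.
move=> z0 nsq; have [w [w0 wgen word]] := finField_generator.
have [k zE] := wgen z z0.
have : z ^+ (q.-1)./2 ^+ 2 = 1 by rewrite -exprM muln2 -half_card expf_card_pred.
move/eqP; rewrite sqrf_eq1 => /orP[/eqP e|/eqP //]; move: e.
rewrite zE -exprM => /word; rewrite {1}half_card -muln2 mulnC dvdn_pmul2r ?half_card_gt0 //.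
move=> k2; case/negP: (nsq (w ^+ k./2)); rewrite zE -exprM muln2.
by rewrite -[in X in _ == X](odd_double_half k) -[odd k]negbK -dvdn2 k2.
Qed.

Lemma nonsquare_exists : exists z : F, z != 0 /\ forall x, x ^+ 2 != z.
Proof.
have [w [w0 wgen word]] := finField_generator; exists w; split=> // x; apply/eqP => xw.
have x0 : x != 0 by apply: contraNneq w0 => x0; rewrite -xw x0 expr0n.
have : w ^+ (q.-1)./2 = 1 by rewrite -xw -exprM mul2n -half_card expf_card_pred.
move/word/dvdn_leq => /(_ half_card_gt0); rewrite {1}half_card -addnn.
by rewrite -{3}[(q.-1)./2]addn0 leq_add2l leqNgt half_card_gt0.
Qed.

Section Less.
Variable n : nat.
Hypotheses (n0 : (0 < n)%N) (lt2 : (n`_2 < q.-1`_2)%N).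

Lemma opp1_is_pow : is_pow n (-1).
Proof.
have [r [b [nE b_odd r2]]] := two_part n0.
have [s [o [qE o_odd s2]]] := two_part card_pred_gt0.
have rs : (r < s)%N by move: lt2; rewrite r2 s2 ltn_exp2l.
have [w [w0 wgen word]] := finField_generator.
(* [w ^ o] has order [2 ^ s]; its power of exponent [2 ^ (s - 1 - r)] works *)
apply/is_powP; exists (w ^+ (o * 2 ^ (s - r.+1))).
have : (w ^+ (o * 2 ^ (s - r.+1)) ^+ n) ^+ 2 = 1.
  rewrite -!exprM nE [X in w ^+ X](_ : _ = q.-1 * b)%N.
    by rewrite exprM expf_card_pred // expr1n.
  rewrite qE -{2}(subnK rs) addnS expnS expnD; ring.
move/eqP; rewrite sqrf_eq1 => /orP[/eqP|/eqP //].
rewrite -exprM => /word; rewrite nE qE -{1}(subnK rs) addnS expnS expnD.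
have -> : (o * 2 ^ (s - r.+1) * (2 ^ r * b) = (2 ^ (s - r.+1) * 2 ^ r * o) * b)%N by ring.
have -> : (2 * (2 ^ (s - r.+1) * 2 ^ r) * o = (2 ^ (s - r.+1) * 2 ^ r * o) * 2)%N by ring.
rewrite dvdn_pmul2l ?dvdn2 ?b_odd // !muln_gt0 !expn_gt0 /=.
by case: (o) o_odd.
Qed.

(** If z^(n/2) = y^n, then z / y^2 is a nonsquare of order dividing n/2. Raising Euler's criterion
    to the odd part [b] of [n] makes the exponent a multiple of n/2 and yields 1 = -1. *)
Lemma nonsquare_half_pow (z : F) : ~~ odd n -> z != 0 -> (forall x, x ^+ 2 != z) ->
  ~~ is_pow n (z ^+ n./2).
Proof.
move=> n_even z0 nsq; apply/negP => /is_powP[y zy].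
have [r [b [nE b_odd r2]]] := two_part n0.
have [s [o [qE o_odd s2]]] := two_part card_pred_gt0.
have rs : (r < s)%N by move: lt2; rewrite r2 s2 ltn_exp2l.
have nh : n = (n./2 * 2)%N by rewrite muln2 -[LHS]odd_double_half (negPf n_even).
have y0 : y != 0.
  apply: contraNneq z0 => y0; move: zy; rewrite y0 expr0n gtn_eqF //= => /eqP.
  by rewrite expf_eq0 => /andP[].
pose z' := z / y ^+ 2; have z'0 : z' != 0 by rewrite mulf_neq0 ?invr_eq0 ?expf_neq0.
have nsq' x : x ^+ 2 != z'.
  apply: contraNneq (nsq (x * y)) => xz; rewrite exprMn xz divfK ?expf_neq0 //.
have z'n : z' ^+ n./2 = 1.
  by rewrite exprMn exprVn -exprM mulnC -nh zy divff ?expf_neq0.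
have := euler_criterion z'0 nsq'; move/(congr1 (fun x => x ^+ b)).
rewrite -exprM; have -> : ((q.-1)./2 * b = n./2 * (2 ^ (s - r) * o))%N.
  apply/eqP; rewrite -(eqn_pmul2r (isT : 0 < 2)%N) mulnAC muln2 -half_card mulnAC -nh nE qE.
  by rewrite -{1}(subnK (ltnW rs)) expnD; apply/eqP; ring.
rewrite exprM z'n expr1n -signr_odd b_odd expr1 => /eqP; rewrite eq_sym.
by rewrite (negPf opp1_neq1).
Qed.

End Less.

Section Greater.
Variable n : nat.
Hypotheses (n0 : (0 < n)%N) (lt2 : (q.-1`_2 < n`_2)%N).

Lemma dvd4 : (4 %| n)%N.
Proof.
have [r [b [nE b_odd r2]]] := two_part n0.
have [s [o [qE o_odd s2]]] := two_part card_pred_gt0.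
have sr : (s < r)%N by move: lt2; rewrite r2 s2 ltn_exp2l.
have s0 : (0 < s)%N.
  rewrite lt0n; apply: contraL q_odd => /eqP s0; move: qE; rewrite s0 mul1n => qE.
  have := o_odd; rewrite -qE; have := finNzRing_gt1 F.
  by case: (#|F|) => //= m _ ->.
by rewrite nE dvdn_mulr // (@dvdn_exp2l 2 2) // (leq_ltn_trans s0).
Qed.

(** Raising to the odd part [o] of q - 1 leaves -1 unchanged and sends every nonzero [n]-th power to
    1. *)
Lemma opp1_not_pow : ~~ is_pow n (-1).
Proof.
have [r [b [nE b_odd r2]]] := two_part n0.
have [s [o [qE o_odd s2]]] := two_part card_pred_gt0.
have sr : (s < r)%N by move: lt2; rewrite r2 s2 ltn_exp2l.
apply/negP => /is_powP[y yE]; have y0 : y != 0.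
  apply: contraTneq isT => y0; move/eqP: yE; rewrite y0 expr0n gtn_eqF //=.
  by rewrite oppr_eq0 oner_eq0.
have := congr1 (fun x => x ^+ o) yE; rewrite -signr_odd o_odd expr1 -exprM.
have -> : (n * o = q.-1 * (2 ^ (r - s) * b))%N.
  by rewrite nE qE -{1}(subnK (ltnW sr)) expnD; ring.
by rewrite exprM expf_card_pred // expr1n => /eqP; rewrite (negPf opp1_neq1).
Qed.

Lemma half_is_pow (z : F) : z != 0 -> is_pow n (z ^+ n./2).
Proof.
move=> z0; have [r [b [nE b_odd r2]]] := two_part n0.
have [s [o [qE o_odd s2]]] := two_part card_pred_gt0.
have sr : (s < r)%N by move: lt2; rewrite r2 s2 ltn_exp2l.
have nh : n./2 = (2 ^ r.-1 * b)%N.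
  by rewrite nE -{1}(ltn_predK sr) expnS -mulnA mul2n doubleK.
(* n (o + 1)/2 = n/2 + o n/2, and q - 1 divides o n/2 because |n/2|_2 is at least |q - 1|_2. *)
apply/is_powP; exists (z ^+ (o.+1)./2).
have oE : ((o.+1)./2 * 2 = o.+1)%N by rewrite muln2 -[RHS]odd_double_half /= o_odd.
rewrite -exprM; have -> : ((o.+1)./2 * n = n./2 + q.-1 * (2 ^ (r.-1 - s) * b))%N.
  rewrite nh nE qE -{1}(ltn_predK sr) expnS.
  have -> : ((o.+1)./2 * (2 * 2 ^ r.-1 * b) = (o.+1)./2 * 2 * (2 ^ r.-1 * b))%N by ring.
  have sr1 : (s <= r.-1)%N by rewrite -ltnS (ltn_predK sr).
  by rewrite oE -{2}(subnK sr1) expnD -{1}(subnK sr1) expnD; ring.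
by rewrite exprD [X in _ * X]exprM expf_card_pred // expr1n mulr1.
Qed.

End Greater.
End OddCard.
End Powers.

Section InvolutionDet.
Variables (F : finFieldType) (n : nat).
Hypothesis n_gt0 : (0 < n)%N.
Hypothesis hq : ~~ odd #|F| \/ (n`_2 <> (#|F|.-1)`_2)%N.

Lemma inverting_involution_is_pow (g g' M M' : 'M[F]_n) z :
    z != 0 -> g *m g' = z%:M -> M *m M' = 1%:M -> M *m g = g' *m M -> is_pow n (\det g) ->
  exists h, [/\ h *m h = 1%:M, h *m g = g' *m h & is_pow n (\det h)].
Proof.
move=> z0 gg' MM' Mg dg; have [I [v [f [a d]]]] := primary_dec_exists g.
have [s [h [_ hh hg _]]] := inverting_involution z0 gg' d MM' Mg.
have dh2 (k : 'M[F]_n) : k *m k = 1%:M -> \det k = 1 \/ \det k = -1 :> F.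
  move=> kk; have : \det k ^+ 2 = 1 by rewrite expr2 -det_mulmx kk det1.
  by move/eqP; rewrite sqrf_eq1 => /orP[]/eqP; [left|right].
have pow1 : is_pow n (1 : F) by rewrite -(expr1n _ n) is_powX.
have [pm1|[q_odd lt2]] : is_pow n (-1 : F) \/ odd #|F| /\ ((#|F|.-1)`_2 < n`_2)%N.
- have [q_odd|q_even] := boolP (odd #|F|); last by left; rewrite even_card_opp1.
  case: hq => [|/eqP]; first by rewrite q_odd.
  by rewrite neq_ltn => /orP[lt2|]; [left; apply: opp1_is_pow|right].
- by exists h; split=> //; case: (dh2 h hh) => ->.
have n4 := dvd4 q_odd n_gt0 lt2; have F2 := two_neq0 q_odd.
have [[x xz]|/forallNP nsq] := pselect (exists x, x ^+ 2 = z).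
  have x0 : x != 0 by apply: contraNneq z0 => x0; rewrite -xz x0 expr0n.
  have gg1 : (x^-1 *: g) *m (x^-1 *: g') = 1%:M.
    by rewrite -scalemxAl -scalemxAr gg' !scale_scalar_mx -xz expr2 mulKf // mulVf.
  have Mg1 : M *m (x^-1 *: g) = (x^-1 *: g') *m M by rewrite -scalemxAr Mg scalemxAl.
  have [h1 [hh1 hg1 dh1]] := det1_inverting_involution F2 gg1 MM' Mg1 n4.
  exists h1; split=> //; last by rewrite dh1.
  move: hg1; rewrite -scalemxAr -scalemxAl => /(congr1 ( *:%R x)).
  by rewrite !scalerA mulfV // !scale1r.
exists h; split=> //.
have kk : (h *m g) *m (h *m g) = z%:M.
  by rewrite {1}hg -!mulmxA [h *m (h *m _)]mulmxA hh mul1mx (scalar_inverse_comm z0 gg').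
have nsq' x : x ^+ 2 != z by apply/eqP/nsq.
have [m [nE dk]] := det_root_scalar nsq' kk.
have m_even : ~~ odd m by move: n4; rewrite nE -muln2 (@dvdn_pmul2r 2 2) // dvdn2.
(* Here n = 2m with [m] even, so the determinant (-z)^m is z^(n/2). *)
have : is_pow n (\det (h *m g)).
  rewrite dk exprNn -signr_odd (negPf m_even) mul1r.
  by have := half_is_pow n_gt0 lt2 z0; rewrite {2}nE doubleK.
have g_neq0 : \det g != 0.
  apply: contraNneq z0 => g0; have := congr1 determinant gg'.
  by rewrite det_mulmx g0 mul0r det_scalar => /esym/eqP; rewrite expf_eq0 => /andP[].
by rewrite det_mulmx mulrC is_powMl.
Qed.

End InvolutionDet.

(** * Counting tuples of reciprocal polynomials *)

Section ReciprocalCount.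
Variables (F : finFieldType) (n : nat).
Local Notation q := #|F|.
Local Notation poly_le := {poly_n.+1 F}.

Definition recip_set m (z : F) : {set poly_le} :=
  [set p : poly_le | [&& polyn p \is monic, size p == m.+1, p`_0 != 0 & star z p == p]].

Lemma star_fixedE m z (p : {poly F}) : p \is monic -> size p = m.+1 -> p`_0 != 0 ->
  (star z p = p) <-> (forall k, (k <= m)%N -> p`_k = (p`_0)^-1 * (p`_(m - k) * z ^+ (m - k))).
Proof.
move=> pm sp p0; rewrite /star sp; split=> [e k km|e].
  by rewrite -[in LHS]e coefZ coef_poly /= ltnS km.
apply/polyP => k; rewrite coefZ coef_poly /= ltnS; case: leqP => km; first by rewrite -e.
by rewrite mulr0 nth_default // sp.
Qed.

Section FixedCoef0.
Variables (m : nat) (z c : F).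
Hypotheses (m_gt0 : (0 < m)%N) (mn : (m <= n)%N) (c0 : c != 0) (c2 : c ^+ 2 = z ^+ m).

(** For [m] even, the relation at the middle index says that c and z^(m/2) have the same product
    with the middle coefficient: it is free if c = z^(m/2) and zero otherwise. *)
Let r := ((m.-1)./2 + (~~ odd m && (c == z ^+ m./2)))%N.

(* The coefficients of index [1 .. r] are free and determine the others. *)
Let coefE (w : {ffun 'I_r -> F}) (k : nat) : F :=
  let wk i := if insub i is Some j then w j else 0 in
  if k == 0%N then c else if k == m then 1 else if (k <= r)%N then wk k.-1
  else if (m - k <= r)%N then c^-1 * (wk (m - k).-1 * z ^+ (m - k)) else 0.

Let E (w : {ffun 'I_r -> F}) : poly_le := npolyp n.+1 (\poly_(k < m.+1) coefE w k).

Let valE w : polyn (E w) = \poly_(k < m.+1) coefE w k.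
Proof. by rewrite npolypK // (leq_trans (size_poly _ _)). Qed.

Let m2 : m = (odd m + m./2.*2)%N. Proof. by rewrite odd_double_half. Qed.

Let coefE0 w : coefE w 0 = c. Proof. by []. Qed.
Let coefEm w : coefE w m = 1.
Proof. by rewrite /coefE gtn_eqF // eqxx. Qed.

Let E_recip w : E w \in recip_set m z.
Proof.
have sE : size (E w) = m.+1 by rewrite valE size_poly_eq // coefEm oner_eq0.
have E0 : (E w)`_0 = c by rewrite valE coef_poly.
have Em : polyn (E w) \is monic.
  by rewrite monicE lead_coefE sE valE coef_poly ltnSn coefEm.
rewrite inE Em sE eqxx E0 c0 /=; apply/eqP/(@star_fixedE m) => //; first by rewrite E0.
move=> k km; rewrite E0 valE !coef_poly !ltnS km leq_subr.
have [->|k0] := posnP k; first by rewrite subn0 coefE0 coefEm mul1r -c2 expr2 mulKf.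
have [->|km'] := eqVneq k m; first by rewrite subnn coefE0 coefEm mulr1 mulVf.
have zz : c^-1 * (c^-1 * z ^+ m) = 1 by rewrite -c2 expr2 mulKf ?mulVf.
have km1 : (k < m)%N by rewrite ltn_neqAle km' km.
rewrite /coefE gtn_eqF // (negPf km') subn_eq0 [(m <= k)%N]leqNgt km1 /= subKn //.
have -> : (m - k == m)%N = false by lia.
have [kr|rk] := leqP k r; have [lr|rl] := leqP (m - k) r.
- have [m_even cz] : ~~ odd m /\ c = z ^+ m./2.
    move: m2 kr lr; rewrite /r; case: (odd m) => /=; first by lia.
    by case: eqP => // _; lia.
  have -> : (m - k = k)%N by move: m2 kr lr; rewrite /r (negPf m_even); case: (_ == _); lia.
  have -> : k = m./2 by move: m2 kr lr; rewrite /r (negPf m_even); case: (_ == _); lia.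
  by rewrite -cz mulrC mulfK.
- set x := (X in X = _); transitivity (c^-1 * (c^-1 * z ^+ m) * x); first by rewrite zz mul1r.
  have -> : z ^+ m = z ^+ k * z ^+ (m - k) by rewrite -exprD subnKC.
  set y := (X in _ = _ * (_ * (X * _) * _)); have -> : x = y by []. by ring.
- by [].
- by rewrite mul0r mulr0.
Qed.

Lemma card_recip_coef0 : #|[set p in recip_set m z | p`_0 == c]| = (q ^ r)%N.
Proof.
have -> : [set p in recip_set m z | p`_0 == c] = E @: [set: {ffun 'I_r -> F}].
  apply/setP => p; apply/idP/imsetP => [|[w _ ->]]; last first.
    by rewrite inE E_recip valE coef_poly /= coefE0.
  rewrite !inE => /andP[/and4P[pm /eqP sp p0 /eqP ps] /eqP pc].
  have pE := proj1 (star_fixedE z pm sp p0) ps; rewrite pc in pE.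
  exists [ffun i : 'I_r => p`_i.+1] => //; apply/val_inj/polyP => k.
  rewrite /= valE coef_poly ltnS; case: leqP => km; last by rewrite nth_default // sp.
  rewrite /coefE; have [->|k0] := posnP k; first by rewrite pc.
  case: eqP => [->|km']; first by have := monicP pm; rewrite lead_coefE sp.
  have wE i : (0 < i <= r)%N -> (if insub i.-1 is Some j then [ffun i : 'I_r => p`_i.+1] j else 0) = p`_i.
    move=> /andP[i0 ir]; rewrite insubT; first by rewrite prednK.
    by move=> ir'; rewrite ffunE /= prednK.
  have [kr|rk] := leqP k r; first by rewrite wE // k0.
  have [lr|rl] := leqP (m - k) r.
    rewrite [LHS](pE k km) wE // lr andbT subn_gt0.
    by rewrite ltn_neqAle km andbT; apply/eqP.
  have m_even : odd m = false.
    by move: m2 rk rl; rewrite /r; case: (odd m) => //=; lia.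
  have kE : k = m./2 by move: m2 rk rl; rewrite /r m_even /=; case: (_ == _); lia.
  have cz : c != z ^+ m./2.
    by move: m2 rk rl; rewrite /r m_even /=; case: (_ == _) => //; lia.
  have := pE k km; have -> : (m - k = k)%N by move: m2; rewrite m_even; lia.
  move/(congr1 ( *%R c)); rewrite mulrA mulfV // mul1r => e.
  have /eqP : p`_k * (c - z ^+ m./2) = 0 by rewrite -kE mulrBr [_ * c]mulrC e subrr.
  by rewrite mulf_eq0 subr_eq0 (negPf cz) orbF => /eqP.
rewrite card_imset ?cardsT ?card_ffun ?card_ord // => w1 w2 /(congr1 val) /=.
rewrite !valE => /polyP eqw; apply/ffunP => i.
have im : (i.+1 < m)%N.
  case: i => i /= ir; move: m2 ir; rewrite /r; case: (odd m) => /=; first by lia.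
  by case: (_ == _); lia.
have := eqw i.+1; rewrite !coef_poly ltnS ltnW // /coefE /= ltn_eqF // ltn_ord.
by rewrite valK.
Qed.

End FixedCoef0.

Lemma recip_set_coef0 m z (p : poly_le) : p \in recip_set m z -> (p`_0) ^+ 2 = z ^+ m.
Proof.
rewrite inE => /and4P[pm /eqP sp p0 /eqP ps].
have := proj1 (star_fixedE z pm sp p0) ps m (leqnn m).
have := monicP pm; rewrite lead_coefE sp /= => ->; rewrite subnn expr0 mulr1 => e.
have := proj1 (star_fixedE z pm sp p0) ps 0%N (leq0n m).
have := monicP pm; rewrite lead_coefE sp /= subn0 => ->; rewrite mul1r => {}e.
by rewrite expr2 {2}e mulrA mulfV // mul1r.
Qed.

Lemma recip_set_0 z : recip_set 0 z = [set npolyp n.+1 1].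
Proof.
have n1 : polyn (npolyp n.+1 (1 : {poly F})) = 1 by rewrite npolypK // size_poly1.
apply/setP => p; rewrite !inE; apply/and4P/eqP => [[pm /eqP sp _ _]|->].
  apply/val_inj; rewrite /= n1; have := monicP pm.
  by rewrite [polyn p]size1_polyC ?sp // lead_coefC => ->.
by rewrite n1 monic1 size_poly1 coefC oner_eq0 star1.
Qed.

(* The "determinant" of a companion matrix of [p]. *)
Definition pdet (p : {poly F}) : F := (-1) ^+ (size p).-1 * p`_0.

End ReciprocalCount.

Section SignedCount.
Variables (F : finFieldType) (n : nat).
Local Notation q := #|F|.

(** For [q] odd, [npos m] and [nneg m] count the reciprocal polynomials of degree [m] with [pdet]
    equal to rho and to -rho, where rho^2 = z^m and rho = z^(m/2) if [m] is even. In degree 0 there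
    is only the polynomial 1. *)
Definition npos (m : nat) : nat := (if odd m then q ^ (m.-1)./2 else q ^ m./2)%N.
Definition nneg (m : nat) : nat := (if m == 0%N then 0 else q ^ (m.-1)./2)%N.

Lemma nq_odd m : odd q -> (0 < m)%N -> nq q m = (npos m + nneg m)%N.
Proof.
rewrite /nq /npos /nneg => ->; case: m => // m _ /=; have [m_odd|m_even] := boolP (odd m) => /=.
  by rewrite uphalf_half m_odd /= expnS mulSn addnC.
by rewrite mul2n addnn.
Qed.

Lemma nq_even m : ~~ odd q -> nq q m = npos m.
Proof. by rewrite /nq /npos => /negPf->. Qed.

Section Root.
Variables (m : nat) (z rho : F).
Hypotheses (mn : (m <= n)%N) (rho0 : rho != 0) (rho2 : rho ^+ 2 = z ^+ m).
Hypothesis rho_even : ~~ odd m -> rho = z ^+ m./2.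

Lemma pdet_recip (p : {poly_n.+1 F}) : p \in recip_set n m z -> pdet p = rho \/ pdet p = - rho.
Proof.
move=> pR; have p2 := recip_set_coef0 pR; apply/pred2P; rewrite -eqf_sqr /pdet.
by rewrite exprMn -exprM mulnC exprM sqrrN !expr1n mul1r p2 rho2.
Qed.

Lemma pdet_eq (p : {poly_n.+1 F}) c : p \in recip_set n m z -> (pdet p == c) = (p`_0 == (-1) ^+ m * c).
Proof.
rewrite inE => /and4P[_ /eqP sp _ _]; rewrite /pdet sp /=.
by rewrite -(can_eq (mulKr (unitrX m (unitrN1 F)))) mulrA -expr2 -exprM mulnC exprM sqrrN !expr1n mul1r.
Qed.

Lemma card_recip_pos : #|[set p in recip_set n m z | pdet p == rho]| = npos m.
Proof.
have [m0|m_gt0] := posnP m.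
  rewrite /npos m0 expn0; move: rho_even; rewrite m0 expr0 recip_set_0 => -> //.
  rewrite -(cards1 (npolyp n.+1 (1 : {poly F}))); apply: eq_card => p; rewrite !inE.
  apply: andb_idr => /eqP->; rewrite /pdet npolypK ?size_poly1 //.
  by rewrite expr0 mul1r coefC.
have -> : [set p in recip_set n m z | pdet p == rho]
    = [set p in recip_set n m z | p`_0 == (-1) ^+ m * rho].
  by apply/setP => p; rewrite inE [RHS]inE; apply: andb_id2l => pR; apply: pdet_eq.
rewrite card_recip_coef0 //; first last.
- by rewrite exprMn -exprM mulnC exprM sqrrN !expr1n mul1r.
- by rewrite mulf_neq0 // expf_neq0 // oppr_eq0 oner_eq0.
rewrite /npos; case: (boolP (odd m)) rho_even => [_ _|m_even /(_ isT) rE]; first by rewrite addn0.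
rewrite -signr_odd (negPf m_even) mul1r rE eqxx addn1.
by congr (_ ^ _)%N; case: (m) m_gt0 m_even => // k _ /=; rewrite negbK uphalf_half => ->.
Qed.

Lemma card_recip_neg : odd q -> #|[set p in recip_set n m z | pdet p != rho]| = nneg m.
Proof.
move=> q_odd; have rN : - rho != rho.
  by rewrite -subr_eq0 -opprD oppr_eq0 -mulr2n -mulr_natl mulf_neq0 ?two_neq0.
have -> : [set p in recip_set n m z | pdet p != rho]
    = [set p in recip_set n m z | p`_0 == (-1) ^+ m * - rho].
  apply/setP => p; rewrite inE [RHS]inE; apply: andb_id2l => pR; rewrite -pdet_eq //.
  by have [->|->] := pdet_recip pR; rewrite eqxx ?rN // eq_sym (negPf rN).
have [m0|m_gt0] := posnP m.
  have rho1 : rho = 1 by rewrite rho_even m0 ?expr0.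
  rewrite /nneg m0 eqxx; apply/eqP; rewrite cards_eq0; apply/eqP/setP => p.
  rewrite inE recip_set_0 !inE; apply/negbTE; rewrite negb_and -implybE; apply/implyP => /eqP->.
  by rewrite npolypK ?size_poly1 // coefC expr0 mul1r rho1 eq_sym opp1_neq1.
rewrite card_recip_coef0 //; first last.
- by rewrite exprMn -exprM mulnC exprM !sqrrN !expr1n mul1r.
- by rewrite mulf_neq0 ?oppr_eq0 // expf_neq0 // oppr_eq0 oner_eq0.
rewrite /nneg gtn_eqF //; case: (boolP (odd m)) rho_even => [_ _|m_even /(_ isT) rE]; first by rewrite addn0.
by rewrite -signr_odd (negPf m_even) mul1r -rE (negPf rN) addn0.
Qed.

End Root.

Section Tuples.
Variable nu : seq nat.
Hypothesis nuP : is_partition n nu.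
Local Notation nn i := (count_mem (i : nat) nu).

Lemma part_le i : i \in nu -> (i <= n)%N.
Proof.
case/and3P: nuP => _ _ /eqP <-; elim: nu => //= j s IHs; rewrite in_cons => /orP[/eqP->|/IHs is_].
  exact: leq_addr.
exact: leq_trans is_ (leq_addl _ _).
Qed.

Lemma count_le i : (0 < i)%N -> (nn i <= n)%N.
Proof.
move=> i0; case/and3P: nuP => _ _ /eqP <-; elim: nu => //= j s IHs.
by case: eqP => [->|_]; lia.
Qed.

Lemma sum_parts : (\sum_(i < n.+1) i * nn i = n)%N.
Proof.
case/and3P: (nuP) => _ _ /eqP nuE; rewrite -[RHS]nuE.
have : forall j, j \in nu -> (j < n.+1)%N by move=> j /part_le.
elim: nu => [|j s IHs] le_n; first by rewrite big1 // => i _; rewrite muln0.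
rewrite /= -IHs => [|k ks]; last by apply: le_n; rewrite in_cons ks orbT.
under eq_bigr do rewrite mulnDr.
rewrite big_split /=; congr (_ + _)%N; have jn := le_n j (mem_head _ _).
rewrite (bigD1 (Ordinal jn)) //= eqxx muln1 big1 ?addn0 // => i.
by rewrite -val_eqE /= eq_sym => /negPf->; rewrite muln0.
Qed.

Lemma prod_parts (R : comPzRingType) (G : nat -> R) : (forall i, i \notin nu -> G i = 1) ->
  \prod_(i < n.+1) G i = \prod_(i <- undup nu) G i.
Proof.
move=> G1; rewrite -(big_mkord xpredT) (bigID (fun i => i \in nu)) /= [X in _ * X]big1 => [|i /G1 //].
rewrite mulr1 -big_filter; apply: perm_big; apply: uniq_perm.
- by rewrite filter_uniq ?iota_uniq.
- exact: undup_uniq.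
move=> i; rewrite mem_filter mem_undup mem_index_iota /= ltnS andbC.
by case: (boolP (i \in nu)) => [/part_le->|]; rewrite ?andbF.
Qed.

(** The invariants of the matrices of type [nu] that are similar to z g^-1 and whose image lies in
    PSL; the product is the determinant. *)
Definition recip_tuples (z : F) : {set {ffun 'I_n.+1 -> {poly_n.+1 F}}} :=
  [set u in family (fun i : 'I_n.+1 => mem (recip_set n (nn i) z)) |
    is_pow n (\prod_i pdet (u i) ^+ i)].

Lemma card_family_prod (R : 'I_n.+1 -> {set {poly_n.+1 F}}) :
  #|family (fun i => mem (R i))| = (\prod_i #|R i|)%N.
Proof.
transitivity (\prod_i \sum_(p in R i) 1)%N; last by apply: eq_bigr => i _; rewrite sum1_card.
by rewrite bigA_distr_big_dep -sum1_card; apply: eq_bigr => u _; rewrite big1_eq.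
Qed.

Section SignedTuples.
Variables (z : F) (rho : nat -> F).
Hypotheses (rho0 : forall i, rho i != 0) (rho2 : forall i, rho i ^+ 2 = z ^+ nn i).
Hypothesis rho_even : forall i, ~~ odd (nn i) -> rho i = z ^+ (nn i)./2.
Hypothesis q_odd : odd q.

Let nn_le (i : nat) : (nn i <= n)%N.
Proof.
have [->|] := posnP i; last exact: count_le.
by case/and3P: nuP => _ /count_memPn->.
Qed.

Let R (i : 'I_n.+1) := recip_set n (nn i) z.
Let kappa := \prod_(i < n.+1) rho i ^+ i.
Let sg (i : nat) (p : {poly_n.+1 F}) : bool := pdet p != rho i.

Let cardR i : #|R i| = (npos (nn i) + nneg (nn i))%N.
Proof.
rewrite -(card_recip_pos (nn_le i) (rho0 i) (rho2 i) (@rho_even i)).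
rewrite -(card_recip_neg (nn_le i) (rho0 i) (rho2 i) (@rho_even i) q_odd).
rewrite -(cardsID [set p : {poly_n.+1 F} | pdet p == rho i]); congr (_ + _)%N.
  by apply: eq_card => p; rewrite !inE.
by apply: eq_card => p; rewrite !inE andbC.
Qed.

Lemma det_tuple (u : {ffun 'I_n.+1 -> {poly_n.+1 F}}) : u \in family (fun i => mem (R i)) ->
  \prod_i pdet (u i) ^+ i = kappa * (-1) ^+ (\sum_(i < n.+1) i * sg i (u i))%N.
Proof.
move=> /familyP uR; rewrite -prodrXr -big_split; apply: eq_bigr => i _ /=.
have uRi : u i \in recip_set n (nn i) z by apply: uR.
rewrite /sg; have [->|->] := pdet_recip (rho2 i) uRi.
  by rewrite eqxx muln0 mulr1.
rewrite mulnC exprM -exprMn mulrC; congr (_ ^+ _).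
have -> : - rho i != rho i.
  by rewrite -subr_eq0 -opprD oppr_eq0 -mulr2n -mulr_natl mulf_neq0 ?two_neq0.
by rewrite expr1 mulN1r.
Qed.

Lemma card_recip_tuples_all : is_pow n (-1 : F) -> is_pow n kappa ->
  #|recip_tuples z| = (\prod_(i < n.+1) (npos (nn i) + nneg (nn i)))%N.
Proof.
move=> p1 pk; under eq_bigr do rewrite -cardR; rewrite -card_family_prod.
apply: eq_card => u; rewrite !inE; apply: andb_idr => uR; rewrite det_tuple //.
by apply: is_powM => //; rewrite -signr_odd; case: odd => //; rewrite expr0 -(expr1n _ n) is_powX.
Qed.

Lemma card_recip_tuples_none : is_pow n (-1 : F) -> kappa != 0 -> ~~ is_pow n kappa ->
  #|recip_tuples z| = 0%N.
Proof.
move=> p1 k0 pk; apply: eq_card0 => u; rewrite !inE; apply/negbTE; rewrite negb_and -implybE.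
apply/implyP => uR; rewrite det_tuple // mulrC is_powMl //; first by rewrite signr_eq0.
by rewrite -signr_odd; case: odd => //; rewrite expr0 -(expr1n _ n) is_powX.
Qed.

(** A tuple is admissible when its sign (-1)^S is 1. The indicator (1 + (-1)^S) / 2 splits the count
    into two sums, each factoring over [i]. *)
Lemma card_recip_tuples_signed : ~~ is_pow n (-1 : F) -> kappa != 0 -> is_pow n kappa ->
  #|recip_tuples z|%:R = 2%:R^-1 * (\prod_(i < n.+1) (npos (nn i) + nneg (nn i))%:R
    + \prod_(i < n.+1) ((npos (nn i))%:R + (-1) ^+ i * (nneg (nn i))%:R)) :> rat.
Proof.
move=> p1 k0 pk.
have pos1 (k : nat) : is_pow n ((-1) ^+ k : F) = ~~ odd k.
  by rewrite -signr_odd; case: odd; [rewrite (negPf p1)|rewrite expr0 -(expr1n _ n) is_powX].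
pose S (u : {ffun 'I_n.+1 -> {poly_n.+1 F}}) := (\sum_(i < n.+1) i * sg i (u i))%N.
have -> : #|recip_tuples z|%:R = \sum_(u in family (fun i => mem (R i))) 2%:R^-1 * (1 + (-1) ^+ S u) :> rat.
  rewrite -sum1_card natr_sum big_mkcond [RHS]big_mkcond; apply: eq_bigr => u _ /=.
  have -> : (u \in recip_tuples z) = (u \in family (fun i => mem (R i))) && is_pow n (\prod_i pdet (u i) ^+ i).
    by rewrite inE.
  case: (boolP (u \in family _)) => //= uR; rewrite det_tuple // is_powMl // pos1.
  by rewrite -[X in 1 + X]signr_odd /S; case: odd.
rewrite -big_distrr big_split /=; congr (_ * (_ + _)).
  rewrite sumr_const card_family_prod natr_prod.
  by apply: eq_bigr => i _; rewrite cardR.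
transitivity (\prod_(i < n.+1) \sum_(p in R i) (-1) ^+ (i * sg i p) : rat); last first.
  apply: eq_bigr => i _; rewrite (bigID (sg i)) /= addrC; congr (_ + _).
    rewrite -(card_recip_pos (nn_le i) (rho0 i) (rho2 i) (@rho_even i)) -sum1_card natr_sum.
    by apply: eq_big => [p|p /andP[_ /negPf->]]; [rewrite !inE negbK|rewrite muln0].
  rewrite -(card_recip_neg (nn_le i) (rho0 i) (rho2 i) (@rho_even i) q_odd) -sum1_card natr_sum.
  rewrite big_distrr /=.
  by apply: eq_big => [p|p /andP[_ ->]]; [rewrite !inE|rewrite muln1 mulr1].
rewrite (bigA_distr_big_dep (fun i p => p \in R i)); apply: eq_bigr => u _.
by rewrite prodrXr.
Qed.

End SignedTuples.
End Tuples.
End SignedCount.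

(** * Summation over the scalar [z] *)

Section TotalCount.
Variables (F : finFieldType) (n : nat) (nu : seq nat).
Local Notation q := #|F|.
Local Notation nn i := (count_mem (i : nat) nu).
Hypotheses (n_gt0 : (0 < n)%N) (nuP : is_partition n nu).

Let q0 : (0 < q)%N. Proof. exact: ltnW (finNzRing_gt1 F). Qed.

Let nn_notin i : i \notin nu -> nn i = 0%N. Proof. by move/count_memPn. Qed.

Let nn_gt0 i : i \in nu -> (0 < nn i)%N. Proof. by rewrite -has_pred1 has_count. Qed.

Lemma prod_npos_nneg : odd q ->
  \prod_(i < n.+1) (npos F (nn i) + nneg F (nn i))%:R = \prod_(i <- undup nu) (nq q (nn i))%:R :> rat.
Proof.
move=> q_odd; rewrite (@prod_parts n nu nuP _ (fun i => (npos F (nn i) + nneg F (nn i))%:R)) => [|i /nn_notin->].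
  apply: eq_big_seq => i; rewrite mem_undup => inu.
  by rewrite nq_odd // nn_gt0.
by rewrite /npos /nneg /= expn0.
Qed.

(** At an odd [i], if n_i is odd then [npos] and [nneg] agree and the second product vanishes; if
    n_i is even, their sum and difference are q + 1 and q - 1 times the same power of q, whence
    [fnu]. Without odd parts the two products coincide. *)
Lemma sl_signed : odd q ->
  2%:R^-1 * (\prod_(i < n.+1) (npos F (nn i) + nneg F (nn i))%:R
    + \prod_(i < n.+1) ((npos F (nn i))%:R + (-1) ^+ i * (nneg F (nn i))%:R)) = sl q nu :> rat.
Proof.
move=> q_odd; rewrite prod_npos_nneg //.
rewrite (@prod_parts n nu nuP _ (fun i => (npos F (nn i))%:R + (-1) ^+ i * (nneg F (nn i))%:R)); last first.
  by move=> i /nn_notin->; rewrite /npos /nneg /= expn0 mulr0 addr0.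
have nqE i : i \in undup nu -> (nq q (nn i))%:R = (npos F (nn i))%:R + (nneg F (nn i))%:R :> rat.
  by rewrite mem_undup => inu; rewrite nq_odd ?nn_gt0 // natrD.
have evenE i : i \in undup nu -> ~~ odd i ->
    (npos F (nn i))%:R + (-1) ^+ i * (nneg F (nn i))%:R = (nq q (nn i))%:R :> rat.
  by move=> inu i_even; rewrite nqE // -signr_odd (negPf i_even) mul1r.
rewrite /sl; case: ifP => [/hasPn no_odd|_].
  rewrite [X in _ + X](eq_big_seq (fun i => (nq q (nn i))%:R)).
    by set X := (X in X + _); rewrite -mulr2n -[X *+ 2]mulr_natl mulKf.
  by move=> i inu; apply: evenE => //; apply: no_odd; rewrite -mem_undup.
case: ifP => [/hasP[i inu]|/negbT/hasPn no_odd].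
  rewrite oddM => /andP[i_odd nn_odd]; congr (_ * _).
  rewrite [X in _ + X](bigD1_seq i) ?undup_uniq ?mem_undup //= -signr_odd i_odd expr1.
  rewrite /npos /nneg nn_odd gtn_eqF ?nn_gt0 // mulN1r subrr mul0r addr0 //.
have nn_even i : i \in undup nu -> odd i -> ~~ odd (nn i).
  by rewrite mem_undup => /no_odd; rewrite oddM; case: (odd i).
have nE i : i \in undup nu -> odd i -> (npos F (nn i))%:R = q%:R * (q ^ ((nn i)./2).-1)%:R :> rat
    /\ (nneg F (nn i))%:R = (q ^ ((nn i)./2).-1)%:R :> rat.
  move=> inu i_odd; have nne := nn_even i inu i_odd; rewrite mem_undup in inu.
  have nn0 := nn_gt0 inu; rewrite /npos /nneg (negPf nne) gtn_eqF //.
  have nnh : (0 < (nn i)./2)%N by rewrite -double_gt0 -(even_halfK nne) //; lia.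
  rewrite -natrM -expnS prednK //; split=> //; congr (q ^ _)%:R.
  by case: (nn i) nne nn0 => // k /=; rewrite negbK uphalf_half => ->.
pose r := count odd (undup nu).
have split_prod (G : nat -> rat) c : (forall i, i \in undup nu -> odd i -> G i = c * (q ^ ((nn i)./2).-1)%:R) ->
    (forall i, i \in undup nu -> ~~ odd i -> G i = (nq q (nn i))%:R) ->
    \prod_(i <- undup nu) G i = c ^+ r * (\prod_(i <- undup nu | odd i) (q ^ ((nn i)./2).-1)%:R
      * \prod_(i <- undup nu | ~~ odd i) (nq q (nn i))%:R).
  move=> Godd Geven; rewrite (bigID odd) /= mulrA; congr (_ * _); last first.
    rewrite big_mkcond [RHS]big_mkcond; apply: eq_big_seq => i inu; case: ifP => // i_even.
    exact: Geven.
  have -> : c ^+ r = \prod_(i <- undup nu | odd i) c by rewrite big_const_seq iter_mulr_1.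
  rewrite -big_split big_mkcond [RHS]big_mkcond; apply: eq_big_seq => i inu; case: ifP => // i_odd.
  exact: Godd.
rewrite (split_prod _ (q%:R + 1)) => [|i inu i_odd|//]; last first.
  by rewrite nqE //; have [-> ->] := nE i inu i_odd; rewrite mulrDl mul1r.
rewrite (split_prod _ (q%:R - 1)) => [|i inu i_odd|i]; last exact: evenE.
  by rewrite /fnu -/r -mulrDl -!mulrA mulrCA mulrA.
have [-> ->] := nE i inu i_odd.
by rewrite -signr_odd i_odd expr1 mulN1r mulrBl mul1r.
Qed.

Lemma dpart_gt1 : (1 < dpart nu)%N = all (fun i => ~~ odd (nn i)) nu.
Proof.
have -> : all (fun i => ~~ odd (nn i)) nu = all (fun i => 2 %| nn i)%N (undup nu).
  rewrite all_undup; apply: eq_all => i; by rewrite dvdn2.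
rewrite /dpart; set s := undup nu; set D := (\big[gcdn/0]_(i <- s) nn i)%N.
have D0 : (0 < D)%N.
  have [i inu] : exists i, i \in nu.
    case: nu nuP => [|i s'] //; last by exists i; rewrite mem_head.
    by case/and3P => _ _ /eqP /= n0; move: n_gt0; rewrite -n0.
  rewrite /D (bigD1_seq i) ?undup_uniq ?mem_undup //= gcdn_gt0 nn_gt0 //.
have -> : (1 < D`_2)%N = (2 %| D)%N.
  by rewrite p_part -(expn0 2) ltn_exp2l // logn_gt0 mem_primes D0.
rewrite /D; elim: s {D D0} => [|i s IHs]; first by rewrite big_nil.
by rewrite big_cons dvdn_gcd IHs.
Qed.

Let q' := q.-1.

(** For z = x^2 the reference determinants rho_i can be the powers x^(n_i), and the reference
    determinant of the tuple is x^n, an [n]-th power. *)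
Lemma tuples_square_roots (x : F) : x != 0 ->
  [/\ forall i : nat, x ^+ nn i != 0, forall i : nat, (x ^+ nn i) ^+ 2 = (x ^+ 2) ^+ nn i,
      forall i : nat, ~~ odd (nn i) -> x ^+ nn i = (x ^+ 2) ^+ (nn i)./2 &
      \prod_(i < n.+1) (x ^+ nn i) ^+ i = x ^+ n].
Proof.
move=> x0; split=> [i|i|i nne|]; first by rewrite expf_neq0.
- by rewrite -!exprM mulnC.
- by rewrite -exprM mul2n -[in LHS](odd_double_half (nn i)) (negPf nne).
rewrite -[in RHS](sum_parts nuP) -prodrXr; apply: eq_bigr => i _.
by rewrite -exprM mulnC.
Qed.

Lemma card_recip_tuples_even (z : F) : ~~ odd q -> z != 0 ->
  #|recip_tuples n nu z|%:R = \prod_(i <- undup nu) (nq q (nn i))%:R :> rat.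
Proof.
move=> q_even z0; have opp1 : -1 = 1 :> F by apply: even_card_opp1.
(* A square root of [z], since z^q = z and [q] is even. *)
pose x := z ^+ q./2; have x0 : x != 0 by rewrite expf_neq0.
have xz : x ^+ 2 = z.
  by rewrite -exprM muln2 -[RHS](expf_card z) -[in RHS](odd_double_half q) (negPf q_even).
have [r0 r2 re rk] := tuples_square_roots x0; rewrite xz in r2 re.
have nn_le (i : 'I_n.+1) : (nn i <= n)%N.
  have [->|] := posnP i; last exact: (count_le nuP).
  by case/and3P: nuP => _ /count_memPn->.
have pE (i : 'I_n.+1) (p : {poly_n.+1 F}) : p \in recip_set n (nn i) z -> pdet p = x ^+ nn i.
  by move=> /(pdet_recip (r2 i))[->|->] //; rewrite -mulN1r opp1 mul1r.
have cardR (i : 'I_n.+1) : #|recip_set n (nn i) z| = npos F (nn i).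
  rewrite -(card_recip_pos (nn_le i) (r0 i) (r2 i) (re i)); apply: eq_card => p.
  by rewrite inE; apply/esym/andb_idr => /pE->.
have -> : #|recip_tuples n nu z| = (\prod_(i < n.+1) npos F (nn i))%N.
  under eq_bigr do rewrite -cardR; rewrite -card_family_prod.
  apply: eq_card => u; rewrite inE; apply: andb_idr => /familyP uR.
  rewrite (eq_bigr (fun i : 'I_n.+1 => (x ^+ nn i) ^+ i)) ?rk ?is_powX // => i _.
  by rewrite (pE i) //; apply: uR.
rewrite natr_prod (@prod_parts n nu nuP _ (fun i => (npos F (nn i))%:R)) => [|i /nn_notin->].
  by apply: eq_bigr => i _; rewrite nq_even.
by rewrite /npos /= expn0.
Qed.

(** A constant term of odd degree n_i squares to z^(n_i), which would make [z] a square. *)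
Lemma recip_tuples_odd_empty (z : F) : (forall x, x ^+ 2 != z) -> has (fun i => odd (nn i)) nu ->
  recip_tuples n nu z = set0.
Proof.
move=> nsq /hasP[i inu nn_odd]; have z0 : z != 0.
  by apply: contraNneq (nsq 0) => ->; rewrite expr0n.
apply/setP => u; rewrite [in RHS]inE inE; apply/negP => /andP[/familyP uR _].
have im : (i < n.+1)%N by rewrite ltnS (part_le nuP).
have := uR (Ordinal im); rewrite /= => /recip_set_coef0; set c := _`_0 => c2.
case/negP: (nsq (c / z ^+ (nn i)./2)); rewrite exprMn exprVn c2 -exprM muln2.
by rewrite -{1}(odd_double_half (nn i)) nn_odd exprD expr1 mulfK ?expf_neq0.
Qed.

Lemma tuples_half_roots (z : F) : z != 0 -> ~~ has (fun i => odd (nn i)) nu ->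
  [/\ forall i : nat, z ^+ (nn i)./2 != 0, forall i : nat, (z ^+ (nn i)./2) ^+ 2 = z ^+ nn i &
      \prod_(i < n.+1) (z ^+ (nn i)./2) ^+ i = z ^+ n./2 /\ ~~ odd n].
Proof.
move=> z0 /hasPn no_odd; have nnE (i : nat) : nn i = ((nn i)./2 * 2)%N.
  rewrite muln2 -[LHS]odd_double_half; have [/no_odd/negPf-> //|/nn_notin->] := boolP (i \in nu).
  by [].
have nE : n = ((\sum_(i < n.+1) i * (nn i)./2) * 2)%N.
  rewrite -[LHS](sum_parts nuP) big_distrl; apply: eq_bigr => i _ /=.
  by rewrite -mulnA -nnE.
split=> [i|i|]; first by rewrite expf_neq0.
  by rewrite -exprM -nnE.
split; last by rewrite nE muln2 odd_double.
have -> : n./2 = (\sum_(i < n.+1) i * (nn i)./2)%N by rewrite {1}nE muln2 doubleK.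
rewrite -prodrXr; apply: eq_bigr => i _; by rewrite -exprM mulnC.
Qed.

(** Multiplication by a nonsquare exchanges the nonzero squares with the nonsquares, so each set has
    (q - 1)/2 elements. *)
Lemma nonsquare_sum (G : F -> rat) (a b : rat) : odd q ->
    (forall x, x != 0 -> G (x ^+ 2) = a) -> (forall z, (forall x, x ^+ 2 != z) -> G z = b) ->
  \sum_(z | z != 0) G z = q'%:R * (2%:R^-1 * (a + b)).
Proof.
move=> q_odd Ga Gb; have [e [e0 nsqe]] := nonsquare_exists q_odd.
pose sq (z : F) := [exists x, x ^+ 2 == z].
have sqP z : sq z -> z != 0 -> G z = a.
  move=> /existsP[x /eqP <-] x2; apply: Ga; apply: contraNneq x2 => ->; by rewrite expr0n.
have nsqP z : ~~ sq z -> G z = b.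
  by move=> /existsPn nz; apply: Gb => x; apply: nz.
have eulerP z : z != 0 -> ~~ sq z -> z ^+ (q.-1)./2 = -1.
  by move=> z0 /existsPn; apply: euler_criterion.
have sq_euler z : z != 0 -> sq z -> z ^+ (q.-1)./2 = 1.
  move=> z0 /existsP[x /eqP xz]; rewrite -xz -exprM mul2n -half_card // expf_card_pred //.
  by apply: contraNneq z0 => x0; rewrite -xz x0 expr0n.
have sqe z : z != 0 -> sq (e * z) = ~~ sq z.
  move=> z0; have ez0 : e * z != 0 by rewrite mulf_neq0.
  have ee : e ^+ (q.-1)./2 = -1 by apply: euler_criterion.
  have [sz|nsz] := boolP (sq z).
    apply/negbTE/negP => sez; have := sq_euler _ ez0 sez.
    by rewrite exprMn ee (sq_euler _ z0 sz) mulr1 => /eqP; rewrite (negPf (opp1_neq1 q_odd)).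
  apply: contraT => nse; have := eulerP _ ez0 nse.
  by rewrite exprMn ee (eulerP _ z0 nsz) mulrNN mulr1 => /esym/eqP; rewrite (negPf (opp1_neq1 q_odd)).
pose S := #|[set z : F | (z != 0) && sq z]|.
have cardN : #|[set z : F | (z != 0) && ~~ sq z]| = S.
  rewrite -(card_imset [set z : F | (z != 0) && ~~ sq z] (mulfI e0)); apply: eq_card => y.
  rewrite inE; apply/imsetP/andP => [[z + ->]|[y0 sy]].
    by rewrite inE => /andP[z0 nz]; rewrite mulf_neq0 // sqe.
  have y1 : e^-1 * y != 0 by rewrite mulf_neq0 ?invr_eq0.
  exists (e^-1 * y); last by rewrite mulrA mulfV // mul1r.
  by rewrite inE y1 -sqe // mulrA mulfV // mul1r.
have S2 : q' = (S + S)%N.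
  transitivity #|[pred z : F | z != 0]|; first by rewrite /q' -(@cardC1 F 0); apply: eq_card => z; rewrite !inE.
  rewrite -(cardID sq) -{2}cardN; congr (_ + _)%N; apply: eq_card => z;
  by rewrite !inE // andbC.
have sum_const (P : pred F) c : #|[set z | P z]| = S -> \sum_(z | P z) c = S%:R * c :> rat.
  move=> <-; rewrite mulr_natl -sumr_const; apply: eq_bigl => z; by rewrite inE.
rewrite (bigID sq) /= (eq_bigr (fun=> a)) => [|z /andP[z0 sz]]; last exact: sqP.
rewrite [X in _ + X](eq_bigr (fun=> b)) => [|z /andP[z0 sz]]; last exact: nsqP.
rewrite !sum_const // S2 -mulrDr addnn -muln2 natrM -[in RHS]mulrA; congr (_ * _).
by rewrite mulVKf.
Qed.

(** For [q] odd, nonsquare [z] contribute nothing if |n|_2 < |q-1|_2 or some n_i is odd, and as much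
    as squares if |n|_2 > |q-1|_2 and all n_i are even. This is the origin of the factors 1/2 in
    [psl]. *)
Theorem card_recip_tuples_total : ~~ odd q \/ (n`_2 <> q.-1`_2)%N ->
  \sum_(z : F | z != 0) #|recip_tuples n nu z|%:R = q'%:R * psl q n nu.
Proof.
move=> hq; rewrite /psl; have [q_odd|q_even] := boolP (odd q); last first.
  rewrite orbT; set P := \prod_(i <- _) _.
  have -> : gcdn 2 q.-1 = 1%N.
    apply/eqP; rewrite -/(coprime 2 q.-1) coprime2n; move: q_even q0.
    by case: #|F| => //= m; rewrite negbK.
  transitivity (\sum_(z : F | z != 0) P).
    by apply: eq_bigr => z z0; apply: card_recip_tuples_even.
  by rewrite invr1 mul1r sumr_const mulr_natl /q' -(@cardC1 F 0).
rewrite orbF; have qn2 : (n`_2 != q.-1`_2)%N by apply/eqP; case: hq => //; rewrite q_odd.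
have sumE a b := @nonsquare_sum (fun z => #|recip_tuples n nu z|%:R) a b q_odd.
case: ltnP => lt2.
  have p1 := opp1_is_pow n_gt0 lt2.
  have -> : gcdn 2 q.-1 = 2%N.
    by apply/gcdn_idPl; rewrite dvdn2; move: q_odd q0; case: #|F|.
  rewrite -[X in 2%:R^-1 * X]addr0; apply: sumE => [x x0|z nsq].
    have [r0 r2 re rk] := tuples_square_roots x0.
    by rewrite (card_recip_tuples_all nuP r0 r2 re) ?rk ?is_powX // natr_prod prod_npos_nneg.
  have [odd_nn|even_nn] := boolP (has (fun i => odd (nn i)) nu).
    by rewrite recip_tuples_odd_empty // cards0.
  have z0 : z != 0 by apply: contraNneq (nsq 0) => ->; rewrite expr0n.
  have [r0 r2 [rk n_even]] := tuples_half_roots z0 even_nn.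
  rewrite (card_recip_tuples_none r0 r2) ?rk ?expf_neq0 //.
  exact: nonsquare_half_pow.
have {}lt2 : (q.-1`_2 < n`_2)%N by rewrite ltn_neqAle eq_sym qn2.
have p1 := opp1_not_pow q_odd n_gt0 lt2.
have sqE (x : F) : x != 0 -> #|recip_tuples n nu (x ^+ 2)|%:R = sl q nu.
  move=> x0; have [r0 r2 re rk] := tuples_square_roots x0.
  by rewrite (card_recip_tuples_signed nuP r0 r2 re) ?rk ?is_powX ?expf_neq0 ?sl_signed.
rewrite dpart_gt1 -[all _ _]negbK -has_predC /=.
have -> : has (predC (fun i => ~~ odd (nn i))) nu = has (fun i => odd (nn i)) nu.
  by apply: eq_has => i /=; rewrite negbK.
case: ifP => [even_nn|/negbT].
  rewrite (sumE (sl q nu) (sl q nu)) => [|x|z nsq]; [|exact: sqE|].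
    by rewrite -mulr2n -(mulr_natl (sl q nu) 2) mulKf.
  have z0 : z != 0 by apply: contraNneq (nsq 0) => ->; rewrite expr0n.
  have [r0 r2 [rk n_even]] := tuples_half_roots z0 even_nn.
  rewrite (card_recip_tuples_signed nuP r0 r2) ?rk ?expf_neq0 ?half_is_pow ?sl_signed //.
rewrite negbK => odd_nn; rewrite -[X in 2%:R^-1 * X]addr0; apply: sumE => [x|z nsq].
  exact: sqE.
by rewrite recip_tuples_odd_empty // cards0.
Qed.

End TotalCount.

(** * Classes of the projective group *)

Section ClassCounting.
Local Open Scope group_scope.
Variable gT : finGroupType.

Lemma sum_card_cent1 (H : {group gT}) x : x \in H ->
  (\sum_(y in x ^: H) #|'C_H[y]| = #|H|)%N.
Proof.
move=> xH; rewrite -(Lagrange (subsetIl H 'C[x])) index_cent1 mulnC -sum_nat_const.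
apply: eq_bigr => _ /imsetP[y yH ->].
by rewrite -{1}(conjGid yH) cent1J -conjIg cardJg.
Qed.

Lemma card_classes_sub (H : {group gT}) (Y : {set gT}) : Y \subset H -> H \subset 'N(Y) ->
  (#|[set C in classes H | C \subset Y]| * #|H| = \sum_(y in Y) #|'C_H[y]|)%N.
Proof.
move=> YH HY; rewrite (partition_big (fun y => y ^: H) (mem [set C in classes H | C \subset Y])) /=.
  rewrite -sum_nat_const; apply: eq_bigr => C; rewrite inE => /andP[/imsetP[x xH ->] xY].
  rewrite -(sum_card_cent1 xH); apply: eq_bigl => y.
  by apply/idP/andP => [yx|[_ /eqP/class_eqP]//]; split; [apply: (subsetP xY)|apply/eqP/class_eqP].
move=> y yY; rewrite inE mem_classes ?(subsetP YH) //.
by apply/subsetP => _ /imsetP[x xH ->]; rewrite memJ_norm // (subsetP HY).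
Qed.

Variables Z K : {group gT}.
Hypothesis nZ : forall x, x \in 'N(Z).

Let nT (A : {set gT}) : A \subset 'N(Z). Proof. exact/subsetP. Qed.

Lemma full_cosetM x y : coset Z (x * y) = coset Z x * coset Z y.
Proof. exact: morphM. Qed.

Lemma full_cosetV x : coset Z x^-1 = (coset Z x)^-1.
Proof. exact: morphV. Qed.

Lemma full_coset_sqr1 x : x * x = 1 -> coset Z x ^+ 2 = 1.
Proof. by move=> xx; rewrite expgS expg1 -full_cosetM xx; apply: morph1. Qed.

Lemma mem_cosetpre_cent1 c x :
  (c \in coset Z @*^-1 'C[coset Z x]) = (coset Z c * coset Z x == coset Z x * coset Z c).
Proof.
rewrite morphpreE inE nZ inE.
by apply/idP/idP => [/cent1P|/eqP] e; [apply/eqP|apply/cent1P].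
Qed.

Lemma card_quotientI (T : {group gT}) : (#|T / Z| * #|T :&: Z| = #|T|)%N.
Proof. by rewrite card_morphim (setIidPr (nT _)) ker_coset -(LagrangeI T Z) mulnC. Qed.

Lemma card_cent1_quotient x :
  (#|'C_(K / Z)[coset Z x]| * #|K :&: Z| = #|K :&: coset Z @*^-1 'C[coset Z x]|)%N.
Proof.
set y := coset Z x; pose T := [group of K :&: coset Z @*^-1 'C[y]].
have ZT : Z \subset coset Z @*^-1 'C[y] by apply: sub_cosetpre.
have -> : 'C_(K / Z)[y] = T / Z by rewrite quotientIG // cosetpreK.
by rewrite -[RHS](card_quotientI T) /= -setIA (setIidPr ZT).
Qed.

(** Each element of [Y] has [#|Z|] preimages, and its centralizer in K / Z is the image of the
    elements of [K] that commute with a preimage modulo [Z]. *)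
Lemma sum_cent1_quotient (Y : {set coset_of Z}) :
  ((\sum_(y in Y) #|'C_(K / Z)[y]|) * #|K :&: Z| * #|Z| =
   \sum_(x | coset Z x \in Y) #|K :&: coset Z @*^-1 'C[coset Z x]|)%N.
Proof.
rewrite !big_distrl /= (partition_big (coset Z) (mem Y)) //=; apply: eq_bigr => y yY.
have [x xN yE] := cosetP y; rewrite yE in yY *.
rewrite (eq_bigr (fun=> (#|'C_(K / Z)[coset Z x]| * #|K :&: Z|)%N)) => [|g /andP[_ /eqP gx]]; last first.
  by rewrite -gx card_cent1_quotient.
rewrite sum_nat_const mulnC; congr (_ * _)%N; rewrite -(card_rcoset Z x).
apply: eq_card => g; rewrite [RHS]unfold_in; apply/idP/andP => [/(rcoset_kercosetP (nZ g) (nZ x)) ->//|[_ /eqP gx]].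
exact/(rcoset_kercosetP (nZ g) (nZ x)).
Qed.

End ClassCounting.

(** * Scalars and determinants in the general linear group *)

Section GeneralLinear.
Variables (F : finFieldType) (n' : nat).
Local Notation n := n'.+1.
Local Notation q := #|F|.
Local Notation gT := {'GL_n[F]}.
Local Notation Z := 'Z('GL_n[F])%G.

Lemma GL_of_unitmx (M : 'M[F]_n) : M \in unitmx -> exists c : gT, GLval c = M.
Proof. by move=> MU; exists (FinRing.unit 'M[F]_n MU). Qed.

Lemma GL_mulmxV (g : gT) : GLval g *m GLval g^-1%g = 1%:M.
Proof. by rewrite -GL_MxE mulgV. Qed.

Lemma GL_mulVmx (g : gT) : GLval g^-1%g *m GLval g = 1%:M.
Proof. by rewrite -GL_MxE mulVg. Qed.

(** Commuting with the transvections 1 + E_ij means commuting with the E_ij, which forces zero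
    off-diagonal entries and equal diagonal ones. *)
Lemma GL_centerP (z : gT) : reflect (exists2 x : F, x != 0 & GLval z = x%:M) (z \in Z).
Proof.
apply: (iffP idP) => [/centerP[_ cz]|[x x0 zE]]; last first.
  apply/centerP; split=> [|c _]; first by rewrite inE.
  apply: val_inj; change (GLval z *m GLval c = GLval c *m GLval z).
  by rewrite zE scalar_mxC.
set A := GLval z; have cE i j : i != j -> A *m delta_mx i j = delta_mx i j *m A.
  move=> ij; have EE : delta_mx i j *m delta_mx i j = 0 :> 'M[F]_n by rewrite mul_delta_mx_0 // eq_sym.
  have [|c cE] := @GL_of_unitmx (1%:M + delta_mx i j).
    suff /mulmx1_unit[] : (1%:M + delta_mx i j) *m (1%:M - delta_mx i j) = 1%:M :> 'M[F]_n by [].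
    by rewrite mulmxBr mulmx1 mulmxDl mul1mx EE addr0 addrK.
  have := congr1 (@GLval _ F) (cz c (in_setT c)); rewrite !GL_MxE cE -/A.
  by rewrite mulmxDr mulmxDl mulmx1 mul1mx => /addrI.
have A0 i k : k != i -> A k i = 0.
  move=> ki; have := congr1 (fun B : 'M[F]_n => B k k) (cE i k _); rewrite eq_sym => /(_ ki).
  rewrite !mxE (bigD1 i) //= big1 => [|j ji]; last by rewrite mxE (negPf ji) mulr0.
  rewrite mxE !eqxx mulr1 addr0 big1 // => j _; by rewrite mxE (negPf ki) mul0r.
have Ad i j : i != j -> A i i = A j j.
  move=> ij; have := congr1 (fun B : 'M[F]_n => B i j) (cE i j ij).
  rewrite !mxE (bigD1 i) //= big1 => [|k ki]; last by rewrite mxE (negPf ki) mulr0.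
  rewrite mxE !eqxx mulr1 addr0 (bigD1 j) //= big1 => [|k ki]; last by rewrite mxE (negPf ki) andbF mul0r.
  by rewrite mxE !eqxx mul1r addr0.
have AE : A = (A ord0 ord0)%:M.
  apply/matrixP => i j; rewrite mxE; have [<-|ij] := eqVneq i j; last by rewrite A0.
  by have [->|i0] := eqVneq i ord0; last exact: Ad.
exists (A ord0 ord0) => //; apply: contraTneq (GL_det z) => a0.
by rewrite -/A AE a0 det_scalar expr0n /= eqxx.
Qed.

Lemma GL_normZ (g : gT) : g \in 'N(Z)%g.
Proof. by apply: (subsetP (normal_norm (center_normal _))); rewrite inE. Qed.

Lemma GL_cosetP (g g' : gT) :
  reflect (exists2 x : F, x != 0 & GLval g = x *: GLval g') (coset Z g == coset Z g').
Proof.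
apply: (iffP eqP) => [/(rcoset_kercosetP (GL_normZ g) (GL_normZ g'))|[x x0 e]].
  case/rcosetP => z /GL_centerP[x x0 zE] ->; exists x => //.
  by rewrite GL_MxE zE mul_scalar_mx.
apply/(rcoset_kercosetP (GL_normZ g) (GL_normZ g'))/rcosetP; exists (g * g'^-1)%g; last by rewrite mulgKV.
apply/GL_centerP; exists x => //.
by rewrite GL_MxE e -scalemxAl GL_mulmxV scalemx1.
Qed.

Lemma card_GL_center : #|Z| = q.-1.
Proof.
have sU (x : {unit F}) : ((FinRing.uval x)%:M : 'M[F]_n) \in unitmx.
  by rewrite unitmxE det_scalar unitrX //; apply: valP.
pose sc (x : {unit F}) : gT := FinRing.unit 'M[F]_n (sU x).
have sc_inj : injective sc.
  move=> x y /(congr1 (@GLval _ F))/matrixP/(_ ord0 ord0); rewrite !mxE eqxx !mulr1n.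
  exact: val_inj.
rewrite -card_finField_unit -(card_imset _ sc_inj); apply: eq_card => z.
apply/GL_centerP/imsetP => [[x x0 zE]|[x _ ->]]; last first.
  by exists (FinRing.uval x) => //; rewrite -unitfE; apply: valP.
have xU : x \is a GRing.unit by rewrite unitfE.
by exists (FinRing.unit F xU); rewrite ?inE //; apply: val_inj; rewrite /= -zE.
Qed.

(** Scaling by [x] multiplies the determinant by [x ^+ n]. *)
Lemma mem_PSL (g : gT) : (coset Z g \in PSL n F) = is_pow n (\det (GLval g)).
Proof.
apply/idP/is_powP => [/morphimP[s _ sSL /eqP/GL_cosetP[x x0 ->]]|[y dg]].
  exists x; rewrite detZ; move: sSL; rewrite inE => /eqP->; exact: mulr1.
have y0 : y != 0.
  by apply: contraTneq (GL_det g) => y0; rewrite dg y0 expr0n /= eqxx.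
have [|s sE] := @GL_of_unitmx (y^-1 *: GLval g).
  by rewrite unitmxZ ?unitfE ?invr_eq0 //; apply: (valP g).
have -> : coset Z g = coset Z s.
  by apply/eqP/GL_cosetP; exists y => //; rewrite sE scalerA mulfV // scale1r.
apply: mem_quotient; rewrite inE sE detZ dg exprVn mulVf ?expf_neq0 //.
Qed.

Fact GLdet_unit (g : gT) : \det (GLval g) \is a GRing.unit.
Proof. by rewrite unitfE GL_det. Qed.

Definition GLdet (g : gT) : {unit F} := FinRing.unit F (GLdet_unit g).

Lemma GLdetM : {morph GLdet : g h / (g * h)%g}.
Proof. by move=> g h; apply: val_inj; rewrite /= det_mulmx. Qed.

(** The determinant maps [T] onto the [D]-th powers of a cyclic group of order q - 1, a subgroup of
    index gcd(q - 1, D), with kernel the intersection with SL. *)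
Lemma card_SL_det_pow (T : {group gT}) D : (0 < D)%N ->
    (forall c, c \in T -> exists y, \det (GLval c) = y ^+ D) ->
    (forall y, y != 0 -> exists2 c, c \in T & \det (GLval c) = y ^+ D) ->
  (#|SL n F :&: T| * q.-1 = #|T| * gcdn q.-1 D)%N.
Proof.
move=> D0 Tpow powT; pose f := Morphism (D := [set: gT]%G) (in2W GLdetM).
have [w wE] := cyclicP (field_unit_group_cyclic [set: {unit F}]%G).
have ow : #[w]%g = q.-1 by rewrite -card_finField_unit /= wE.
have fX (y : {unit F}) k : FinRing.uval (y ^+ k)%g = FinRing.uval y ^+ k.
  by elim: k => // k IHk; rewrite expgS exprS -IHk.
have imf : (f @* T = <[w ^+ D]>)%g.
  apply/setP => u; apply/morphimP/cycleP => [[c _ cT ->]|[k ->]].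
    have [y dc] := Tpow c cT.
    have yU : y \is a GRing.unit.
      by rewrite unitfE; apply: contraTneq (GL_det c) => y0; rewrite dc y0 expr0n gtn_eqF // eqxx.
    have : FinRing.unit F yU \in <[w]>%g by rewrite -wE inE.
    case/cycleP => k yk; exists k; rewrite -expgM mulnC expgM -yk.
    by apply: val_inj; rewrite /= fX.
  have wk0 : FinRing.uval (w ^+ k)%g != 0 by rewrite -unitfE; apply: valP.
  have [c cT dc] := powT _ wk0; exists c; rewrite ?inE //.
  by apply: val_inj; rewrite /= dc -fX -!expgM mulnC.
have kerf : ('ker f)%g = SL n F.
  apply/setP => c; rewrite !inE /=; apply/eqP/eqP => [/(congr1 (@FinRing.uval _)) //|dc].
  exact: val_inj.
have := card_morphim f T; rewrite imf -orderE orderXgcd ow setTI kerf => cT.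
rewrite -(LagrangeI T (SL n F)) setIC -cT -mulnA divnK //; apply: dvdn_gcdl.
Qed.

Lemma card_SL : (#|SL n F| * q.-1 = #|[set: gT]|)%N.
Proof.
have := @card_SL_det_pow [set: gT]%G 1 isT; rewrite setIT gcdn1 muln1; apply.
  by move=> c _; exists (\det (GLval c)); rewrite expr1.
move=> y y0; pose d : 'rV[F]_n := \row_i (if i == ord0 then y else 1).
have dd : \det (diag_mx d) = y.
  rewrite det_diag (bigD1 ord0) //= big1 => [|i i0]; first by rewrite mxE eqxx mulr1.
  by rewrite mxE (negPf i0).
have [|c cE] := @GL_of_unitmx (diag_mx d); first by rewrite unitmxE dd unitfE.
by exists c; rewrite ?inE // cE dd expr1.
Qed.

End GeneralLinear.

Section DataOfUnits.
Variable F : finFieldType.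

Lemma data_coef0 n (g g' : 'M[F]_n) z u i : z != 0 -> g *m g' = z%:M -> has_data g u -> (u i)`_0 != 0.
Proof.
move=> z0 gg' [I [v [f [a [d ->]]]]]; rewrite -horner_coef0 horner_prod prodf_seq_neq0.
by apply/allP => j _; apply/implyP => _; rewrite horner_coef0 (primary_dec_coef0 z0 gg' d).
Qed.

Lemma mx_has_type_data n (g : 'M[F]_n) u nu : has_data g u ->
  mx_has_type g nu <-> (forall i, count_mem i nu = (size (u i)).-1).
Proof.
move=> gu; rewrite mx_has_typeP; split=> [[u' gu'] uE i|uE]; last by exists u.
by rewrite (data_uniq gu gu').
Qed.

(** Scaling is the composite of two reciprocations, from [g] to g^-1 with scalar 1 and from g^-1 to
    x g with scalar [x]; each preserves degrees and exponents. *)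
Lemma mx_has_type_scale n (g g' : 'M[F]_n) x nu : x != 0 -> g *m g' = 1%:M ->
  mx_has_type g nu -> mx_has_type (x *: g) nu.
Proof.
move=> x0 gg' /mx_has_typeP[u gu uE].
have gu1 := data_recip (oner_neq0 F) gg' gu.
have gg2 : g' *m (x *: g) = x%:M by rewrite -scalemxAr (mulmx1C gg') scalemx1.
have gu2 := data_recip x0 gg2 gu1; apply/mx_has_typeP.
exists (fun i => star x (star 1 (u i))) => // i.
rewrite !size_star //; first exact: data_coef0 (oner_neq0 F) gg' gu.
exact: data_coef0 x0 gg2 gu1.
Qed.

Lemma mx_has_type_conj n (g g' M M' : 'M[F]_n) nu : M *m M' = 1%:M -> M *m g = g' *m M ->
  mx_has_type g nu -> mx_has_type g' nu.
Proof.
move=> MM' Mg /mx_has_typeP[u gu uE]; apply/mx_has_typeP; exists u => //.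
exact: data_conj MM' Mg gu.
Qed.

Lemma data_size_le n (g : 'M[F]_n) u i : has_data g u -> (size (u i) <= n.+1)%N.
Proof.
move=> gu; have [/andP[i0 im]|/(data_out gu)->] := boolP (0 < i <= n)%N; last by rewrite size_poly1.
rewrite -{1}(data_dim gu) (bigD1 (Ordinal (im : i < n.+1)%N)) //=.
case: (size (u i)) => // s /=; rewrite ltnS -{1}(muln1 s) mulnC.
by rewrite (leq_trans _ (leq_addr _ _)) // leq_mul2r i0 orbT.
Qed.

End DataOfUnits.

Section RealClasses.
Variables (F : finFieldType) (n' : nat).
Local Notation n := n'.+1.
Local Notation q := #|F|.
Local Notation gT := {'GL_n[F]}.
Local Notation Z := 'Z('GL_n[F])%G.

Lemma PGL_has_typeE (g : gT) nu : PGL_has_type (coset Z g) nu <-> mx_has_type g nu.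
Proof.
split=> [[h /eqP/GL_cosetP[x x0 ->]]|]; last by exists g.
exact: mx_has_type_scale x0 (GL_mulmxV h).
Qed.

Definition inverters (g : gT) : {set gT} :=
  [set c | coset Z c * coset Z g * (coset Z c)^-1 == (coset Z g)^-1]%g.

Definition twisted_inverters (g : gT) (z : F) : {set gT} :=
  [set c : gT | GLval c *m GLval g == z *: GLval g^-1%g *m GLval c].

Lemma twistedP (g : gT) (z : F) (c : gT) :
  reflect (GLval c *m GLval g = z *: GLval g^-1%g *m GLval c) (c \in twisted_inverters g z).
Proof. by rewrite /twisted_inverters in_set; apply: eqP. Qed.

Lemma inverters_twisted (g c : gT) :
  reflect (exists2 z, z != 0 & c \in twisted_inverters g z) (c \in inverters g).
Proof.
have -> : (c \in inverters g) = (coset Z (c * g * c^-1)%g == coset Z g^-1)%g.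
  by rewrite inE !(full_cosetM (@GL_normZ _ _)) !(full_cosetV (@GL_normZ _ _)).
apply: (iffP (GL_cosetP _ _)) => [[z z0 e]|[z z0 /twistedP e]]; exists z => //.
  by apply/twistedP; rewrite -e !GL_MxE -!mulmxA (GL_mulVmx c) mulmx1.
by rewrite !GL_MxE e -mulmxA (GL_mulmxV c) mulmx1.
Qed.

Lemma real_PSL_inverter (g : gT) : real_elt (PSL n F) (coset Z g) -> exists c, c \in inverters g.
Proof.
case/existsP => y /andP[_ yg]; have [c _ yE] := cosetP y.
by exists c; rewrite inE -yE.
Qed.

Lemma card_inverters (g c0 : gT) : c0 \in inverters g ->
  #|inverters g| = #|(coset Z @*^-1 'C[coset Z g])%g|.
Proof.
rewrite inE => /eqP e0; rewrite -(card_lcoset _ c0); apply: eq_card => c.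
rewrite mem_lcoset (mem_cosetpre_cent1 (@GL_normZ _ _)) inE.
rewrite (full_cosetM (@GL_normZ _ _)) (full_cosetV (@GL_normZ _ _)).
rewrite -e0 eq_sym; set x := coset Z c; set y := coset Z g; set x0 := coset Z c0.
rewrite -(inj_eq (mulIg x)) mulgKV -(inj_eq (mulgI x0^-1)%g) !mulgA mulVg mul1g.
by rewrite eq_sym.
Qed.

Lemma card_inverters_sum g : #|inverters g| = (\sum_(z : F | z != 0%R) #|twisted_inverters g z|)%N.
Proof.
rewrite -sum1_card.
under [RHS]eq_bigr do rewrite -sum1_card.
rewrite (exchange_big_dep (mem (inverters g))) /=; last first.
  by move=> z c z0 cz; apply/inverters_twisted; exists z.
apply: eq_bigr => c /inverters_twisted[z z0 cz].
rewrite (big_pred1 z) // => w /=; apply/andP/eqP => [[w0 cw]|-> //].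
move: cz cw => /twistedP ez /twistedP/esym; rewrite ez -!scalemxAl => /eqP; rewrite -subr_eq0 -scalerBl scaler_eq0 subr_eq0 => /orP[/eqP//|].
rewrite -GL_MxE => /eqP e; have := GL_det (g^-1 * c)%g; rewrite e.
by rewrite det0 eqxx.
Qed.

Lemma card_twisted_inverters g z c0 : c0 \in twisted_inverters g z ->
  #|twisted_inverters g z| = #|'C[g]%g|.
Proof.
move=> /twistedP e0; rewrite -(card_lcoset _ c0); apply: eq_card => c.
rewrite mem_lcoset -[in LHS](mulKVg c0 c); move: (c0^-1 * c)%g => {c} d.
apply/twistedP/cent1P; rewrite !GL_MxE mulmxA -e0 -!mulmxA => e; last by congr (_ *m _); rewrite -!GL_MxE e.
apply: val_inj; change (GLval d *m GLval g = GLval g *m GLval d).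
by have := congr1 (mulmx (GLval c0^-1%g)) e; rewrite !mulmxA (GL_mulVmx c0) !mul1mx.
Qed.

End RealClasses.

(** * Inverters and reciprocal tuples *)

Section TwistedCount.
Variables (F : finFieldType) (n' : nat) (nu : seq nat).
Local Notation n := n'.+1.
Local Notation gT := {'GL_n[F]}.
Local Notation nn i := (count_mem (i : nat) nu).
Hypothesis nuP : is_partition n nu.

Definition GLdata (g : gT) : nat -> {poly F} := projT1 (cid (data_exists (GLval g))).

Lemma GLdataP g : has_data (GLval g) (GLdata g).
Proof. exact: projT2 (cid (data_exists (GLval g))). Qed.

Definition data_tuple (g : gT) : {ffun 'I_n.+1 -> {poly_n.+1 F}} :=
  [ffun i : 'I_n.+1 => NPoly (data_size_le i (GLdataP g))].

Lemma data_tupleE g (i : 'I_n.+1) : polyn (data_tuple g i) = GLdata g i.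
Proof. by rewrite ffunE. Qed.

Lemma GLdata_coef0 g i : (GLdata g i)`_0 != 0.
Proof. exact: data_coef0 (oner_neq0 F) (GL_mulmxV g) (GLdataP g). Qed.

Lemma GLdata_eq g u : has_data (GLval g) u <-> GLdata g = u.
Proof.
split=> [gu|<-]; [exact: data_uniq (GLdataP g) gu|exact: GLdataP].
Qed.

Lemma GLdata_out g (u : nat -> {poly F}) : (forall i, ~~ (0 < i <= n)%N -> u i = 1) ->
  (forall i : 'I_n.+1, GLdata g i = u i) -> GLdata g = u.
Proof.
move=> u1 e; apply/funext => i; have [im|im] := boolP (i < n.+1)%N; first exact: (e (Ordinal im)).
have im' : ~~ (0 < i <= n)%N by rewrite -[(i <= _)%N]ltnS (negPf im) andbF.
by rewrite u1 // (data_out (GLdataP g)).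
Qed.

Lemma data_tuple_class g h : (data_tuple g == data_tuple h) = (g \in h ^: [set: gT])%g.
Proof.
apply/eqP/imsetP => [e|[c _ ->]].
  have {}e : GLdata g = GLdata h.
    apply: GLdata_out => [i|i]; first exact: (data_out (GLdataP h)).
    by rewrite -!data_tupleE e.
  have gh := GLdataP g; rewrite e in gh.
  have [M [M' [MM' _ Mh]]] := data_similar gh (GLdataP h).
  have [c cE] := GL_of_unitmx (proj1 (mulmx1_unit MM')).
  exists c; rewrite ?inE //; apply: (mulgI c); rewrite mulKVg.
  by apply: val_inj; change (GLval c *m GLval g = GLval h *m GLval c); rewrite cE.
apply/ffunP => i; apply: val_inj; rewrite /= !data_tupleE; suff -> : GLdata (h ^ c)%g = GLdata h by [].
apply/GLdata_eq; apply: (data_conj (GL_mulVmx c)) (GLdataP h).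
by rewrite -!GL_MxE conjgE -!mulgA mulgV mulg1.
Qed.

Lemma twisted_inverter_data g z : z != 0 ->
  (exists c, c \in twisted_inverters g z) <-> (forall i, star z (GLdata g i) = GLdata g i).
Proof.
move=> z0; have gz : (GLval g) *m (z *: GLval g^-1%g) = z%:M.
  by rewrite -scalemxAr (GL_mulmxV g) scalemx1.
have gs := data_recip z0 gz (GLdataP g).
split=> [[c /twistedP cg] i|e].
  have gu := data_conj (GL_mulmxV c) cg (GLdataP g).
  by have /(congr1 (fun u => u i)) := data_uniq gs gu.
have {}gs : has_data (z *: GLval g^-1%g) (GLdata g) by congr (has_data _ _): gs; apply/funext.
have [M [M' [MM' _ Mg]]] := data_similar (GLdataP g) gs.
have [c cE] := GL_of_unitmx (proj1 (mulmx1_unit MM')).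
by exists c; apply/twistedP; rewrite cE.
Qed.

Lemma recip_tuplesP g z : z != 0 ->
  reflect [/\ is_pow n (\det (GLval g)), mx_has_type (GLval g) nu & exists c, c \in twisted_inverters g z]
    (data_tuple g \in recip_tuples n nu z).
Proof.
move=> z0.
have detE : \det (GLval g) = \prod_(i < n.+1) pdet (data_tuple g i) ^+ i.
  by rewrite (data_det (GLdataP g)); apply: eq_bigr => i _; rewrite -data_tupleE.
have monE i : GLdata g i \is monic := data_monic i (GLdataP g).
have nnE : mx_has_type (GLval g) nu <-> (forall i, count_mem i nu = (size (GLdata g i)).-1).
  exact: mx_has_type_data (GLdataP g).
rewrite inE -detE; apply: (iffP andP) => [[/familyP uR ->]|[-> /nnE gnu /(twisted_inverter_data g z0) gz]].
  have {}uR (i : 'I_n.+1) : size (GLdata g i) = (nn i).+1 /\ star z (GLdata g i) = GLdata g i.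
    by have := uR i; rewrite inE data_tupleE => /and4P[_ /eqP-> _ /eqP].
  have out i : ~~ (i < n.+1)%N -> GLdata g i = 1 /\ nn i = 0%N.
    move=> im; split; first by rewrite (data_out (GLdataP g)) // -[(i <= _)%N]ltnS (negPf im) andbF.
    by apply/count_memPn; apply: contra im => /(part_le nuP); rewrite ltnS.
  split=> //; [apply/nnE => i|apply/(twisted_inverter_data g z0) => i].
    have [im|/out[-> ->]] := boolP (i < n.+1)%N; last by rewrite size_poly1.
    by have [/= -> _] := uR (Ordinal im).
  have [im|/out[-> _]] := boolP (i < n.+1)%N; last exact: star1.
  by have [] := uR (Ordinal im).
split=> //; apply/familyP => i; rewrite inE data_tupleE monE GLdata_coef0 gz eqxx.
by rewrite gnu prednK ?eqxx // size_poly_gt0 monic_neq0.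
Qed.

Lemma recip_tuple_realized z u : z != 0 -> u \in recip_tuples n nu z -> exists g, data_tuple g = u.
Proof.
move=> z0; rewrite inE => /andP[/familyP uR _].
have {}uR (i : 'I_n.+1) : [/\ polyn (u i) \is monic, size (u i) = (nn i).+1 & (u i)`_0 != 0].
  by have := uR i; rewrite inE => /and4P[-> /eqP->].
pose v i : {poly F} := if (i < n.+1)%N then polyn (u (inord i)) else 1.
have vE (i : 'I_n.+1) : v i = polyn (u i) by rewrite /v ltn_ord inord_val.
have vm i : v i \is monic.
  by rewrite /v; case: ifP => _; [have [] := uR (inord i)|exact: monic1].
have v1 i : ~~ (0 < i <= n)%N -> v i = 1.
  rewrite /v ltnS; case: (posnP i) => [->|i0] /=; last by move/negPf->.
  move=> _; have [um us _] := uR (inord 0); rewrite inordK // in us.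
  (* Parts are positive, so the component of index 0 is monic of degree 0. *)
  have nn0 : nn 0 = 0%N by apply/count_memPn; case/and3P: nuP.
  rewrite nn0 in us; have uC := size1_polyC (eq_leq us).
  by move: um; rewrite uC; move: (_`_0) => c; rewrite monicE lead_coefC => /eqP->.
have vdim : (\sum_(i < n.+1) i * (size (v i)).-1 = n)%N.
  rewrite -[RHS](sum_parts nuP); apply: eq_bigr => i _; rewrite vE.
  by have [_ -> _] := uR i.
have [M Mv] := data_model vm v1 vdim.
have MU : M \in unitmx.
  rewrite unitmxE unitfE (data_det Mv); apply/prodf_neq0 => i _; rewrite expf_neq0 // vE.
  by rewrite mulf_neq0 ?signr_eq0 //; have [] := uR i.
have [g gE] := GL_of_unitmx MU; exists g; apply/ffunP => i; apply: val_inj.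
have gv : GLdata g = v by apply/GLdata_eq; rewrite gE.
by rewrite /= data_tupleE -vE gv.
Qed.

(** The matrices with a nonempty set of inverters for [z] form one GL-class for each tuple, and over
    a class the orders of the centralizers add up to the order of the group. *)
Lemma sum_card_twisted_inverters z : z != 0 ->
  (\sum_(g : gT | is_pow n (\det (GLval g)) && `[< mx_has_type (GLval g) nu >]) #|twisted_inverters g z|
   = #|recip_tuples n nu z| * #|[set: gT]|)%N.
Proof.
move=> z0; rewrite (bigID (fun g => data_tuple g \in recip_tuples n nu z)) /= addnC big1 => [|g]; last first.
  case/andP=> /andP[dg /asboolP gnu] /recip_tuplesP ng; apply: eq_card0 => c.
  by apply/negbTE/negP => cg; case: (ng z0); split=> //; exists c.
rewrite add0n (eq_bigl (fun g => data_tuple g \in recip_tuples n nu z)); last first.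
  move=> g; apply: andb_idl => /(recip_tuplesP g z0)[-> gnu _]; exact/asboolP.
rewrite (partition_big data_tuple (mem (recip_tuples n nu z))) //= -sum_nat_const.
apply: eq_bigr => u uR; have [h hu] := recip_tuple_realized z0 uR.
rewrite -(sum_card_cent1 (in_setT h)); apply: eq_big => [g|g /andP[gR _]].
  rewrite -data_tuple_class hu; apply: andb_idl => /eqP->; exact: uR.
have [_ _ [c cg]] := recip_tuplesP g z0 gR.
by rewrite (card_twisted_inverters cg) setTI.
Qed.

End TwistedCount.

(** * Real classes of the projective special linear group *)

Section RealPSL.
Variables (F : finFieldType) (n' : nat).
Local Notation n := n'.+1.
Local Notation q := #|F|.
Local Notation gT := {'GL_n[F]}.
Local Notation Z := 'Z('GL_n[F])%G.
Local Notation PSLn := (PSL n F).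

Hypothesis hq : ~~ odd q \/ (n`_2 <> q.-1`_2)%N.

Lemma inverter_strongly_real (g c : gT) : is_pow n (\det (GLval g)) -> c \in inverters g ->
  strongly_real_elt PSLn (coset Z g).
Proof.
move=> dg /inverters_twisted[z z0 /twistedP cg].
have gz : (GLval g) *m (z *: GLval g^-1%g) = z%:M.
  by rewrite -scalemxAr (GL_mulmxV g) scalemx1.
have [M [MM Mg dM]] := inverting_involution_is_pow (ltn0Sn n') hq z0 gz (GL_mulmxV c) cg dg.
have [h hM] := GL_of_unitmx (proj1 (mulmx1_unit MM)).
have : h \in inverters g by apply/inverters_twisted; exists z => //; apply/twistedP; rewrite hM.
rewrite inE => hg; apply/existsP; exists (coset Z h); rewrite mem_PSL hM dM hg /=.
apply/eqP/(full_coset_sqr1 (@GL_normZ _ _)).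
by apply: val_inj; change (GLval h *m GLval h = 1%:M); rewrite hM.
Qed.

Lemma real_PSL_strongly_real (y : coset_of Z) : y \in PSLn -> real_elt PSLn y -> strongly_real_elt PSLn y.
Proof.
have [g _ ->] := cosetP y; rewrite mem_PSL => dg /real_PSL_inverter[c]; exact: inverter_strongly_real.
Qed.

(** An inverter in PGL can be replaced by one in PSL because the strong reality construction
    produces an involution of suitable determinant. *)
Lemma real_PSL_inverterP (g : gT) : is_pow n (\det (GLval g)) ->
  reflect (exists c, c \in inverters g) (real_elt PSLn (coset Z g)).
Proof.
move=> dg; apply: (iffP idP) => [|[c /(inverter_strongly_real dg)/existsP[h]]].
  exact: real_PSL_inverter.
by case/and3P=> hP hg _; apply/existsP; exists h; rewrite hP.
Qed.

Section GivenType.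
Variable nu : seq nat.
Hypothesis nuP : is_partition n nu.

(** The exponents [a j] are the parts of [nu], so the upper bound from [det_scaled_commutant] and
    the lower bound from [det_centralizer] meet at their gcd [D]. *)
Lemma card_SL_commutant (g : gT) : mx_has_type (GLval g) nu ->
  (#|SL n F :&: (coset Z @*^-1 'C[coset Z g])%g| * q.-1
   = #|(coset Z @*^-1 'C[coset Z g])%g| * hpart q nu)%N.
Proof.
case/mx_has_typeP => u [I [v [f [a [d uE]]]]] nuE.
have f0 := primary_dec_coef0 (oner_neq0 F) (GL_mulmxV g) d.
have partsP i : i \in nu <-> exists j, a j = i.
  rewrite -has_pred1 has_count nuE uE; split=> [|[j <-]].
    have [j /eqP aj|no] := pickP (fun j => a j == i); first by exists j.
    by rewrite big_pred0 // size_poly1.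
  rewrite size_prod_monic => [|k _]; last exact: monic_irred_neq0 (proj1 (proj1 d k)).
  rewrite (bigD1 j) //= ltn_addr //; have [[fs _] _] := proj1 (proj1 d j).
  by rewrite -subn1 subn_gt0.
pose D := (\big[gcdn/0]_j a j)%N.
have DE : hpart q nu = gcdn q.-1 D.
  congr gcdn; apply/eqP; rewrite eqn_dvd; apply/andP; split.
    apply: (big_ind (fun k => _ %| k)%N) => [|k l ? ?|j _]; rewrite ?dvdn0 ?dvdn_gcd //.
      by apply/andP.
    have : a j \in nu by apply/partsP; exists j.
    by elim: nu => // i s IHs; rewrite inE big_cons => /predU1P[->|/IHs]; [exact: dvdn_gcdl|apply: dvdn_trans; exact: dvdn_gcdr].
  rewrite big_seq; apply: (big_ind (fun k => _ %| k)%N) => [|k l ? ?|i /partsP[j <-]]; rewrite ?dvdn0 ?dvdn_gcd //.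
    by apply/andP.
  by rewrite /D (bigD1 j) //= dvdn_gcdl.
have D0 : (0 < D)%N.
  rewrite lt0n; apply/negP => /eqP D0; have := primary_dec_dim d.
  rewrite big1 // => j _; have : (D %| a j)%N by rewrite /D (bigD1 j) //= dvdn_gcdl.
  by rewrite D0 dvd0n => /eqP->.
rewrite DE; apply: (@card_SL_det_pow _ _ [group of (coset Z @*^-1 'C[coset Z g])%g]) => //= [c|y y0].
  rewrite (mem_cosetpre_cent1 (@GL_normZ _ _)) -!(full_cosetM (@GL_normZ _ _)).
  case/GL_cosetP => mu mu0; rewrite !GL_MxE => cg.
  apply: (det_scaled_commutant d f0 (GL_unitmx c) mu0) => [|j].
    by rewrite cg scalemxAl.
  by rewrite /D (bigD1 j) //= dvdn_gcdl.
have [M [MU Mg dM]] := det_centralizer d y0.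
have [c cM] := GL_of_unitmx MU; exists c; last by rewrite cM.
rewrite (mem_cosetpre_cent1 (@GL_normZ _ _)) -!(full_cosetM (@GL_normZ _ _)).
by apply/GL_cosetP; exists 1; rewrite ?oner_neq0 // scale1r !GL_MxE cM.
Qed.

Definition real_PSL_type : {set coset_of Z} :=
  [set y in PSLn | real_elt PSLn y && `[< PGL_has_type y nu >]].

Lemma coset_real_PSL_type (g : gT) : (coset Z g \in real_PSL_type) =
  [&& is_pow n (\det (GLval g)), real_elt PSLn (coset Z g) & `[< mx_has_type (GLval g) nu >]].
Proof.
rewrite /real_PSL_type in_set mem_PSL; congr [&& _, _ & _].
by apply/asbool_equiv_eq; apply: PGL_has_typeE.
Qed.

Lemma real_PSL_type_norm : (PSLn \subset 'N(real_PSL_type))%g.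
Proof.
apply/subsetP => x xP; rewrite inE; apply/subsetP => _ /imsetP[y yY ->].
move: yY; rewrite !inE => /and3P[yP /existsP[h /andP[hP /eqP hy]] /asboolP yt].
rewrite groupJ //=; apply/andP; split.
  by apply/existsP; exists (h ^ x)%g; rewrite groupJ //= -conjVg -!conjMg hy conjVg.
apply/asboolP; have [g _ gE] := cosetP y; have [c _ cE] := cosetP x.
rewrite gE cE in yt *; rewrite /conjg -(full_cosetV (@GL_normZ _ _)) -!(full_cosetM (@GL_normZ _ _)).
apply/PGL_has_typeE; move/PGL_has_typeE: yt; apply: (mx_has_type_conj (GL_mulVmx c)).
by rewrite -!GL_MxE -!mulgA mulgV mulg1.
Qed.

Lemma sum_real_PSL_type :
  (\sum_(g : gT | coset Z g \in real_PSL_type) #|(coset Z @*^-1 'C[coset Z g])%g|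
   = (\sum_(z : F | z != 0%R) #|recip_tuples n nu z|) * #|[set: gT]|)%N.
Proof.
rewrite big_distrl /= -(eq_bigr _ (fun z z0 => sum_card_twisted_inverters nuP z0)).
rewrite exchange_big /=.
rewrite -(eq_bigr _ (fun g _ => card_inverters_sum g)).
rewrite [RHS](bigID (fun g : gT => coset Z g \in real_PSL_type)) /= [X in (_ + X)%N]big1 => [|g]; last first.
  case/andP=> /andP[dg gnu]; rewrite coset_real_PSL_type dg gnu andbT /= => /(real_PSL_inverterP dg) nc.
  by apply: eq_card0 => c; apply/negbTE/negP => cg; apply: nc; exists c.
rewrite addn0; apply: eq_big => [g|g].
  by apply/esym/andb_idl; rewrite coset_real_PSL_type => /and3P[-> _ ->].
rewrite coset_real_PSL_type => /and3P[dg /(real_PSL_inverterP dg)[c cg] _].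
by rewrite (card_inverters cg).
Qed.

Theorem card_real_PSL_classes :
  (#|[set C in classes PSLn | real_class PSLn C & `[< class_has_type C nu >]]|)%:R
   = (hpart q nu)%:R * psl q n nu :> rat.
Proof.
have -> : [set C in classes PSLn | real_class PSLn C & `[< class_has_type C nu >]]
        = [set C in classes PSLn | C \subset real_PSL_type].
  apply/setP => C; rewrite !inE; case: (boolP (C \in classes PSLn)) => //= CP.
  have CPS : C \subset PSLn by case/imsetP: CP => x xP ->; apply: class_subG.
  apply/andP/subsetP => [[/forall_inP Cr /asboolP Ct] y yC|CY].
    by rewrite inE (subsetP CPS) //= Cr //=; apply/asboolP; apply: Ct.
  split; first by apply/forall_inP => y /CY; rewrite inE => /and3P[].
  by apply/asboolP => y /CY; rewrite inE => /and3P[_ _ /asboolP].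
set N := #|_|.
have YP : real_PSL_type \subset PSLn by apply/subsetP => y; rewrite inE => /andP[].
have count := card_classes_sub YP real_PSL_type_norm.
have sumC := sum_cent1_quotient [group of SL n F] (@GL_normZ _ _) real_PSL_type.
have quoE := card_quotientI (@GL_normZ F n') [group of SL n F].
have slE := card_SL F n'; have zE := card_GL_center F n'.
(* [A] is evaluated by classes in [AE] and by pairs in [BE]; comparing the two and cancelling |GL| =
   |SL| (q - 1) gives [NE]. *)
pose A := (\sum_(g : gT | coset Z g \in real_PSL_type) #|SL n F :&: (coset Z @*^-1 'C[coset Z g])%g|)%N.
have AE : (N * #|SL n F| * q.-1 = A)%N.
  by rewrite -zE -quoE /A -sumC -count /= mulnA.
have BE : (A * q.-1 = (\sum_(z : F | z != 0%R) #|recip_tuples n nu z|) * #|[set: gT]| * hpart q nu)%N.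
  rewrite -sum_real_PSL_type !big_distrl; apply: eq_bigr => g.
  by rewrite coset_real_PSL_type => /and3P[_ _ /asboolP gnu]; apply: card_SL_commutant.
have total := card_recip_tuples_total (ltn0Sn n') nuP hq.
have S0 : (0 < #|SL n F| * q.-1)%N by rewrite muln_gt0 (cardG_gt0 [group of SL n F]) card_pred_gt0.
have NE : (N * q.-1 = (\sum_(z : F | z != 0%R) #|recip_tuples n nu z|) * hpart q nu)%N.
  apply/eqP; rewrite -(eqn_pmul2r S0); apply/eqP.
  by rewrite mulnAC mulnA AE BE -slE mulnAC.
have q0 : (q.-1%:R : rat) != 0 by rewrite Num.Theory.pnatr_eq0 -lt0n card_pred_gt0.
by apply: (mulIf q0); rewrite -natrM NE natrM natr_sum total mulrC mulrA mulrAC.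
Qed.

End GivenType.
End RealPSL.

Theorem theorem8p6 (F : finFieldType) (n : nat) (n_gt0 : (0 < n)%N)
    (hq : ~~ odd #|F| \/ (n`_2 <> (#|F|.-1)`_2)%N) :
  (forall nu : seq nat, is_partition n nu ->
     (#|[set C in classes (PSL n F) |
          real_class (PSL n F) C & `[< class_has_type C nu >]]|)%:R
       = (hpart #|F| nu)%:R * psl #|F| n nu :> rat)
  /\
  (forall C : {set coset_of 'Z('GL_n[F])}, C \in classes (PSL n F) ->
     real_class (PSL n F) C -> strongly_real_class (PSL n F) C).
Proof.
case: n n_gt0 hq => // n' _ hq'; split=> [nu nuP|C CP /forall_inP Cr].
  exact: card_real_PSL_classes.
apply/forall_inP => y yC; apply: real_PSL_strongly_real => //; last exact: Cr.
by case/imsetP: CP yC => x xP -> /(subsetP (class_subG xP (subxx _))).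
Qed.
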